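(* Let $\rho(\theta)$, $\theta\in\Theta\subseteq\mathbb R^p$, be a smooth quantum statistical model of $d\times d$ density matrices, fix $\theta$, and let $\mathcal C_G=\mathcal C_G(\theta)$, $\mathcal C^K=\mathcal C^K(\theta)$, $\mathcal V$, $\mathcal I$ be as defined in the context. Then: (i) For every positive-definite real symmetric $p\times p$ matrix $K$, every $N$ and every measurement $M=M^{(N)}$ on $N$ copies of the system, the average Fisher information matrix $\overline I_M=\overline I_M^{(N)}(\theta)$ satisfies $$\mathrm{trace}\,K\,\overline I_M\ \le\ \mathcal C^K .$$ (ii) If $G_0$ is positive-definite real symmetric and $I_0\in\mathcal I$ satisfies $\mathrm{trace}\,G_0I_0^{-1}=\mathcal C_{G_0}$, then with $K_0=I_0^{-1}G_0I_0^{-1}$ one has $\mathcal C^{K_0}=\mathcal C_{G_0}$. Conversely, if $K_0$ is positive-definite real symmetric and $I_0\in\mathcal I$ satisfies $\mathrm{trace}\,K_0I_0=\mathcal C^{K_0}$, then with $G_0=I_0K_0I_0$ one has $\mathcal C_{G_0}=\mathcal C^{K_0}$. (iii) None of the bounds is redundant, in the sense that for all positive-definite real symmetric $G$ and $K$, $$\mathcal C_G=\inf_{V\in\mathcal V}\mathrm{trace}(GV)\qquad\text{and}\qquad \mathcal C^K=\sup_{I\in\mathcal I}\mathrm{trace}(KI),$$ and for each such $G$ there is a unique minimizer $V\in\mathcal V$ in the first equation.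
   Context: States and measurements. A $d\times d$ density matrix is a self-adjoint non-negative complex matrix of trace one. A quantum statistical model is a family $\rho(\theta)$ of $d\times d$ density matrices indexed by a real column vector $\theta\in\Theta\subseteq\mathbb R^p$; smooth means once continuously differentiable. The joint state of $N$ copies is $\rho(\theta)^{\otimes N}$ on $(\mathbb C^d)^{\otimes N}$. A (collective) measurement $M^{(N)}$ on $N$ copies is a positive operator valued measure on a measurable space $(\mathcal X,\mathcal B)$: a sigma-additive map assigning to each $B\in\mathcal B$ a non-negative self-adjoint $d^N\times d^N$ matrix $M^{(N)}(B)$, with $M^{(N)}(\mathcal X)=\mathbf 1$. The outcome has distribution $\Pr(\text{outcome}\in B)=\mathrm{trace}(\rho(\theta)^{\otimes N}M^{(N)}(B))$. The average Fisher information matrix $\overline I_M^{(N)}(\theta)$ is $1/N$ times the $p\times p$ Fisher information matrix for $\theta$ in the outcome of $M^{(N)}$. Holevo bound. For a positive-definite real symmetric $p\times p$ matrix $G$, $$\mathcal C_G(\theta)=\inf\{\mathrm{trace}(GV): V\ge Z(\vec X)\},$$ the infimum being over real symmetric $p\times p$ matrices $V$ and over $\vec X=(X_1,\dots,X_p)$, where the $X_i$ are $d\times d$ self-adjoint matrices satisfying $\frac{\partial}{\partial\theta_i}\mathrm{trace}(\rho(\theta)X_j)=\delta_{ij}$ for all $i,j$ (the $X_j$ held fixed in the differentiation); $Z(\vec X)$ is the $p\times p$ self-adjoint matrix with entries $\mathrm{trace}(\rho(\theta)X_iX_j)$; $\ge$ is the ordering of self-adjoint matrices. It is assumed that the bound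 is finite, i.e. that there is some $\vec X$ satisfying the constraints. (The Holevo family of lower bounds on average inverse information is $\mathrm{trace}\,G\,\overline I_M^{-1}\ge\mathcal C_G$ for each positive-definite $G$.) Sets. $\mathcal V$ and $\mathcal I$ are the following sets of positive-definite symmetric real $p\times p$ matrices, where $G$ ranges over all positive-definite symmetric real $p\times p$ matrices: $$\mathcal V=\{V:\mathrm{trace}(GV)\ge\mathcal C_G(\theta)\ \forall G\},\qquad \mathcal I=\{I:\mathrm{trace}(GI^{-1})\ge\mathcal C_G(\theta)\ \forall G\}.$$ Dual bound. For positive-definite real symmetric $K$, $\mathcal C^K=\mathcal C^K(\theta)$ is the number for which $\{I:\mathrm{trace}(KI)=\mathcal C^K\}$ is the supporting hyperplane, with normal $K$, bounding $\mathcal I$ from above, i.e. the least constant such that $\mathrm{trace}(KI)\le\mathcal C^K$ for all $I\in\mathcal I$. *)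

(* Defs.v *)
From HB Require Import structures.
From mathcomp Require Import all_boot all_order all_algebra.
From mathcomp Require Import complex mxtens.
From mathcomp Require Import all_classical all_reals all_analysis.

Set Implicit Arguments.
Unset Strict Implicit.
Unset Printing Implicit Defensive.

Import Order.TTheory GRing.Theory Num.Theory.
Import numFieldNormedType.Exports.

Local Open Scope classical_set_scope.
Local Open Scope ring_scope.
Local Open Scope complex_scope.
Local Open Scope sesquilinear_scope.

Definition psd (R : realType) (n : nat) (A : 'M[R[i]]_n) : Prop :=
  A \is hermsymmx /\ forall v : 'cV[R[i]]_n, 0 <= (v ^t* *m A *m v) 0 0.

Definition posdef_sym (R : realType) (p : nat) (A : 'M[R]_p) : Prop :=
  A^T = A /\ forall v : 'cV[R]_p, v != 0 -> 0 < (v^T *m A *m v) 0 0.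

Definition density_matrix (R : realType) (d : nat) (A : 'M[R[i]]_d) : Prop :=
  psd A /\ \tr A = 1.

Definition basis_vec (R : realType) (p : nat) (k : 'I_p) : 'cV[R]_p :=
  delta_mx k 0.

Definition C1_on (R : realType) (p : nat) (U : set 'cV[R]_p)
    (f : 'cV[R]_p -> R) : Prop :=
  forall t, U t -> forall k : 'I_p,
    derivable f t (basis_vec R k) /\
    {for t, continuous ('D_(basis_vec R k) f)}.

(* Partial derivatives are two-sided, so they are only imposed at the interior
   points of the parameter set; for open [Theta] this is all of [Theta]. *)
Definition smooth_quantum_model (R : realType) (d p : nat)
    (Theta : set 'cV[R]_p) (rho : 'cV[R]_p -> 'M[R[i]]_d) : Prop :=
  (forall t, Theta t -> density_matrix (rho t)) /\
  (forall i j : 'I_d,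
     C1_on (interior Theta) (fun t => complex.Re (rho t i j)) /\
     C1_on (interior Theta) (fun t => complex.Im (rho t i j))).

Fixpoint tensor_dim (d N : nat) : nat :=
  if N is N'.+1 then (d * tensor_dim d N')%N else 1%N.

Lemma tensor_dimE (d N : nat) : tensor_dim d N = (d ^ N)%N.
Proof. by elim: N => //= N ->; rewrite expnS. Qed.

(* The recursive form of the dimension [d ^ N] avoids casts. *)
Fixpoint tensor_power (R : realType) (d : nat) (A : 'M[R[i]]_d) (N : nat) :
    'M[R[i]]_(tensor_dim d N) :=
  if N is N'.+1 then A *t tensor_power A N' else 1%:M.

Record povm (disp : measure_display) (T : measurableType disp)
    (R : realType) (n : nat) : Type := Povm {
  povm_mx :> set T -> 'M[R[i]]_n;
  povm_psd : forall B, measurable B -> psd (povm_mx B);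
  povm_setT : povm_mx setT = 1%:M;
  povm_sigma_additive : forall F : (set T)^nat,
    (forall k, measurable (F k)) -> trivIset setT F ->
    forall i j : 'I_n,
      ((fun m => \sum_(0 <= k < m) complex.Re (povm_mx (F k) i j)) @ \oo -->
         complex.Re (povm_mx (\bigcup_k F k) i j)) /\
      ((fun m => \sum_(0 <= k < m) complex.Im (povm_mx (F k) i j)) @ \oo -->
         complex.Im (povm_mx (\bigcup_k F k) i j)) }.

Definition outcome_law (R : realType) (d p N : nat)
    (rho : 'cV[R]_p -> 'M[R[i]]_d)
    (disp : measure_display) (T : measurableType disp)
    (M : povm T R (tensor_dim d N)) (t : 'cV[R]_p) (B : set T) : R :=
  complex.Re (\tr (tensor_power (rho t) N *m M B)).

(* No sign is imposed on the density [f t]: it is nonnegative almost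
   everywhere as soon as [P t] takes nonnegative values. *)
Definition density_family (R : realType) (p : nat)
    (disp : measure_display) (T : measurableType disp)
    (Theta : set 'cV[R]_p) (P : 'cV[R]_p -> set T -> R)
    (mu : {sigma_finite_measure set T -> \bar R})
    (f : 'cV[R]_p -> T -> R) : Prop :=
  forall t, Theta t ->
    mu.-integrable setT (EFin \o f t) /\
    forall B, measurable B -> (P t B)%:E = (\int[mu]_(x in B) (f t x)%:E)%E.

Definition score (R : realType) (p : nat) (T : Type)
    (f : 'cV[R]_p -> T -> R) (theta : 'cV[R]_p) (k : 'I_p) (x : T) : R :=
  'D_(basis_vec R k) (fun t => ln (f t x)) theta.

(* [I] is the matrix of the expectations of [score i * score j] under [P theta].
   It is stated as a relation because it refers to a dominating measure and to
   versions of the densities; the value of [I] does not depend on them. Where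
   [f theta x = 0] the integrand is zero, whatever the value of the score. *)
Definition is_fisher_information (R : realType) (p : nat)
    (disp : measure_display) (T : measurableType disp)
    (Theta : set 'cV[R]_p) (P : 'cV[R]_p -> set T -> R)
    (theta : 'cV[R]_p) (I : 'M[R]_p) : Prop :=
  exists (mu : {sigma_finite_measure set T -> \bar R})
         (f : 'cV[R]_p -> T -> R),
    [/\ density_family Theta P mu f,
        {ae mu, forall x, forall k : 'I_p,
           derivable (fun t => f t x) theta (basis_vec R k)} &
        forall i j : 'I_p,
          let g x := score f theta i x * score f theta j x * f theta x in
          mu.-integrable setT (EFin \o g) /\
          I i j = (\int[mu]_x g x)%R].

Definition locally_unbiased (R : realType) (d p : nat)
    (rho : 'cV[R]_p -> 'M[R[i]]_d) (theta : 'cV[R]_p)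
    (X : 'I_p -> 'M[R[i]]_d) : Prop :=
  (forall j, X j \is hermsymmx) /\
  (forall i j : 'I_p,
     'D_(basis_vec R i) (fun t => complex.Re (\tr (rho t *m X j))) theta
     = (i == j)%:R).

Definition Zmx (R : realType) (d p : nat) (r : 'M[R[i]]_d)
    (X : 'I_p -> 'M[R[i]]_d) : 'M[R[i]]_p :=
  \matrix_(i, j) \tr (r *m X i *m X j).

(* The constraint set is bounded below by 0; [inf] is meaningful once a locally
   unbiased [X] exists. *)
Definition holevo (R : realType) (d p : nat)
    (rho : 'cV[R]_p -> 'M[R[i]]_d) (theta : 'cV[R]_p) (G : 'M[R]_p) : R :=
  inf [set \tr (G *m V) | V in [set V : 'M[R]_p | V^T = V /\
         exists X, locally_unbiased rho theta X /\
           psd (map_mx (real_complex R) V - Zmx (rho theta) X)]].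

Definition calV (R : realType) (d p : nat)
    (rho : 'cV[R]_p -> 'M[R[i]]_d) (theta : 'cV[R]_p) : set 'M[R]_p :=
  [set V | posdef_sym V /\
     forall G, posdef_sym G -> holevo rho theta G <= \tr (G *m V)].

Definition calI (R : realType) (d p : nat)
    (rho : 'cV[R]_p -> 'M[R[i]]_d) (theta : 'cV[R]_p) : set 'M[R]_p :=
  [set I | posdef_sym I /\
     forall G, posdef_sym G -> holevo rho theta G <= \tr (G *m invmx I)].

Definition dual_holevo (R : realType) (d p : nat)
    (rho : 'cV[R]_p -> 'M[R[i]]_d) (theta : 'cV[R]_p) (K : 'M[R]_p) : R :=
  inf [set c : R | forall I, calI rho theta I -> \tr (K *m I) <= c].

(* Main.v *)
Require Import Defs.
From HB Require Import structures.
From mathcomp Require Import all_boot all_order all_algebra.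
From mathcomp Require Import complex mxtens.
From mathcomp Require Import all_classical all_reals all_analysis measurable_realfun.
From mathcomp Require Import ring lra.

(**
The idea is to describe the Holevo bounds by one closed convex set. For a real
matrix [D] and a symmetric [V], call the pair [(D, V)] attainable when some
Hermitian family [Y] has responses [Re tr (drho_i Y_j) = D_ij] and covariance
matrix [Z(Y) <= V]. The Holevo bound is the infimum of [tr (G V)] over the [V]
such that [(1, V)] is attainable. The change of observables [Y |-> Y A] shows
that [(1, V)] is attainable if and only if [(V^-1, V^-1)] is, so that
covariances and informations are two views of the same set.

Attainability is closed ([attainable_limit]). The states are positive, hence the
form of [drho] vanishes on the kernel of [rho]; so the block of [Y] on this kernel
has no influence and can be removed, and what remains is bounded by [tr V]
([truncation]). It follows that the infimum is attained and, by a separating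
hyperplane, that [calV] consists exactly of the [V] with [(1, V)] attainable
([inV_feas]), and [calI] of the definite [I] with [(I, I)] attainable. Existence
of the minimizer and the two formulas of (iii) are immediate from this.

For the inequality in (i) it is enough that [(I/N, I/N)] is attainable for the
Fisher information [I] of every measurement on [N] copies: mix with an element of
[calI] to make it definite, and let the weight of that element tend to zero
([attain_le_dual]). For finitely many outcomes with scores [tau_j], take
[W_j = sum_b tau_j(b) M_b] and replace it by the sum over the copies of its
centred conditional expectations. This observable on one copy has the same
response, and its covariance is at most [N] times that of [W_j], by orthogonality
of the terms ([qform_reduce]); the covariance of [W_j] is at most the second
moment of the scores ([kadison]). In general the scores are approximated by step
functions ([score_cross_limit], [score_square_limit]) and closedness is applied.
The information exists because the density of the measurement with respect to its
trace is a matrix on which the law depends linearly, and because the square of the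
derivative of the density is at most a multiple of the density
([fisher_information_exists]).

Part (ii) is the convex duality of [V |-> V^-1]. If [I0] minimizes
[tr (G0 I^-1)] over the convex set [calI], then the derivative at [I0] in every
direction [I - I0] is nonnegative, which says that [I0] maximizes [tr (K0 I)]
([dual_of_primal]). Conversely the inequality [V^-1 >= 2 I0 - I0 V I0] turns a
maximizer of [tr (K0 I)] into a lower bound for [tr (G0 V)] ([primal_of_dual]).

Uniqueness in (iii) is not a matter of strict convexity of the objective, which is
linear. A Lagrange multiplier [H = G + i S] reduces the problem to the minimization
of the quadratic function [tr (H Z(X))], with complementary slackness
[H (V - Z(X)) = 0] ([multiplier], [slackness]). For two minimizers the slackness
relations give [H (V2 - V1) = H Z(X1, D)] with [D = X2 - X1], and stationarity along
all the combinations of [D] makes the real part of the right-hand side zero, that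
is, [G (V2 - V1) = 0] ([feas_minimizer_unique]).
*)

Set Implicit Arguments.
Unset Strict Implicit.
Unset Printing Implicit Defensive.

Import Order.TTheory GRing.Theory Num.Theory.
Import numFieldNormedType.Exports.

Local Open Scope classical_set_scope.
Local Open Scope ring_scope.
Local Open Scope sesquilinear_scope.

(** * Positive semidefinite complex matrices *)

Section Trace.
Variable K : pzRingType.

Lemma mxtraceN n (A : 'M[K]_n) : \tr (- A) = - \tr A.
Proof. exact: raddfN. Qed.

Lemma mxtraceB n (A B : 'M[K]_n) : \tr (A - B) = \tr A - \tr B.
Proof. exact: raddfB. Qed.

Lemma mxtrace_sum n (I : Type) (s : seq I) (P : pred I) (F : I -> 'M[K]_n) :
  \tr (\sum_(i <- s | P i) F i) = \sum_(i <- s | P i) \tr (F i).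
Proof. exact: raddf_sum. Qed.

End Trace.

Section Adjoint.
Variable C : numClosedFieldType.

Lemma adjM m n q (A : 'M[C]_(m, n)) (B : 'M[C]_(n, q)) :
  (A *m B) ^t* = B ^t* *m A ^t*.
Proof. by rewrite trmx_mul map_mxM. Qed.

Lemma adjD m n (A B : 'M[C]_(m, n)) : (A + B) ^t* = A ^t* + B ^t*.
Proof. by rewrite linearD map_mxD. Qed.

Lemma adjN m n (A : 'M[C]_(m, n)) : (- A) ^t* = - A ^t*.
Proof. by rewrite linearN map_mxN. Qed.

Lemma adjB m n (A B : 'M[C]_(m, n)) : (A - B) ^t* = A ^t* - B ^t*.
Proof. by rewrite adjD adjN. Qed.

Lemma adjZ m n c (A : 'M[C]_(m, n)) : (c *: A) ^t* = c^* *: A ^t*.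
Proof. by rewrite linearZ map_mxZ. Qed.

Lemma adj0 m n : (0 : 'M[C]_(m, n)) ^t* = 0.
Proof. by rewrite trmx0 map_mx0. Qed.

Lemma adj1 n : (1%:M : 'M[C]_n) ^t* = 1%:M.
Proof. by rewrite trmx1 map_mx1. Qed.

Lemma adj_sum m n (I : Type) (r : seq I) (P : pred I) (F : I -> 'M[C]_(m, n)) :
  (\sum_(i <- r | P i) F i) ^t* = \sum_(i <- r | P i) (F i) ^t*.
Proof.
by apply: (big_morph (fun A : 'M[C]_(m, n) => A ^t*) (@adjD m n) (@adj0 m n)).
Qed.

Lemma tr_adj n (A : 'M[C]_n) : \tr (A ^t*) = (\tr A)^*.
Proof. by rewrite trace_map_mx mxtrace_tr. Qed.

Lemma adj_tens m n q r (A : 'M[C]_(m, n)) (B : 'M[C]_(q, r)) :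
  (A *t B) ^t* = A ^t* *t B ^t*.
Proof. by rewrite trmx_tens map_mxT. Qed.

Lemma hermE n (A : 'M[C]_n) : (A \is hermsymmx) = (A ^t* == A).
Proof. by rewrite qualifE /= expr0 scale1r eq_sym. Qed.

Lemma hermP n (A : 'M[C]_n) : reflect (A ^t* = A) (A \is hermsymmx).
Proof. by rewrite hermE; apply: eqP. Qed.

Lemma trMadj_ge0 m n (A : 'M[C]_(m, n)) : 0 <= \tr (A *m A ^t*).
Proof.
apply: sumr_ge0 => i _; rewrite mxE; apply: sumr_ge0 => j _.
by rewrite !mxE -normCK exprn_ge0.
Qed.

Lemma trMadj_eq0 m n (A : 'M[C]_(m, n)) : \tr (A *m A ^t*) = 0 -> A = 0.
Proof.
move=> h0; apply/matrixP => i j; rewrite mxE.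
have nn k l : 0 <= A k l * (A k l)^* by rewrite -normCK exprn_ge0.
have h1 : forall k, true -> (A *m A ^t*) k k = 0.
  apply: psumr_eq0P h0 => k _; rewrite mxE; apply: sumr_ge0 => l _.
  by rewrite !mxE.
move: (h1 i isT); rewrite mxE => h2.
have h3 : forall l, true -> A i l * (A ^t*) l i = 0.
  by apply: psumr_eq0P h2 => l _; rewrite !mxE.
move: (h3 j isT); rewrite !mxE -normCK => /eqP.
by rewrite expf_eq0 /= normr_eq0 => /eqP.
Qed.

End Adjoint.

Section PSD.
Variable C : numClosedFieldType.

(** Positivity over an abstract algebraically closed field; at [complex R] it is
    [psd] by conversion. *)
Definition psdmx n (A : 'M[C]_n) : Prop :=
  A \is hermsymmx /\ forall v : 'cV[C]_n, 0 <= (v ^t* *m A *m v) 0 0.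

Lemma psd_herm n (A : 'M[C]_n) : psdmx A -> A ^t* = A.
Proof. by case=> /hermP. Qed.

Lemma psd_MMadj m n (K : 'M[C]_(n, m)) : psdmx (K *m K ^t*).
Proof.
split; first by apply/hermP; rewrite adjM trmxCK.
move=> v; set w := K ^t* *m v.
have -> : v ^t* *m (K *m K ^t*) *m v = w ^t* *m w.
  by rewrite /w adjM trmxCK !mulmxA.
rewrite mxE; apply: sumr_ge0 => j _.
by rewrite !mxE mulrC -normCK exprn_ge0.
Qed.

Lemma psd_spectral n (A : 'M[C]_n) : psdmx A ->
  exists U : 'M[C]_n, exists l : 'rV[C]_n,
    [/\ U *m U ^t* = 1%:M, U ^t* *m U = 1%:M,
        A = U ^t* *m diag_mx l *m U & forall k, 0 <= l 0 k].
Proof.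
case=> hA pA.
have /hermitian_normalmx/orthomx_spectralP := hA.
set U := spectralmx A; set l := spectral_diag A => eA.
have uU : U \is unitarymx by apply: spectral_unitarymx.
have UU : U *m U ^t* = 1%:M by apply/unitarymxP.
have UU' : U ^t* *m U = 1%:M by apply: mulmx1C.
exists U, l; split => //; first by rewrite -invmx_unitary.
move=> k; have := pA (U ^t* *m delta_mx k 0).
rewrite eA invmx_unitary // adjM trmxCK !mulmxA.
rewrite -(mulmxA _ U) UU mulmx1 -(mulmxA _ U) UU mulmx1.
rewrite mxE (bigD1 k) //= big1 ?addr0; last first.
  by move=> i /negPf ik; rewrite !mxE ik mulr0.
rewrite !mxE eqxx mulr1 (bigD1 k) //= big1 ?addr0; last first.
  by move=> i /negPf ik; rewrite !mxE ik conjC0 mul0r.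
by rewrite !mxE !eqxx conjC1 mul1r mulr1n.
Qed.

Lemma diag_factor n (s : 'rV[C]_n) : (forall k, 0 <= s 0 k) ->
  exists t, diag_mx s = diag_mx t *m (diag_mx t) ^t*.
Proof.
move=> s0; exists (\row_k sqrtC (s 0 k)).
rewrite tr_diag_mx map_diag_mx mulmx_diag; congr diag_mx.
apply/rowP => k; rewrite !mxE /=.
by rewrite geC0_conj ?sqrtC_ge0 // -expr2 sqrtCK.
Qed.

Lemma psd_diagmx n (s : 'rV[C]_n) : (forall k, 0 <= s 0 k) -> psdmx (diag_mx s).
Proof. by move=> /diag_factor[t ->]; apply: psd_MMadj. Qed.

(** The square root that turns the trace inequalities below into the positivity
    of squared lengths. *)
Lemma psd_factor n (A : 'M[C]_n) : psdmx A -> exists K : 'M[C]_n, A = K *m K ^t*.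
Proof.
move=> /psd_spectral[U [l [_ _ -> /diag_factor[t ->]]]].
by exists (U ^t* *m diag_mx t); rewrite adjM trmxCK !mulmxA.
Qed.

Lemma psd_conj m n (A : 'M[C]_n) (B : 'M[C]_(m, n)) :
  psdmx A -> psdmx (B *m A *m B ^t*).
Proof.
move=> /psd_factor[K ->].
have -> : B *m (K *m K ^t*) *m B ^t* = (B *m K) *m (B *m K) ^t*.
  by rewrite adjM !mulmxA.
exact: psd_MMadj.
Qed.

Lemma psd_add n (A B : 'M[C]_n) : psdmx A -> psdmx B -> psdmx (A + B).
Proof.
case=> /hermP hA pA [/hermP hB pB]; split; first by apply/hermP; rewrite adjD hA hB.
by move=> v; rewrite mulmxDr mulmxDl mxE addr_ge0.
Qed.

Lemma psd_scale n (A : 'M[C]_n) c : 0 <= c -> psdmx A -> psdmx (c *: A).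
Proof.
move=> c0 [/hermP hA pA]; split.
  by apply/hermP; rewrite adjZ hA geC0_conj.
by move=> v; rewrite -scalemxAr -scalemxAl mxE mulr_ge0.
Qed.

Lemma psd_form_le n (A B : 'M[C]_n) (v : 'cV[C]_n) : psdmx (A - B) ->
  (v ^t* *m B *m v) 0 0 <= (v ^t* *m A *m v) 0 0.
Proof.
by case=> _ /(_ v); rewrite mulmxBr mulmxBl mxE [X in _ + X]mxE subr_ge0.
Qed.

Lemma psd0 n : psdmx (0 : 'M[C]_n).
Proof.
split; first by apply/hermP; rewrite adj0.
by move=> v; rewrite mulmx0 mul0mx mxE.
Qed.

Lemma psd1 n : psdmx (1%:M : 'M[C]_n).
Proof. by have := @psd_MMadj n n 1%:M; rewrite adj1 mulmx1. Qed.

Lemma psd_sum n (I : Type) (r : seq I) (P : pred I) (F : I -> 'M[C]_n) :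
  (forall i, P i -> psdmx (F i)) -> psdmx (\sum_(i <- r | P i) F i).
Proof.
move=> h; elim/big_rec: _ => [|i x Pi px]; first exact: psd0.
by apply: psd_add => //; apply: h.
Qed.

Lemma psd_tr_ge0 n (A : 'M[C]_n) : psdmx A -> 0 <= \tr A.
Proof. by move=> /psd_factor[K ->]; apply: trMadj_ge0. Qed.

Lemma tr_MMadjM n (K L : 'M[C]_n) :
  \tr (K *m K ^t* *m (L *m L ^t*)) = \tr ((K ^t* *m L) *m (K ^t* *m L) ^t*).
Proof. by rewrite adjM trmxCK -!mulmxA mxtrace_mulC !mulmxA. Qed.

Lemma psd_trM_ge0 n (A B : 'M[C]_n) : psdmx A -> psdmx B -> 0 <= \tr (A *m B).
Proof.
by move=> /psd_factor[K ->] /psd_factor[L ->]; rewrite tr_MMadjM trMadj_ge0.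
Qed.

Lemma psd_trM_eq0 n (A B : 'M[C]_n) :
  psdmx A -> psdmx B -> \tr (A *m B) = 0 -> A *m B = 0.
Proof.
move=> /psd_factor[K ->] /psd_factor[L ->]; rewrite tr_MMadjM => /trMadj_eq0 h.
by rewrite !mulmxA -(mulmxA K) h mulmx0 mul0mx.
Qed.

Lemma psd_tr_eq0 n (A : 'M[C]_n) : psdmx A -> \tr A = 0 -> A = 0.
Proof. by move=> /psd_factor[K ->] /trMadj_eq0->; rewrite mul0mx. Qed.

Lemma psd_diag_ge0 n (A : 'M[C]_n) k : psdmx A -> 0 <= A k k.
Proof.
case=> _ /(_ (delta_mx k 0)).
rewrite mxE (bigD1 k) //= big1 ?addr0; last first.
  by move=> i /negPf ik; rewrite !mxE ik mulr0.
rewrite !mxE eqxx mulr1 (bigD1 k) //= big1 ?addr0; last first.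
  by move=> i /negPf ik; rewrite !mxE ik conjC0 mul0r.
by rewrite !mxE !eqxx conjC1 mul1r.
Qed.

Lemma psd_diag_le_tr n (A : 'M[C]_n) k : psdmx A -> A k k <= \tr A.
Proof.
move=> pA; rewrite /mxtrace (bigD1 k) //= lerDl.
by apply: sumr_ge0 => i _; apply: psd_diag_ge0.
Qed.

(** With [A = K K^H], the entry [(i, j)] is the inner product of two rows of
    [K], so that it is at most the average of the two squared lengths, which are
    diagonal entries of [A]. *)
Lemma psd_entry_le_tr n (A : 'M[C]_n) i j : psdmx A -> `|A i j| <= \tr A.
Proof.
move=> pA; have [K eA] := psd_factor pA.
have Akk k : A k k = \sum_l `|K k l| ^+ 2.
  by rewrite eA mxE; apply: eq_bigr => l _; rewrite !mxE normCK.
suff h : `|A i j| <= (A i i + A j j) / 2.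
  apply: le_trans h _; rewrite ler_pdivrMr // mulr_natr mulr2n.
  by rewrite lerD // psd_diag_le_tr.
rewrite !Akk -big_split /= mulr_suml {1}eA mxE.
apply: le_trans (ler_norm_sum _ _ _) _; apply: ler_sum => l _.
rewrite !mxE normrM norm_conjC ler_pdivlMr // -subr_ge0.
have -> : `|K i l| ^+ 2 + `|K j l| ^+ 2 - `|K i l| * `|K j l| * 2
   = (`|K i l| - `|K j l|) ^+ 2 by ring.
by rewrite real_exprn_even_ge0 // rpredB ?normr_real.
Qed.

(** The trace is the sum of the eigenvalues, hence bounds each of them. *)
Lemma psd_le_tr n (A : 'M[C]_n) : psdmx A -> psdmx ((\tr A)%:M - A).
Proof.
move=> pA; have [U [l [UU UU' eA l0]]] := psd_spectral pA.
have -> : \tr A = \sum_k l 0 k.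
  by rewrite eA mxtrace_mulC mulmxA UU mul1mx mxtrace_diag.
pose s := \row_k (\sum_k l 0 k - l 0 k).
have -> : (\sum_k l 0 k)%:M - A = U ^t* *m diag_mx s *m U.
  have -> : diag_mx s = (\sum_k l 0 k)%:M - diag_mx l.
    by apply/matrixP => i j; rewrite !mxE -mulrnBl.
  by rewrite mulmxBr mulmxBl -eA mul_mx_scalar -scalemxAl UU' scalemx1.
rewrite -{2}[U]trmxCK; apply: psd_conj; apply: psd_diagmx => k.
rewrite mxE subr_ge0 [X in _ <= X](bigD1 k) //= lerDl.
by apply: sumr_ge0.
Qed.

(** [2 s (s + H)] is the sum of [(s + H)^2] and of [s^2 - H^2], and [H^2] is at
    most [tr H^2]. *)
Lemma psd_shift n (H : 'M[C]_n) s : H ^t* = H -> 0 < s ->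
  \tr (H *m H ^t*) <= s ^+ 2 -> psdmx (s%:M + H).
Proof.
move=> hH s0 hs; have s1 : s \is Num.real by apply: gtr0_real.
have hsH : (s%:M + H) ^t* = s%:M + H.
  by rewrite adjD hH tr_scalar_mx map_scalar_mx /= conj_Creal.
have -> : s%:M + H = (2 * s)^-1 *: ((s%:M + H) *m (s%:M + H) ^t*
    + ((\tr (H *m H ^t*))%:M - H *m H ^t*) + (s ^+ 2 - \tr (H *m H ^t*)) *: 1%:M).
  rewrite hsH hH mulmxDl !mulmxDr -scalar_mxM mul_mx_scalar mul_scalar_mx.
  rewrite scalerBl !scalemx1.
  have -> : s%:M + H = (2 * s)^-1 *: ((2 * s) *: (s%:M + H)).
    by rewrite scalerA mulVf ?scale1r // mulf_neq0 ?pnatr_eq0 // gt_eqF.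
  congr (_ *: _); rewrite scalerDr scale_scalar_mx.
  move: (H *m H) (\tr _) => HH t; apply/matrixP => i j; rewrite !mxE.
  by case: (i == j); rewrite ?mulr1n ?mulr0n; ring.
apply: psd_scale; first by rewrite invr_ge0 mulr_ge0 ?ler0n // ltW.
apply: psd_add; last by apply: psd_scale; [rewrite subr_ge0|exact: psd1].
by apply: psd_add; [exact: psd_MMadj|apply/psd_le_tr/psd_MMadj].
Qed.

(** With [A = K K^H], the matrix [tr A A - A^2] is [K (tr (K^H K) - K^H K) K^H],
    which is positive by [psd_le_tr]. *)
Lemma psd_sqr_le n (r A : 'M[C]_n) : psdmx r -> psdmx A ->
  \tr (r *m A *m A) <= \tr A * \tr (r *m A).
Proof.
move=> pr pA; have [K eA] := psd_factor pA.
have pK : psdmx (K ^t* *m K) by have := psd_MMadj (K ^t*); rewrite trmxCK.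
have -> : \tr A = \tr (K ^t* *m K) by rewrite eA mxtrace_mulC.
have e : K *m ((\tr (K ^t* *m K))%:M - K ^t* *m K) *m K ^t*
    = \tr (K ^t* *m K) *: A - A *m A.
  by rewrite mulmxBr mulmxBl mul_mx_scalar -scalemxAl eA !mulmxA.
have := psd_trM_ge0 pr (psd_conj K (psd_le_tr pK)).
by rewrite e mulmxBr -scalemxAr linearB linearZ /= mulmxA subr_ge0.
Qed.

End PSD.

(** * Reduction of an observable on N copies to one copy *)

Section SandwichForm.
Variable C : numClosedFieldType.

(** The second moment of [A] in the state [r]: a positive quadratic form, which
    is degenerate when [r] has a kernel. *)
Definition qform n (r A : 'M[C]_n) : C := \tr (r *m A *m A ^t*).

Lemma qform_ge0 n (r A : 'M[C]_n) : psdmx r -> 0 <= qform r A.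
Proof.
by move=> pr; rewrite /qform -mulmxA; apply: psd_trM_ge0 => //; apply: psd_MMadj.
Qed.

Lemma qform_eq0 n (r A : 'M[C]_n) : psdmx r -> qform r A = 0 -> r *m A = 0.
Proof.
move=> /psd_factor[K ->]; rewrite /qform -mulmxA tr_MMadjM => /trMadj_eq0 h.
by rewrite -mulmxA h mulmx0.
Qed.

Lemma qform_adjC n (r A B : 'M[C]_n) : r ^t* = r ->
  \tr (r *m B *m A ^t*) = (\tr (r *m A *m B ^t*))^*.
Proof.
by move=> hr; rewrite -tr_adj !adjM trmxCK hr !mulmxA [RHS]mxtrace_mulC mulmxA.
Qed.

Lemma qformD n (r A B : 'M[C]_n) :
  qform r (A + B)
  = qform r A + qform r B + (\tr (r *m A *m B ^t*) + \tr (r *m B *m A ^t*)).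
Proof. by rewrite /qform adjD !mulmxDr !mulmxDl !linearD /=; ring. Qed.

Lemma qformZ n (r A : 'M[C]_n) c : qform r (c *: A) = `|c| ^+ 2 * qform r A.
Proof.
by rewrite /qform adjZ -!scalemxAr -scalemxAl !linearZ /= mulrA normCK [c^* * c]mulrC.
Qed.

(** The difference of the two sides is a multiple of [qform r (k A - B)]. The
    weights are those with which the constants of the successive splittings add
    up to [N] in [qform_reduce]. *)
Lemma qformD_le n (r A B : 'M[C]_n) (k : nat) : psdmx r -> (0 < k)%N ->
  qform r (A + B) <= k.+1%:R * (qform r A + qform r B / k%:R).
Proof.
move=> pr k0; have k0' : (k%:R : C) != 0 by rewrite pnatr_eq0 -lt0n.
rewrite -subr_ge0.
have -> : k.+1%:R * (qform r A + qform r B / k%:R) - qform r (A + B)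
   = k%:R^-1 * qform r (k%:R *: A + (- 1) *: B).
  rewrite !qformD !qformZ normrN1 expr1n mul1r ger0_norm ?ler0n //.
  rewrite !adjZ conjC_nat rmorphN rmorph1 -!scalemxAr -!scalemxAl !linearZ /=.
  by rewrite -natr1; field.
by rewrite mulr_ge0 ?invr_ge0 ?ler0n // qform_ge0.
Qed.

End SandwichForm.

Section TensorLinear.
Variable K : comNzRingType.

Lemma tensmxDl m n q s (A B : 'M[K]_(m, n)) (D : 'M[K]_(q, s)) :
  (A + B) *t D = A *t D + B *t D.
Proof. by apply/matrixP => i j; rewrite !mxE mulrDl. Qed.

Lemma tensmxDr m n q s (A : 'M[K]_(m, n)) (B D : 'M[K]_(q, s)) :
  A *t (B + D) = A *t B + A *t D.
Proof. by apply/matrixP => i j; rewrite !mxE mulrDr. Qed.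

Lemma tensmxZl m n q s c (A : 'M[K]_(m, n)) (D : 'M[K]_(q, s)) :
  (c *: A) *t D = c *: (A *t D).
Proof. by apply/matrixP => i j; rewrite !mxE mulrA. Qed.

Lemma tensmxZr m n q s c (A : 'M[K]_(m, n)) (D : 'M[K]_(q, s)) :
  A *t (c *: D) = c *: (A *t D).
Proof. by apply/matrixP => i j; rewrite !mxE mulrCA. Qed.

Lemma tensmx_suml m n q s (I : Type) (e : seq I) (F : I -> 'M[K]_(m, n))
    (D : 'M[K]_(q, s)) :
  (\sum_(i <- e) F i) *t D = \sum_(i <- e) (F i *t D).
Proof.
by apply: (big_morph (fun A => A *t D)) => [A B|]; rewrite ?tensmxDl ?tens0mx.
Qed.

Lemma tensmx_sumr m n q s (I : Type) (e : seq I) (A : 'M[K]_(m, n))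
    (F : I -> 'M[K]_(q, s)) :
  A *t (\sum_(i <- e) F i) = \sum_(i <- e) (A *t F i).
Proof.
by apply: (big_morph (fun D => A *t D)) => [B D|]; rewrite ?tensmxDr ?tensmx0.
Qed.

Lemma tr_tens m n (A : 'M[K]_m) (B : 'M[K]_n) : \tr (A *t B) = \tr A * \tr B.
Proof. by rewrite /mxtrace mulr_sum; apply: eq_bigr => i _; rewrite !mxE. Qed.

End TensorLinear.

Section PartialTrace.
Variable C : numClosedFieldType.

(** The conditional expectation of [W] given the first factor, the second one
    being in the state [r2]; it is defined by the duality [tr_ptr1]. *)
Definition ptr1 m n (r2 : 'M[C]_n) (W : 'M[C]_(m * n)) : 'M[C]_m :=
  \matrix_(i, j) \tr ((delta_mx j i *t r2) *m W).

(** The conditional expectation of [W] given the second factor. *)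
Definition ptr2 m n (r1 : 'M[C]_m) (W : 'M[C]_(m * n)) : 'M[C]_n :=
  \matrix_(i, j) \tr ((r1 *t delta_mx j i) *m W).

Lemma tr_ptr1 m n (r2 : 'M[C]_n) A (W : 'M[C]_(m * n)) :
  \tr (A *m ptr1 r2 W) = \tr ((A *t r2) *m W).
Proof.
rewrite {2}(matrix_sum_delta A) tensmx_suml mulmx_suml linear_sum /=.
rewrite /mxtrace; apply: eq_bigr => i _.
rewrite mxE tensmx_suml mulmx_suml -/(mxtrace _) linear_sum /=; apply: eq_bigr => j _.
by rewrite mxE tensmxZl -scalemxAl linearZ.
Qed.

Lemma tr_ptr2 m n (r1 : 'M[C]_m) A (W : 'M[C]_(m * n)) :
  \tr (A *m ptr2 r1 W) = \tr ((r1 *t A) *m W).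
Proof.
rewrite {2}(matrix_sum_delta A) tensmx_sumr mulmx_suml linear_sum /=.
rewrite /mxtrace; apply: eq_bigr => i _.
rewrite mxE tensmx_sumr mulmx_suml -/(mxtrace _) linear_sum /=; apply: eq_bigr => j _.
by rewrite mxE tensmxZr -scalemxAl linearZ.
Qed.

Lemma ptr1_is_linear m n (r2 : 'M[C]_n) : linear (@ptr1 m n r2).
Proof.
move=> c W W'; apply/matrixP => i j.
by rewrite !mxE mulmxDr -scalemxAr linearD linearZ.
Qed.

Lemma ptr2_is_linear m n (r1 : 'M[C]_m) : linear (@ptr2 m n r1).
Proof.
move=> c W W'; apply/matrixP => i j.
by rewrite !mxE mulmxDr -scalemxAr linearD linearZ.
Qed.

Lemma delta_adj m n i j : (delta_mx i j : 'M[C]_(m, n)) ^t* = delta_mx j i.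
Proof. by rewrite trmx_delta map_delta_mx. Qed.

Lemma ptr1_adj m n (r2 : 'M[C]_n) (W : 'M[C]_(m * n)) : r2 ^t* = r2 ->
  ptr1 r2 (W ^t*) = (ptr1 r2 W) ^t*.
Proof.
move=> hr; apply/matrixP => i j; rewrite !mxE -tr_adj adjM adj_tens delta_adj hr.
by rewrite mxtrace_mulC.
Qed.

Lemma ptr2_adj m n (r1 : 'M[C]_m) (W : 'M[C]_(m * n)) : r1 ^t* = r1 ->
  ptr2 r1 (W ^t*) = (ptr2 r1 W) ^t*.
Proof.
move=> hr; apply/matrixP => i j; rewrite !mxE -tr_adj adjM adj_tens delta_adj hr.
by rewrite mxtrace_mulC.
Qed.

Lemma psd_tens m n (r1 : 'M[C]_m) (r2 : 'M[C]_n) : psdmx r1 -> psdmx r2 -> psdmx (r1 *t r2).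
Proof.
move=> /psd_factor[K ->] /psd_factor[L ->].
by rewrite -tensmx_mul -adj_tens; apply: psd_MMadj.
Qed.

(** For the inner product given by the product state, the two terms are the
    squared lengths of the projections of [W] on the centred observables of the
    first factor and on the observables of the second one. Centring makes these
    two spaces orthogonal, and the inequality is Bessel's. *)
Lemma qform_bipartite m n (r1 : 'M[C]_m) (r2 : 'M[C]_n) (W : 'M[C]_(m * n)) :
  psdmx r1 -> psdmx r2 -> \tr r1 = 1 -> \tr r2 = 1 ->
  qform r1 (ptr1 r2 W - (\tr ((r1 *t r2) *m W))%:M) + qform r2 (ptr2 r1 W)
  <= qform (r1 *t r2) W.
Proof.
move=> p1 p2 t1 t2; set tau := \tr _; set A := _ - _; set D := ptr2 r1 W.
have p12 := psd_tens p1 p2.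
have h1 := psd_herm p1; have h2 := psd_herm p2.
have h12 := psd_herm p12.
have trA : \tr (r1 *m A) = 0.
  rewrite /A mulmxBr linearB /= tr_ptr1 mul_mx_scalar linearZ /= t1 mulr1.
  by rewrite /tau subrr.
have trA' : \tr (r1 *m A ^t*) = 0.
  by rewrite -{1}h1 mxtrace_mulC -adjM tr_adj trA conjC0.
pose A1 := A *t (1%:M : 'M[C]_n); pose D1 := (1%:M : 'M[C]_m) *t D.
pose f := fun U V : 'M[C]_(m * n) => \tr ((r1 *t r2) *m U *m V ^t*).
have fC U V : f V U = (f U V)^* by rewrite /f qform_adjC.
have fWA : f W A1 = qform r1 A.
  rewrite /f /A1 adj_tens adj1 mxtrace_mulC mulmxA tensmx_mul mul1mx -tr_ptr1.
  have -> : ptr1 r2 W = A + tau%:M by rewrite /A subrK.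
  rewrite mulmxDr linearD /= mul_mx_scalar linearZ /= [\tr (A ^t* *m r1)]mxtrace_mulC.
  by rewrite trA' mulr0 addr0 /qform mxtrace_mulC mulmxA mxtrace_mulC mulmxA.
have fWD : f W D1 = qform r2 D.
  rewrite /f /D1 adj_tens adj1 mxtrace_mulC mulmxA tensmx_mul mul1mx -tr_ptr2.
  by rewrite /qform mxtrace_mulC mulmxA mxtrace_mulC mulmxA.
have fAA : f A1 A1 = qform r1 A.
  rewrite /f /A1 adj_tens adj1 !tensmx_mul !mulmx1 tr_tens t2 mulr1 //.
have fDD : f D1 D1 = qform r2 D.
  rewrite /f /D1 adj_tens adj1 !tensmx_mul !mulmx1 tr_tens t1 mul1r //.
have fAD : f A1 D1 = 0.
  by rewrite /f /D1 /A1 adj_tens adj1 !tensmx_mul !mulmx1 tr_tens trA mul0r.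
have qr M : psdmx M -> (\tr M)^* = \tr M.
  by move=> pM; rewrite geC0_conj ?psd_tr_ge0.
have rq k (r B : 'M[C]_k) : psdmx r -> (qform r B)^* = qform r B.
  by move=> pr; rewrite geC0_conj ?qform_ge0.
have e : qform (r1 *t r2) (W + (- 1) *: (A1 + D1))
    = f W W + (f A1 A1 + f D1 D1 + (f A1 D1 + f D1 A1))
      - (f W A1 + f W D1 + (f A1 W + f D1 W)).
  rewrite qformD qformZ normrN1 expr1n mul1r qformD -/(f A1 D1) -/(f D1 A1).
  rewrite adjZ rmorphN rmorph1 adjD -!scalemxAr -scalemxAl !mulmxDr !mulmxDl.
  by rewrite !scaleN1r !linearN !linearD /= -opprD.
have := qform_ge0 (W + (- 1) *: (A1 + D1)) p12.
rewrite e [f D1 A1]fC [f A1 W]fC [f D1 W]fC fWA fWD fAA fDD fAD conjC0 !rq //.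
rewrite -[f W W]/(qform _ W) => h; rewrite -subr_ge0; apply: (le_trans h).
by rewrite le_eqVlt; apply/orP; left; apply/eqP; ring.
Qed.

End PartialTrace.

HB.instance Definition _ (C : numClosedFieldType) m n (r2 : 'M[C]_n) :=
  GRing.isLinear.Build C 'M[C]_(m * n) 'M[C]_m _
    (@ptr1 C m n r2) (@ptr1_is_linear C m n r2).
HB.instance Definition _ (C : numClosedFieldType) m n (r1 : 'M[C]_m) :=
  GRing.isLinear.Build C 'M[C]_(m * n) 'M[C]_n _
    (@ptr2 C m n r1) (@ptr2_is_linear C m n r1).

Section Reduction.
Variables (C : numClosedFieldType) (d : nat).

Fixpoint tpower (A : 'M[C]_d) (N : nat) : 'M[C]_(tensor_dim d N) :=
  if N is N'.+1 then A *t tpower A N' else 1%:M.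

(** The sum over the copies of the centred conditional expectation of [W] given
    that copy: the observable on one copy that responds to a change of the state
    as [W] does on [N] copies ([tr_reduce]). *)
Fixpoint reduce (r : 'M[C]_d) (N : nat) : 'M[C]_(tensor_dim d N) -> 'M[C]_d :=
  match N return 'M[C]_(tensor_dim d N) -> 'M[C]_d with
  | 0%N => fun _ => 0
  | N'.+1 => fun W =>
      ptr1 (tpower r N') W - (\tr (tpower r N'.+1 *m W))%:M
      + reduce r (ptr2 r W)
  end.

Fixpoint dtpower (r dr : 'M[C]_d) (N : nat) : 'M[C]_(tensor_dim d N) :=
  match N return 'M[C]_(tensor_dim d N) with
  | 0%N => 0
  | N'.+1 => dr *t tpower r N' + r *t dtpower r dr N'
  end.

Lemma reduce_is_linear r N : linear (@reduce r N).
Proof.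
elim: N => [|N IH] c W W'; first by rewrite /= scaler0 addr0.
rewrite /= ptr1_is_linear ptr2_is_linear IH mulmxDr -scalemxAr linearD linearZ /=.
rewrite raddfD /= -scale_scalar_mx scalerDr scalerBr.
by rewrite [RHS]addrACA opprD; congr (_ + _); rewrite addrACA.
Qed.

Section State.
Variable r : 'M[C]_d.
Hypotheses (pr : psdmx r) (tr1 : \tr r = 1).

Lemma tpower_psd N : psdmx (tpower r N).
Proof. by elim: N => [|N IH] /=; [exact: psd1|exact: psd_tens]. Qed.

Lemma tpower_tr N : \tr (tpower r N) = 1.
Proof. by elim: N => [|N IH] /=; rewrite ?mxtrace1 // tr_tens IH tr1 mulr1. Qed.

Lemma reduce_adj N (W : 'M[C]_(tensor_dim d N)) :
  reduce r (W ^t*) = (reduce r W) ^t*.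
Proof.
elim: N W => [|N IH] W; first by rewrite /= adj0.
rewrite [LHS]/= [in RHS]/= adjD adjB tr_scalar_mx map_scalar_mx.
have hN := psd_herm (tpower_psd N).
rewrite ptr1_adj // (ptr2_adj _ (psd_herm pr)) IH; congr (_ - _%:M + _).
have := psd_herm (tpower_psd N.+1); rewrite [tpower _ _]/= => hN1.
by rewrite /= -tr_adj adjM hN1 mxtrace_mulC.
Qed.

(** The centring disappears since [dr] has trace zero. *)
Lemma tr_reduce (dr : 'M[C]_d) N (W : 'M[C]_(tensor_dim d N)) : \tr dr = 0 ->
  \tr (dtpower r dr N *m W) = \tr (dr *m reduce r W).
Proof.
move=> dr0; elim: N W => [|N IH] W /=; first by rewrite mul0mx mulmx0 !mxtrace0.
rewrite mulmxDl linearD /= -tr_ptr1 -tr_ptr2 IH mulmxDr linearD /=; congr (_ + _).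
by rewrite mulmxBr linearB /= mul_mx_scalar linearZ /= dr0 mulr0 subr0.
Qed.

(** The centred conditional expectations given different copies are orthogonal,
    so that their squared lengths add up to at most that of [W], while the
    square of a sum of [N] terms is at most [N] times the sum of the squares. *)
Lemma qform_reduce N (W : 'M[C]_(tensor_dim d N)) :
  qform r (reduce r W) <= N%:R * qform (tpower r N) W.
Proof.
elim: N W => [|N IH] W.
  by rewrite /= /qform mulmx0 mul0mx mxtrace0 mul0r.
have := qform_bipartite W pr (tpower_psd N) tr1 (tpower_tr N).
rewrite [reduce _ _]/= [tpower r N.+1]/=; set A := _ - _ => hb.
case: N => [|N] in W IH A hb *.
  rewrite /= addr0 mul1r; apply: le_trans hb; rewrite lerDl qform_ge0 //.
  exact: (tpower_psd 0).
apply: (le_trans (qformD_le A _ pr (ltn0Sn N))).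
rewrite ler_wpM2l ?ler0n //; apply: le_trans hb.
by rewrite lerD2l ler_pdivrMr ?ltr0n // mulrC IH.
Qed.

End State.
End Reduction.

HB.instance Definition _ (C : numClosedFieldType) d (r : 'M[C]_d) N :=
  GRing.isLinear.Build C 'M[C]_(tensor_dim d N) 'M[C]_d _
    (@reduce C d r N) (@reduce_is_linear C d r N).

(** * Truncation of observables to the support of a state, and Gram matrices *)

Section Truncation.
Variable C : numClosedFieldType.

(** Polarization: the vectors [e_i + e_j] and [e_i + i e_j] recover the entries
    of [M]. *)
Lemma form_eq0 n (M : 'M[C]_n) :
  (forall v : 'cV[C]_n, (v ^t* *m M *m v) 0 0 = 0) -> M = 0.
Proof.
move=> h; apply/matrixP => i j; rewrite [RHS]mxE.
have e (a b : C) k l :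
   let v := a *: delta_mx k 0 + b *: delta_mx l 0 : 'cV[C]_n in
   (v ^t* *m M *m v) 0 0
   = `|a| ^+ 2 * M k k + a^* * b * M k l + b^* * a * M l k + `|b| ^+ 2 * M l l.
  have dM k' l' : (delta_mx k' 0 : 'cV[C]_n) ^t* *m M *m delta_mx l' 0 = (M k' l')%:M.
    rewrite delta_adj -rowE -colE; apply/matrixP => x y.
    by rewrite !ord1 !mxE eqxx.
  rewrite /= adjD !adjZ !mulmxDl !mulmxDr -!scalemxAl -!scalemxAr.
  rewrite !dM !scale_scalar_mx !mxE !eqxx !mulr1n !normCK.
  by ring.
have hd k : M k k = 0.
  by have := h (1 *: delta_mx k 0 + 0 *: delta_mx k 0);
     rewrite e normr1 normr0 conjC0 conjC1 expr0n /=; move=> <-; ring.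
have h1 := h (1 *: delta_mx i 0 + 1 *: delta_mx j 0).
have h2 := h (1 *: delta_mx i 0 + 'i *: delta_mx j 0).
rewrite e !hd !mulr0 add0r addr0 !conjC1 !mulr1 !mul1r in h1.
rewrite e !hd !mulr0 add0r addr0 !conjC1 !mulr1 !mul1r conjCi mulNr in h2.
have h3 : 2 * 'i * M i j = 0.
  have -> : 2 * 'i * M i j
     = 'i * (M i j + M j i) + ('i * M i j - 'i * M j i) by ring.
  by rewrite h1 h2 mulr0 addr0.
move/eqP: h3; rewrite !mulf_eq0 pnatr_eq0 /= => /orP[|/eqP//].
by rewrite (negPf (neq0Ci C)).
Qed.

(** [Q] is the spectral projection on the kernel of [r]; on its complement [r]
    is bounded below by its least nonzero eigenvalue, and [c] is at least the
    inverse of that eigenvalue. *)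
Lemma psd_kernel_proj n (r : 'M[C]_n) : psdmx r ->
  exists Q : 'M[C]_n, exists c : C,
  [/\ Q ^t* = Q, Q *m Q = Q, r *m Q = 0, 0 <= c & psdmx (c *: r - (1%:M - Q))].
Proof.
move=> /psd_spectral[U [l [UU UU' er l0]]].
pose q := \row_k ((l 0 k == 0)%:R : C).
pose c := \sum_(k | l 0 k != 0) (l 0 k)^-1.
have c0 : 0 <= c by apply: sumr_ge0 => k _; rewrite invr_ge0.
have hc k : l 0 k != 0 -> 1 <= c * l 0 k.
  move=> lk; have lk0 : 0 < l 0 k by rewrite lt_def lk l0.
  rewrite -ler_pdivrMr // div1r /c (bigD1 k) //= lerDl.
  by apply: sumr_ge0 => i _; rewrite invr_ge0.
have conjM (a b : 'rV[C]_n) :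
    (U ^t* *m diag_mx a *m U) *m (U ^t* *m diag_mx b *m U)
    = U ^t* *m diag_mx (\row_k (a 0 k * b 0 k)) *m U.
  by rewrite !mulmxA -(mulmxA _ U) UU mulmx1 -(mulmxA _ (diag_mx a)) mulmx_diag.
exists (U ^t* *m diag_mx q *m U), c; split => //.
- rewrite !adjM trmxCK mulmxA; congr (_ *m _ *m _).
  rewrite tr_diag_mx map_diag_mx; congr diag_mx.
  by apply/rowP => k; rewrite !mxE /= conjC_nat.
- rewrite conjM; congr (_ *m diag_mx _ *m _).
  by apply/rowP => k; rewrite !mxE; case: eqP; rewrite ?mulr1 ?mulr0.
- rewrite er conjM -[RHS](mul0mx _ U) -[in RHS](mulmx0 _ (U ^t*)).
  congr (_ *m _ *m _); rewrite -[RHS](linear0 diag_mx); congr diag_mx.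
  by apply/rowP => k; rewrite !mxE; case: eqP => [->|]; rewrite ?mulr1 ?mulr0.
- pose s := \row_k (c * l 0 k - (1 - q 0 k)).
  have -> : c *: r - (1%:M - U ^t* *m diag_mx q *m U) = U ^t* *m diag_mx s *m U.
    have -> : diag_mx s = c *: diag_mx l - (1%:M - diag_mx q).
      apply/matrixP => i j; rewrite !mxE.
      by case: (i == j); rewrite ?mulr1n // ?mulr0n ?mulr0 !subr0.
    rewrite !mulmxBr !mulmxBl -scalemxAr -scalemxAl -er mulmx1 UU'.
    by [].
  rewrite -{2}[U]trmxCK; apply: psd_conj; apply: psd_diagmx => k.
  rewrite !mxE; case: eqP => [->|/eqP/hc]; first by rewrite subrr mulr0 subr0.
  by rewrite subr0 subr_ge0.
Qed.

Lemma entry_sqr_le_tr m n (A : 'M[C]_(m, n)) k l :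
  `|A k l| ^+ 2 <= \tr (A *m A ^t*).
Proof.
apply: le_trans (psd_diag_le_tr k (psd_MMadj A)).
rewrite mxE (bigD1 l) //= !mxE -normCK lerDl.
by apply: sumr_ge0 => j _; rewrite !mxE -normCK exprn_ge0.
Qed.

(** Only the part [X - Q X Q] of an observable matters: it determines the second
    moments and the responses to every [D] whose form vanishes on the kernel of
    [r]. Unlike [X] itself, this part is bounded by [qform r X], which is what
    makes the observables of the Holevo bound compact. *)
Lemma truncation n (r : 'M[C]_n) : psdmx r ->
  exists Q : 'M[C]_n, exists c : C,
  [/\ Q ^t* = Q,
      (forall D : 'M[C]_n,
         (forall v : 'cV[C]_n, r *m v = 0 -> (v ^t* *m D *m v) 0 0 = 0) ->
         forall X, \tr (D *m (X - Q *m X *m Q)) = \tr (D *m X)),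
      (forall X Y, \tr (r *m (X - Q *m X *m Q) *m (Y - Q *m Y *m Q))
                   = \tr (r *m X *m Y)),
      0 <= c &
      forall X, X ^t* = X -> forall k l,
        `|(X - Q *m X *m Q) k l| ^+ 2 <= c * qform r X].
Proof.
move=> pr; have [Q [c [hQ QQ rQ c0 pc]]] := psd_kernel_proj pr.
have hr := psd_herm pr.
have Qr : Q *m r = 0 by rewrite -hQ -hr -adjM rQ adj0.
have rT X : r *m (X - Q *m X *m Q) = r *m X.
  by rewrite mulmxBr !mulmxA rQ !mul0mx subr0.
have trT A X : \tr (r *m A *m (X - Q *m X *m Q)) = \tr (r *m A *m X).
  rewrite mulmxBr linearB /= [X in _ - X]mxtrace_mulC.
  by rewrite !mulmxA -(mulmxA _ Q r) Qr mulmx0 !mul0mx mxtrace0 subr0.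
exists Q, (2 * c); split => //; last first.
- move=> X hX k l; set Y := X - _.
  have hY : Y ^t* = Y by rewrite /Y adjB !adjM hX hQ mulmxA.
  have QYQ : Q *m Y *m Q = 0.
    by rewrite /Y mulmxBr mulmxBl !mulmxA QQ -(mulmxA _ Q) QQ subrr.
  pose P := 1%:M - Q.
  have hP : P ^t* = P by rewrite /P adjB adj1 hQ.
  have PP : P *m P = P.
    by rewrite /P mulmxBr mulmx1 mulmxBl mul1mx QQ subrr subr0.
  have -> : qform r X = \tr (r *m Y *m Y).
    by rewrite /qform hX [r *m Y]rT trT.
  apply: le_trans (entry_sqr_le_tr _ _ _) _; clearbody Y.
  have e1 : \tr (Y *m Y ^t*) = \tr (P *m Y *m Y) + \tr (Q *m Y *m Y).
    by rewrite -linearD -!mulmxDl /P subrK mul1mx hY.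
  have e2 : Q *m Y = Q *m Y *m P by rewrite /P mulmxBr mulmx1 QYQ subr0.
  have e3 : \tr (P *m Y *m Y)
      = \tr (Q *m Y *m Y) + \tr ((P *m Y *m P) *m (P *m Y *m P) ^t*).
    have -> : P *m Y *m Y = P *m Y *m (Q *m Y) + P *m Y *m (P *m Y).
      by rewrite -mulmxDr -mulmxDl /P addrCA subrr addr0 mul1mx.
    rewrite linearD /=; congr (_ + _).
      by rewrite mxtrace_mulC e2 !mulmxA -(mulmxA _ P P) PP -e2.
    rewrite !adjM hP hY -!mulmxA [P *m (P *m _)]mulmxA PP.
    by rewrite [RHS]mxtrace_mulC -!mulmxA PP [RHS]mxtrace_mulC -!mulmxA.
  have pP : 0 <= \tr (P *m Y *m Y).
    have -> : \tr (P *m Y *m Y) = \tr ((P *m Y) *m (P *m Y) ^t*).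
      by rewrite adjM hP hY !mulmxA [RHS]mxtrace_mulC !mulmxA PP.
    exact: trMadj_ge0.
  have h4 : \tr (P *m Y *m Y) <= c * \tr (r *m Y *m Y).
    have := psd_trM_ge0 pc (psd_MMadj Y).
    by rewrite hY mulmxBl linearB /= -scalemxAl linearZ /= -/P !mulmxA subr_ge0.
  rewrite e1 -mulrA mulr_natl mulr2n; apply: lerD => //.
  by apply: le_trans h4; rewrite e3 lerDl trMadj_ge0.
- by rewrite mulr_ge0 ?ler0n.
- by move=> X Y; rewrite rT trT.
- move=> D hD X.
  have QDQ : Q *m D *m Q = 0.
    apply: form_eq0 => v.
    have := hD (Q *m v); rewrite mulmxA rQ mul0mx => /(_ erefl).
    by rewrite adjM hQ !mulmxA.
  rewrite mulmxBr linearB /= [X in _ - X]mxtrace_mulC -!mulmxA [X in _ - X]mxtrace_mulC.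
  by rewrite -!mulmxA [Q *m (D *m Q)]mulmxA QDQ mulmx0 mxtrace0 subr0.
Qed.

End Truncation.

Section Gram.
Variables (C : numClosedFieldType) (d p : nat).
Variable r : 'M[C]_d.
Hypothesis pr : psdmx r.
Implicit Types X Y : 'I_p -> 'M[C]_d.

(** The matrix [Z] of the Holevo bound as a sesquilinear expression; the second
    family allows polarization. *)
Definition gram X Y : 'M[C]_p := \matrix_(i, j) \tr (r *m X i *m Y j).

Lemma gramDr X Y Y' : gram X (fun j => Y j + Y' j) = gram X Y + gram X Y'.
Proof. by apply/matrixP => i j; rewrite !mxE mulmxDr mxtraceD. Qed.

Lemma gramDl X X' Y : gram (fun j => X j + X' j) Y = gram X Y + gram X' Y.
Proof. by apply/matrixP => i j; rewrite !mxE mulmxDr mulmxDl mxtraceD. Qed.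

Lemma gramZr c X Y : gram X (fun j => c *: Y j) = c *: gram X Y.
Proof. by apply/matrixP => i j; rewrite !mxE -scalemxAr mxtraceZ. Qed.

Lemma gramZl c X Y : gram (fun j => c *: X j) Y = c *: gram X Y.
Proof. by apply/matrixP => i j; rewrite !mxE -scalemxAr -scalemxAl mxtraceZ. Qed.

Lemma gram_mulr X Y (B : 'M[C]_p) :
  gram X (fun j => \sum_k B k j *: Y k) = gram X Y *m B.
Proof.
apply/matrixP => i j; rewrite !mxE mulmx_sumr mxtrace_sum; apply: eq_bigr => k _.
by rewrite -scalemxAr mxtraceZ mxE mulrC.
Qed.

Lemma gram_mull X Y (B : 'M[C]_p) :
  gram (fun j => \sum_k B k j *: X k) Y = B^T *m gram X Y.
Proof.
apply/matrixP => i j; rewrite !mxE mulmx_sumr mulmx_suml mxtrace_sum.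
by apply: eq_bigr => k _; rewrite -scalemxAr -scalemxAl mxtraceZ !mxE.
Qed.

Lemma gram_form Y (v : 'cV[C]_p) : (forall j, (Y j) ^t* = Y j) ->
  (v ^t* *m gram Y Y *m v) 0 0 = qform r (\sum_j (v j 0)^* *: Y j).
Proof.
move=> hY; rewrite /qform adj_sum mulmx_sumr mxtrace_sum.
under [RHS]eq_bigr => j _ do rewrite mulmx_sumr mulmx_suml mxtrace_sum.
rewrite mxE; apply: eq_bigr => j _.
rewrite mxE mulr_suml; apply: eq_bigr => i _.
rewrite adjZ hY conjCK -!scalemxAr -scalemxAl !mxtraceZ !mxE.
by ring.
Qed.

Lemma gram_adj X Y : (forall j, (X j) ^t* = X j) -> (forall j, (Y j) ^t* = Y j) ->
  (gram X Y) ^t* = gram Y X.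
Proof.
move=> hX hY; apply/matrixP => i j; rewrite !mxE.
rewrite -{1}[Y i]hY -{2}[X j]hX; apply/esym.
by apply: qform_adjC; apply: psd_herm.
Qed.

Lemma gram_psd Y : (forall j, (Y j) ^t* = Y j) -> psdmx (gram Y Y).
Proof.
move=> hY; split; first by apply/hermP/gram_adj.
by move=> v; rewrite gram_form // qform_ge0.
Qed.

(** Matrix convexity of [Y |-> gram Y Y]: between [Y1] and [Y2] the defect is [a
    b] times the Gram matrix of [Y1 - Y2]. *)
Lemma gram_convex_psd (a b : C) (P1 P2 : 'M[C]_p) Y1 Y2 :
  0 <= a -> 0 <= b -> a + b = 1 ->
  (forall j, (Y1 j) ^t* = Y1 j) -> (forall j, (Y2 j) ^t* = Y2 j) ->
  psdmx (P1 - gram Y1 Y1) -> psdmx (P2 - gram Y2 Y2) ->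
  let Y j := a *: Y1 j + b *: Y2 j in psdmx (a *: P1 + b *: P2 - gram Y Y).
Proof.
move=> a0 b0 ab h1 h2 p1 p2 Y.
pose D j := Y1 j + (- 1) *: Y2 j.
have hD j : (D j) ^t* = D j by rewrite /D adjD adjZ h1 h2 rmorphN rmorph1.
have -> : a *: P1 + b *: P2 - gram Y Y
   = a *: (P1 - gram Y1 Y1) + b *: (P2 - gram Y2 Y2) + (a * b) *: gram D D.
  rewrite !(gramDl, gramDr, gramZl, gramZr).
  move: (gram Y1 Y1) (gram Y2 Y2) (gram Y1 Y2) (gram Y2 Y1) => A B E F.
  have -> : a = 1 - b by rewrite -ab addrK.
  by apply/matrixP => i j; rewrite !mxE; ring.
apply: psd_add; last exact: psd_scale (mulr_ge0 a0 b0) (gram_psd hD).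
exact: psd_add (psd_scale a0 p1) (psd_scale b0 p2).
Qed.

End Gram.

(** * Limits of complex numbers and matrices along a filter *)

Section ComplexLimits.
Variable R : realType.
Local Notation C := (complex R).

Lemma ReD (z w : C) : complex.Re (z + w) = complex.Re z + complex.Re w.
Proof. by case: z => a b; case: w. Qed.

Lemma ImD (z w : C) : complex.Im (z + w) = complex.Im z + complex.Im w.
Proof. by case: z => a b; case: w. Qed.

Lemma ReM (z w : C) : complex.Re (z * w)
  = complex.Re z * complex.Re w - complex.Im z * complex.Im w.
Proof. by case: z => a b; case: w. Qed.

Lemma ImM (z w : C) : complex.Im (z * w)
  = complex.Re z * complex.Im w + complex.Im z * complex.Re w.
Proof. by case: z => a b; case: w. Qed.

Lemma ReJ (z : C) : complex.Re (z^*) = complex.Re z.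
Proof. by case: z. Qed.

Lemma ImJ (z : C) : complex.Im (z^*) = - complex.Im z.
Proof. by case: z. Qed.

Lemma ReN (z : C) : complex.Re (- z) = - complex.Re z.
Proof. by case: z. Qed.

Lemma ImN (z : C) : complex.Im (- z) = - complex.Im z.
Proof. by case: z. Qed.

Lemma complex_eq (z w : C) :
  complex.Re z = complex.Re w -> complex.Im z = complex.Im w -> z = w.
Proof. by case: z => a b; case: w => c d /= -> ->. Qed.

Lemma Re_sum (I : Type) (r : seq I) (P : pred I) (F : I -> C) :
  complex.Re (\sum_(i <- r | P i) F i) = \sum_(i <- r | P i) complex.Re (F i).
Proof. by apply: (big_morph (@complex.Re R)) => [z w|]; rewrite ?ReD. Qed.

Lemma ReZr (a : R) (z : C) : complex.Re (real_complex R a * z) = a * complex.Re z.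
Proof. by case: z => x y; rewrite ReM /= mul0r subr0. Qed.

Lemma ImZr (a : R) (z : C) : complex.Im (real_complex R a * z) = a * complex.Im z.
Proof. by case: z => x y; rewrite ImM /= mul0r addr0. Qed.

Lemma cplx_ge0 (z : C) : (0 <= z) = (complex.Im z == 0) && (0 <= complex.Re z).
Proof. by rewrite lecE. Qed.

Lemma cplx_le (z w : C) : z <= w -> complex.Re z <= complex.Re w.
Proof. by rewrite lecE => /andP[]. Qed.

Lemma Re_le_norm (z : C) : real_complex R `|complex.Re z| <= `|z|.
Proof. exact: normc_ge_Re. Qed.

Lemma Im_le_norm (z : C) : real_complex R `|complex.Im z| <= `|z|.
Proof.
have -> : complex.Im z = - complex.Re (z * 'i%C) by case: z => a b /=; ring.
rewrite normrN; apply: le_trans (Re_le_norm _) _; rewrite normrM.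
have -> : `|'i%C : C| = 1 by rewrite normc_def /= expr0n expr1n add0r sqrtr1.
by rewrite mulr1.
Qed.

Section Filter.
Variables (T : Type) (F : set_system T).
Context {FF : ProperFilter F}.

(** Convergence of the two real coordinates, so that only the topology of [R] is
    involved. *)
Definition ccvg (z : T -> C) (l : C) : Prop :=
  (complex.Re (z x) @[x --> F] --> complex.Re l) /\
  (complex.Im (z x) @[x --> F] --> complex.Im l).

Definition mcvg m n (A : T -> 'M[C]_(m, n)) (L : 'M[C]_(m, n)) : Prop :=
  forall i j, ccvg (fun x => A x i j) (L i j).

Lemma ccvg_ext z z' l : (forall x, z x = z' x) -> ccvg z' l -> ccvg z l.
Proof. by move=> /funext ->. Qed.

Lemma ccvg_cst l : ccvg (fun=> l) l.
Proof. by split; apply: cvg_cst. Qed.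

Lemma ccvgD z w l l' : ccvg z l -> ccvg w l' -> ccvg (fun x => z x + w x) (l + l').
Proof.
case=> zr zi [wr wi]; split.
  by rewrite ReD; under eq_fun do rewrite ReD; apply: cvgD.
by rewrite ImD; under eq_fun do rewrite ImD; apply: cvgD.
Qed.

Lemma ccvgM z w l l' : ccvg z l -> ccvg w l' -> ccvg (fun x => z x * w x) (l * l').
Proof.
case=> zr zi [wr wi]; split.
  rewrite ReM; under eq_fun do rewrite ReM.
  by apply: cvgB; apply: cvgM.
rewrite ImM; under eq_fun do rewrite ImM.
by apply: cvgD; apply: cvgM.
Qed.

Lemma ccvgN z l : ccvg z l -> ccvg (fun x => - z x) (- l).
Proof.
case=> zr zi; split.
  by rewrite ReN; under eq_fun do rewrite ReN; apply: cvgN.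
by rewrite ImN; under eq_fun do rewrite ImN; apply: cvgN.
Qed.

Lemma ccvgJ z l : ccvg z l -> ccvg (fun x => (z x)^*) l^*.
Proof.
case=> zr zi; split.
  by rewrite ReJ; under eq_fun do rewrite ReJ.
by rewrite ImJ; under eq_fun do rewrite ImJ; apply: cvgN.
Qed.

Lemma ccvg_sum (I : Type) (r : seq I) (z : I -> T -> C) (l : I -> C) :
  (forall i, ccvg (z i) (l i)) ->
  ccvg (fun x => \sum_(i <- r) z i x) (\sum_(i <- r) l i).
Proof.
move=> h; elim: r => [|i r IH].
  by rewrite big_nil; apply: ccvg_ext (ccvg_cst _) => x; rewrite big_nil.
rewrite big_cons; apply: ccvg_ext (ccvgD (h i) IH) => x.
by rewrite big_cons.
Qed.

Lemma fcvg_unique (u : T -> R) (a b : R) :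
  u x @[x --> F] --> a -> u x @[x --> F] --> b -> a = b.
Proof. exact: norm_cvg_unique. Qed.

Lemma ccvg_unique z l l' : ccvg z l -> ccvg z l' -> l = l'.
Proof.
case=> zr zi [zr' zi'].
by apply: complex_eq; [apply: fcvg_unique zr zr'|apply: fcvg_unique zi zi'].
Qed.

Lemma ccvg_ge0 z l : ccvg z l -> (forall x, 0 <= z x) -> 0 <= l.
Proof.
case=> zr zi h; rewrite cplx_ge0; apply/andP; split.
  apply/eqP; apply: (fcvg_unique zi).
  have -> : (fun x => complex.Im (z x)) = (fun=> 0).
    by apply/funext => x; have := h x; rewrite cplx_ge0 => /andP[/eqP].
  exact: cvg_cst.
apply: cvgr_to_ge zr _; apply: nearW => x.
by have := h x; rewrite cplx_ge0 => /andP[].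
Qed.

Lemma mcvg_cst m n (A : 'M[C]_(m, n)) : mcvg (fun=> A) A.
Proof. by move=> i j; apply: ccvg_cst. Qed.

Lemma mcvgD m n (A B : T -> 'M[C]_(m, n)) L L' :
  mcvg A L -> mcvg B L' -> mcvg (fun x => A x + B x) (L + L').
Proof.
move=> hA hB i j; rewrite mxE; apply: ccvg_ext (ccvgD (hA i j) (hB i j)) => x.
by rewrite mxE.
Qed.

Lemma mcvgN m n (A : T -> 'M[C]_(m, n)) L :
  mcvg A L -> mcvg (fun x => - A x) (- L).
Proof.
by move=> hA i j; rewrite mxE; apply: ccvg_ext (ccvgN (hA i j)) => x; rewrite mxE.
Qed.

Lemma mcvgM m n q (A : T -> 'M[C]_(m, n)) (B : T -> 'M[C]_(n, q)) L L' :
  mcvg A L -> mcvg B L' -> mcvg (fun x => A x *m B x) (L *m L').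
Proof.
move=> hA hB i j; rewrite mxE.
apply: ccvg_ext (ccvg_sum (index_enum _) (fun k => ccvgM (hA i k) (hB k j))) => x.
by rewrite mxE.
Qed.

Lemma mcvg_adj m n (A : T -> 'M[C]_(m, n)) L :
  mcvg A L -> mcvg (fun x => (A x) ^t*) (L ^t*).
Proof.
by move=> hA i j; rewrite !mxE; apply: ccvg_ext (ccvgJ (hA j i)) => x; rewrite !mxE.
Qed.

Lemma mcvg_tr n (A : T -> 'M[C]_n) L :
  mcvg A L -> ccvg (fun x => \tr (A x)) (\tr L).
Proof. by move=> hA; apply: ccvg_sum => i; apply: hA. Qed.

Lemma mcvg_unique m n (A : T -> 'M[C]_(m, n)) L L' : mcvg A L -> mcvg A L' -> L = L'.
Proof. by move=> h h'; apply/matrixP => i j; apply: ccvg_unique (h i j) (h' i j). Qed.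

Lemma mcvg_herm n (A : T -> 'M[C]_n) L :
  mcvg A L -> (forall x, (A x) ^t* = A x) -> L ^t* = L.
Proof.
move=> h hA; have h' := mcvg_adj h; apply: mcvg_unique h' _.
by have -> : (fun x => A x ^t*) = A by apply/funext.
Qed.

Lemma mcvg_psd n (A : T -> 'M[C]_n) L :
  mcvg A L -> (forall x, psdmx (A x)) -> psdmx L.
Proof.
move=> h hA; split; first by apply/hermP; apply: (mcvg_herm h) => x; apply: psd_herm.
move=> v; apply: (@ccvg_ge0 (fun x => (v ^t* *m A x *m v) 0 0)); last first.
  by move=> x; case: (hA x).
by apply: (mcvgM (mcvgM (mcvg_cst _) h) (mcvg_cst _)).
Qed.

End Filter.

(** Limits along an ultrafilter play the role of convergent subsequences: every
    bounded sequence has one. *)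
Lemma ultra_on_nat : exists U : set_system nat,
  UltraFilter U /\ ((\oo : set_system nat) `<=` U)%classic.
Proof. by have [G [GU sFG]] := @ultraFilterLemma nat \oo _; exists G. Qed.

Section UltraLimits.
Variable U : set_system nat.
Context {UU : UltraFilter U}.

Lemma ultra_fmap (S : Type) (u : nat -> S) : UltraFilter (fmap u U).
Proof.
split; first exact: fmap_proper_filter.
move=> G GF sUG; rewrite eqEsubset; split => // A GA.
have [//|nA] := in_ultra_setVsetC (u @^-1` A) UU.
have : G (A `&` ~` A) by apply: filterI => //; apply: sUG.
by rewrite setICr => /filter_not_empty.
Qed.

Lemma ultra_lim (u : nat -> R) (M : R) : (forall n, `|u n| <= M) ->
  exists l : R, u n @[n --> U] --> l.
Proof.
move=> h; have := @segment_compact R (- M) M; rewrite compact_ultra.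
case/(_ (u n @[n --> U]) (ultra_fmap u)).
  have -> : (u n @[n --> U]) `[- M, M]%classic = U (u @^-1` `[- M, M]%classic) by [].
  apply: (@filterS _ U _ setT); last exact: filterT.
  by move=> n _; rewrite /= in_itv /= -ler_norml; apply: h.
by move=> l [_ hl]; exists l.
Qed.

Lemma ultra_clim (z : nat -> C) (M : R) : (forall n, `|z n| <= real_complex R M) ->
  exists l, ccvg U z l.
Proof.
move=> h.
have [a ha] : exists l : R, complex.Re (z n) @[n --> U] --> l.
  by apply: (@ultra_lim _ M) => n; rewrite -lecR; apply: le_trans (Re_le_norm _) (h n).
have [b hb] : exists l : R, complex.Im (z n) @[n --> U] --> l.
  by apply: (@ultra_lim _ M) => n; rewrite -lecR; apply: le_trans (Im_le_norm _) (h n).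
by exists (Complex a b).
Qed.

Lemma ultra_mlim m n (A : nat -> 'M[C]_(m, n)) (M : R) :
  (forall k i j, `|A k i j| <= real_complex R M) -> exists L, mcvg U A L.
Proof.
move=> h.
have /choice[f hf] : forall ij : 'I_m * 'I_n, exists l,
    ccvg U (fun k => A k ij.1 ij.2) l.
  by move=> ij; apply: (@ultra_clim _ M) => k.
by exists (\matrix_(i, j) f (i, j)) => i j; rewrite mxE; apply: (hf (i, j)).
Qed.

End UltraLimits.

End ComplexLimits.

(** * Real positive semidefinite and positive definite matrices *)

Section RealPSD.
Variable R : realType.
Local Notation C := (complex R).

Definition cmx m n (A : 'M[R]_(m, n)) : 'M[C]_(m, n) := map_mx (real_complex R) A.

Definition rpsd n (A : 'M[R]_n) : Prop :=
  A^T = A /\ forall u : 'cV[R]_n, 0 <= (u^T *m A *m u) 0 0.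

Lemma conj_real (a : R) : (real_complex R a)^* = real_complex R a.
Proof. by apply: complex_eq; rewrite ?ReJ ?ImJ //= oppr0. Qed.

Lemma cmx_adj m n (A : 'M[R]_(m, n)) : (cmx A) ^t* = cmx A^T.
Proof. by apply/matrixP => i j; rewrite !mxE; apply: conj_real. Qed.

Lemma cmxM m n q (A : 'M[R]_(m, n)) (B : 'M[R]_(n, q)) :
  cmx (A *m B) = cmx A *m cmx B.
Proof. exact: map_mxM. Qed.

Lemma cmxD m n (A B : 'M[R]_(m, n)) : cmx (A + B) = cmx A + cmx B.
Proof. exact: map_mxD. Qed.

Lemma cmxB m n (A B : 'M[R]_(m, n)) : cmx (A - B) = cmx A - cmx B.
Proof. exact: map_mxB. Qed.

Lemma cmxZ m n a (A : 'M[R]_(m, n)) : cmx (a *: A) = real_complex R a *: cmx A.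
Proof. exact: map_mxZ. Qed.

Lemma cmx_scalar n a : cmx (a%:M : 'M[R]_n) = (real_complex R a)%:M.
Proof. exact: map_scalar_mx. Qed.

Lemma tr_cmx n (A : 'M[R]_n) : \tr (cmx A) = real_complex R (\tr A).
Proof. exact: trace_map_mx. Qed.

Lemma cmx_inj m n (A B : 'M[R]_(m, n)) : cmx A = cmx B -> A = B.
Proof.
by move=> /matrixP h; apply/matrixP => i j; have := h i j; rewrite !mxE => -[].
Qed.

Definition Remx m n (A : 'M[C]_(m, n)) : 'M[R]_(m, n) := map_mx (@complex.Re R) A.
Definition Immx m n (A : 'M[C]_(m, n)) : 'M[R]_(m, n) := map_mx (@complex.Im R) A.

Lemma cmx_ReIm m n (A : 'M[C]_(m, n)) : A = cmx (Remx A) + 'i%C *: cmx (Immx A).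
Proof.
apply/matrixP => i j; rewrite !mxE; case: (A i j) => a b.
by apply: complex_eq; rewrite ?ReD ?ImD ?ReM ?ImM /=; ring.
Qed.

(** The cross terms between the real and the imaginary part of [v] cancel by the
    symmetry of [W]. *)
Lemma cmx_form n (W : 'M[R]_n) (v : 'cV[C]_n) : W^T = W ->
  (v ^t* *m cmx W *m v) 0 0
  = real_complex R (((Remx v)^T *m W *m Remx v) 0 0
                    + ((Immx v)^T *m W *m Immx v) 0 0).
Proof.
move=> hW; set a := Remx v; set b := Immx v.
have -> : v = cmx a + 'i%C *: cmx b by apply: cmx_ReIm.
have hi : ('i%C : C)^* = - 'i%C by apply: complex_eq; rewrite ?ReJ ?ImJ ?ReN ?ImN /= ?oppr0.
rewrite adjD adjZ hi !cmx_adj !mulmxDl !mulmxDr -!scalemxAl -!scalemxAr -!cmxM.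
have hab : (b^T *m W *m a) = (a^T *m W *m b).
  have <- : (b^T *m W *m a)^T = a^T *m W *m b by rewrite !trmx_mul trmxK hW mulmxA.
  by apply/matrixP => i j; rewrite !ord1 [RHS]mxE.
rewrite hab; move: (a^T *m W *m a) (b^T *m W *m b) (a^T *m W *m b) => x y z.
rewrite scalerA mulNr -expr2 sqr_i opprK scale1r scaleNr addrA addrK -cmxD.
by rewrite mxE [in LHS]mxE.
Qed.

Lemma rpsd_cmx n (W : 'M[R]_n) : rpsd W -> psdmx (cmx W).
Proof.
case=> hW pW; split; first by apply/hermP; rewrite cmx_adj hW.
by move=> v; rewrite cmx_form // ler0c addr_ge0.
Qed.

Lemma cmx_rpsd n (W : 'M[R]_n) : psdmx (cmx W) -> rpsd W.
Proof.
move=> pW; have hW : W^T = W by apply: cmx_inj; rewrite -cmx_adj psd_herm.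
split => // u; case: pW => _ /(_ (cmx u)).
by rewrite cmx_adj -!cmxM mxE ler0c.
Qed.

Lemma rpsdD n (A B : 'M[R]_n) : rpsd A -> rpsd B -> rpsd (A + B).
Proof.
case=> hA pA [hB pB]; split; first by rewrite linearD /= hA hB.
by move=> u; rewrite mulmxDr mulmxDl mxE addr_ge0.
Qed.

Lemma rpsdZ n a (A : 'M[R]_n) : 0 <= a -> rpsd A -> rpsd (a *: A).
Proof.
move=> a0 [hA pA]; split; first by rewrite linearZ /= hA.
by move=> u; rewrite -scalemxAr -scalemxAl mxE mulr_ge0.
Qed.

Lemma rpsd_conj m n (A : 'M[R]_n) (B : 'M[R]_(m, n)) : rpsd A -> rpsd (B *m A *m B^T).
Proof.
case=> hA pA; split; first by rewrite !trmx_mul trmxK hA mulmxA.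
by move=> u; have := pA (B^T *m u); rewrite trmx_mul trmxK !mulmxA.
Qed.

Lemma rpsd_scalar n a : 0 <= a -> rpsd (a%:M : 'M[R]_n).
Proof.
move=> a0; apply: cmx_rpsd; rewrite cmx_scalar -scalemx1.
by apply: psd_scale; rewrite ?ler0c //; apply: psd1.
Qed.

Lemma rpsd_tr_ge0 n (A : 'M[R]_n) : rpsd A -> 0 <= \tr A.
Proof. by move=> /rpsd_cmx/psd_tr_ge0; rewrite tr_cmx ler0c. Qed.

Lemma rpsd_trM_ge0 n (A B : 'M[R]_n) : rpsd A -> rpsd B -> 0 <= \tr (A *m B).
Proof.
move=> /rpsd_cmx pA /rpsd_cmx pB; have := psd_trM_ge0 pA pB.
by rewrite -cmxM tr_cmx ler0c.
Qed.

Lemma rpsd_le_tr n (A : 'M[R]_n) : rpsd A -> rpsd ((\tr A)%:M - A).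
Proof.
move=> /rpsd_cmx/psd_le_tr; rewrite tr_cmx -cmx_scalar -cmxB.
exact: cmx_rpsd.
Qed.

Lemma cmx_norm (z : R) : `|real_complex R z : C| = real_complex R `|z|.
Proof. by rewrite normc_def /= expr0n addr0 sqrtr_sqr. Qed.

Lemma rpsd_entry_le_tr n (A : 'M[R]_n) i j : rpsd A -> `|A i j| <= \tr A.
Proof.
move=> /rpsd_cmx/(psd_entry_le_tr i j); rewrite tr_cmx mxE.
by rewrite cmx_norm lecR.
Qed.

Lemma posdef_rpsd n (A : 'M[R]_n) : posdef_sym A -> rpsd A.
Proof.
case=> hA pA; split => // u; have [->|u0] := eqVneq u 0.
  by rewrite mulmx0 mxE.
by apply: ltW; apply: pA.
Qed.

Lemma normv_gt0 n (u : 'cV[R]_n) : u != 0 -> 0 < (u^T *m u) 0 0.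
Proof.
move=> u0; rewrite lt_def; apply/andP; split; last first.
  by rewrite mxE sumr_ge0 // => i _; rewrite mxE -expr2 sqr_ge0.
apply: contra_neq u0 => h; apply/matrixP => i j; rewrite ord1 [RHS]mxE.
move: h; rewrite mxE => /psumr_eq0P h.
have /eqP : (u^T) 0 i * u i 0 = 0.
  by apply: h => // k _; rewrite mxE -expr2 sqr_ge0.
by rewrite mxE mulf_eq0 orbb => /eqP.
Qed.

Lemma posdefD n (A B : 'M[R]_n) : posdef_sym A -> rpsd B -> posdef_sym (A + B).
Proof.
case=> hA pA [hB pB]; split; first by rewrite linearD /= hA hB.
move=> u u0; rewrite mulmxDr mulmxDl mxE; apply: ltr_wpDr; first exact: pB.
exact: pA.
Qed.

Lemma posdefZ n a (A : 'M[R]_n) : 0 < a -> posdef_sym A -> posdef_sym (a *: A).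
Proof.
move=> a0 [hA pA]; split; first by rewrite linearZ /= hA.
by move=> u u0; rewrite -scalemxAr -scalemxAl mxE mulr_gt0 // pA.
Qed.

Lemma posdef_scalar n a : 0 < a -> posdef_sym (a%:M : 'M[R]_n).
Proof.
move=> a0; split; first by rewrite tr_scalar_mx.
move=> u u0; rewrite mul_mx_scalar -scalemxAl mxE mulr_gt0 //.
exact: normv_gt0.
Qed.

Lemma rpsd_posdef n (A : 'M[R]_n) c : 0 < c -> rpsd (A - c%:M) -> posdef_sym A.
Proof. by move=> c0 h; rewrite -[A](subrK c%:M) addrC; apply: posdefD => //; apply: posdef_scalar. Qed.

Lemma posdef_unit n (A : 'M[R]_n) : posdef_sym A -> A \in unitmx.
Proof.
case=> hA pA; rewrite -row_free_unit -kermx_eq0; apply/eqP/row_matrixP => i.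
rewrite row0; apply/eqP; apply/contraT => h.
have h' : (row i (kermx A))^T != 0 by rewrite -trmx0 (inj_eq trmx_inj).
have := pA _ h'; rewrite trmxK -row_mul mulmx_ker row0 mul0mx mxE.
by rewrite ltxx.
Qed.

Lemma posdef_inv n (A : 'M[R]_n) : posdef_sym A -> posdef_sym (invmx A).
Proof.
move=> pA; have uA := posdef_unit pA; case: pA => hA pA.
split; first by rewrite trmx_inv hA.
move=> u u0; have := pA (invmx A *m u).
rewrite trmx_mul trmx_inv hA !mulmxA mulmxKV //; apply.
by apply: contra_neq u0 => h; rewrite -[u](mulKVmx uA) h mulmx0.
Qed.

(** The first-order lower bound of the convex map [A |-> A^-1]: the difference
    is [(A^-1 - X) A (A^-1 - X)]. *)
Lemma inv_tangent n (A X : 'M[R]_n) : posdef_sym A -> X^T = X ->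
  rpsd (invmx A - (X + X - X *m A *m X)).
Proof.
move=> pA hX; have uA := posdef_unit pA.
have hA : A^T = A by case: pA.
have -> : invmx A - (X + X - X *m A *m X)
    = (invmx A - X) *m A *m (invmx A - X)^T.
  have -> : (invmx A - X)^T = invmx A - X by rewrite linearB /= trmx_inv hA hX.
  rewrite !mulmxBl !mulmxBr mulVmx // mul1mx.
  rewrite -(mulmxA X A (invmx A)) mulmxV // mulmx1 mul1mx.
  by rewrite !opprB opprD !addrA; congr (_ + _); rewrite addrAC.
by apply: rpsd_conj; apply: posdef_rpsd.
Qed.

(** This is [inv_tangent] at [X = B^-1]. *)
Lemma inv_antitone n (A B : 'M[R]_n) : posdef_sym A -> posdef_sym B ->
  rpsd (B - A) -> rpsd (invmx A - invmx B).
Proof.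
move=> pA pB h; have uB := posdef_unit pB.
have hB : (invmx B)^T = invmx B by case: (posdef_inv pB).
have := rpsdD (inv_tangent pA hB) (rpsd_conj (invmx B) h).
rewrite hB mulmxBr mulmxBl mulVmx // mul1mx.
have -> // (a b c : 'M[R]_n) : a - (b + b - c) + (b - c) = a - b.
by apply/matrixP => i j; rewrite !mxE; ring.
Qed.

(** Inverting [A^-1 <= tr (A^-1) + 1] gives an explicit lower bound for [A]. *)
Lemma posdef_lower n (A : 'M[R]_n) : posdef_sym A ->
  exists2 c, 0 < c & rpsd (A - c%:M).
Proof.
move=> pA; have uA := posdef_unit pA; have pI := posdef_inv pA.
pose t := \tr (invmx A) + 1.
have t0 : 0 < t by apply: ltr_wpDl => //; apply/rpsd_tr_ge0/posdef_rpsd.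
exists t^-1; first by rewrite invr_gt0.
have h : rpsd (t%:M - invmx A).
  have := rpsdD (rpsd_le_tr (posdef_rpsd pI)) (rpsd_scalar n ler01).
  by rewrite addrAC -raddfD.
have := inv_antitone pI (posdef_scalar n t0) h.
by rewrite invmxK invmx_scalar.
Qed.

Lemma posdef_tr_gt0 n (A : 'M[R]_n) : posdef_sym A -> (0 < n)%N -> 0 < \tr A.
Proof.
move=> /posdef_lower[c c0 h] n0; have := rpsd_tr_ge0 h.
rewrite linearB /= mxtrace_scalar subr_ge0; apply: lt_le_trans.
by rewrite pmulrn_lgt0.
Qed.

Lemma posdef_conj_unit n (A B : 'M[R]_n) : posdef_sym A -> B \in unitmx ->
  posdef_sym (B *m A *m B^T).
Proof.
move=> [hA pA] uB; split; first by rewrite !trmx_mul trmxK hA mulmxA.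
move=> u u0; have := pA (B^T *m u); rewrite trmx_mul trmxK !mulmxA; apply.
apply: contra_neq u0 => h.
have uBT : B^T \in unitmx by rewrite unitmx_tr.
by rewrite -[u](mulKmx uBT) h mulmx0.
Qed.

(** The resolvent identity, once on each side of the inverse. *)
Lemma inv_expansion n (A D : 'M[R]_n) t : A \in unitmx -> A + t *: D \in unitmx ->
  invmx (A + t *: D) = invmx A - t *: (invmx A *m D *m invmx A)
    + t ^+ 2 *: (invmx A *m D *m invmx (A + t *: D) *m D *m invmx A).
Proof.
move=> uA uJ; set J := A + _; set B := invmx J; set V := invmx A.
have e1 : B = V - t *: (B *m D *m V).
  have : B *m J *m V = V by rewrite mulVmx // mul1mx.
  rewrite mulmxDr mulmxDl -(mulmxA B A V) mulmxV // mulmx1 -scalemxAr -scalemxAl => h.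
  exact: (canRL (addrK _) h).
have e2 : B = V - t *: (V *m D *m B).
  have : V *m (J *m B) = V by rewrite mulmxV // mulmx1.
  rewrite mulmxA mulmxDr mulmxDl mulVmx // mul1mx -scalemxAr -scalemxAl => h.
  exact: (canRL (addrK _) h).
have e3 : B *m D *m V = V *m D *m V - t *: (V *m D *m B *m D *m V).
  by rewrite {1}e2 !mulmxBl -!scalemxAl.
by rewrite {1}e1 e3 scalerBr opprB scalerA expr2 addrA addrAC.
Qed.

End RealPSD.

(** * Attainable pairs of a response and a covariance bound *)

Section Attainable.
Variables (R : realType) (d p : nat).
Local Notation C := (complex R).
Variables (r : 'M[C]_d) (dr : 'I_p -> 'M[C]_d).
Hypotheses (pr : psdmx r).
(* A differentiable curve of positive matrices through [r] has derivatives of this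
   kind: the form at a vector of the kernel of [r] has a minimum at [r]. *)
Hypothesis kernel_dr : forall k (v : 'cV[C]_d), r *m v = 0 ->
  (v ^t* *m dr k *m v) 0 0 = 0.

Definition response (Y : 'I_p -> 'M[C]_d) : 'M[R]_p :=
  \matrix_(i, j) complex.Re (\tr (dr i *m Y j)).

(** A locally unbiased family has response [1]; the estimators built from the
    scores of a measurement with average information [I] have response [I] and
    covariance at most [I]. Leaving the response free puts both in one convex
    set, in which [attainable_mul] passes from [(1, V)] to [(V^-1, V^-1)] and
    back. *)
Definition attainable (D V : 'M[R]_p) : Prop :=
  exists Y : 'I_p -> 'M[C]_d,
  [/\ forall j, (Y j) ^t* = Y j, response Y = D & psdmx (cmx V - gram r Y Y)].

Lemma attainable_sym D V : attainable D V -> V^T = V.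
Proof.
case=> Y [hY _ /psd_herm]; rewrite adjB gram_adj // => /addIr.
by rewrite cmx_adj => /cmx_inj.
Qed.

Lemma attainable_psd D V : attainable D V -> rpsd V.
Proof.
case=> Y [hY _ h]; apply: cmx_rpsd; rewrite -[cmx V](subrK (gram r Y Y)).
exact: psd_add h (gram_psd pr hY).
Qed.

Lemma attainable_up D V W : attainable D V -> rpsd W -> attainable D (V + W).
Proof.
case=> Y [hY hD h] /rpsd_cmx hW; exists Y; split; [exact: hY|exact: hD|].
by rewrite cmxD addrAC; apply: psd_add h hW.
Qed.

(** The linear change of observables [Y |-> Y A]. *)
Lemma attainable_mul D V A : attainable D V -> attainable (D *m A) (A^T *m V *m A).
Proof.
case=> Y [hY hD h].
pose Y' j := \sum_k real_complex R (A k j) *: Y k.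
exists Y'; split.
- move=> j; rewrite /Y' adj_sum; apply: eq_bigr => k _.
  by rewrite adjZ hY conj_real.
- apply/matrixP => i j; rewrite -hD !mxE /Y' mulmx_sumr mxtrace_sum /= Re_sum.
  apply: eq_bigr => k _.
  by rewrite -scalemxAr mxtraceZ ReZr mxE mulrC.
- have -> : gram r Y' Y' = (cmx A)^T *m gram r Y Y *m cmx A.
    rewrite -gram_mull -gram_mulr; apply/matrixP => i j; rewrite !mxE.
    have e l : Y' l = \sum_k cmx A k l *: Y k by apply: eq_bigr => k _; rewrite mxE.
    by rewrite e (e j).
  have hA : cmx A^T = (cmx A)^T by rewrite /cmx map_trmx.
  have := psd_conj (cmx A^T) h; rewrite cmx_adj trmxK.
  by rewrite !cmxM hA mulmxBr mulmxBl.
Qed.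

Lemma attainable_convex D1 V1 D2 V2 t : 0 <= t <= 1 ->
  attainable D1 V1 -> attainable D2 V2 ->
  attainable ((1 - t) *: D1 + t *: D2) ((1 - t) *: V1 + t *: V2).
Proof.
move=> /andP[t0 t1] [Y1 [h1 hD1 p1]] [Y2 [h2 hD2 p2]].
pose a := real_complex R (1 - t); pose b := real_complex R t.
have hab : a + b = 1 by rewrite /a /b -rmorphD subrK rmorph1.
have a0 : 0 <= a by rewrite ler0c subr_ge0.
have b0 : 0 <= b by rewrite ler0c.
exists (fun j => a *: Y1 j + b *: Y2 j); split.
- by move=> j; rewrite adjD !adjZ h1 h2 !conj_real.
- apply/matrixP => i j; rewrite -hD1 -hD2 !mxE mulmxDr -!scalemxAr mxtraceD.
  by rewrite !mxtraceZ ReD !ReZr.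
- rewrite cmxD !cmxZ; exact: gram_convex_psd a0 b0 hab h1 h2 p1 p2.
Qed.

Lemma tr_sqr_bound n (A B : 'M[C]_n) m : (forall k l, `|B k l| ^+ 2 <= m) ->
  0 <= m -> `|\tr (A *m B)| ^+ 2 <= (\sum_k \sum_l `|A k l|) ^+ 2 * m.
Proof.
move=> h m0.
have hB k l : `|B k l| <= sqrtC m.
  by rewrite -(@ler_pXn2r _ 2) ?nnegrE ?sqrtC_ge0 // sqrtCK.
rewrite -[m in X in _ <= X]sqrtCK -exprMn.
rewrite ler_pXn2r ?nnegrE ?mulr_ge0 ?sqrtC_ge0 //; last first.
  by do 2! (apply: sumr_ge0 => ? _).
rewrite /mxtrace mulr_suml; apply: le_trans (ler_norm_sum _ _ _) _.
apply: ler_sum => k _; rewrite mxE mulr_suml; apply: le_trans (ler_norm_sum _ _ _) _.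
by apply: ler_sum => l _; rewrite normrM ler_wpM2l.
Qed.

(** The response to [dr i] factors through the truncation of [X], whose entries
    are bounded by [qform r X]; this is where the boundary condition on [dr] is
    used. It says that the model has finite quantum information. *)
Lemma derivative_bound : exists2 c : R, 0 <= c &
  forall i X, X ^t* = X ->
    complex.Re (\tr (dr i *m X)) ^+ 2 <= c * complex.Re (qform r X).
Proof.
have [Q [c [hQ hD _ c0 hb]]] := truncation pr.
pose s i := \sum_k \sum_l `|dr i k l|.
pose m := (\sum_i s i ^+ 2) * c.
have s0 i : 0 <= s i by do 2! (apply: sumr_ge0 => ? _).
have m0 : 0 <= m by rewrite mulr_ge0 // sumr_ge0 // => i _; rewrite exprn_ge0.
exists (complex.Re m); first by move: m0; rewrite cplx_ge0 => /andP[].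
move=> i X hX; have q0 := qform_ge0 X pr.
have h : `|\tr (dr i *m X)| ^+ 2 <= m * qform r X.
  rewrite -(hD _ (kernel_dr i) X).
  apply: le_trans (tr_sqr_bound (dr i) (hb X hX) _) _; first by rewrite mulr_ge0.
  rewrite mulrA ler_wpM2r // ler_wpM2r // (bigD1 i) //= lerDl.
  by apply: sumr_ge0 => k _; rewrite exprn_ge0.
rewrite -add_Re2_Im2 in h; have := cplx_le h.
have -> : complex.Re (m * qform r X) = complex.Re m * complex.Re (qform r X).
  rewrite ReM; move: m0; rewrite cplx_ge0 => /andP[/eqP-> _].
  by rewrite mul0r subr0.
by apply: le_trans; rewrite /= lerDl sqr_ge0.
Qed.

Lemma attainable_bound : exists2 c : R, 0 <= c &
  forall D V, attainable D V -> forall (u : 'cV[R]_p) i,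
    ((D *m u) i 0) ^+ 2 <= c * (u^T *m V *m u) 0 0.
Proof.
have [c c0 hc] := derivative_bound; exists c => // D V [Y [hY hD hV]] u i.
have hVs : V^T = V by apply: (@attainable_sym D); exists Y.
pose X := \sum_j real_complex R (u j 0) *: Y j.
have hX : X ^t* = X.
  by rewrite /X adj_sum; apply: eq_bigr => j _; rewrite adjZ hY conj_real.
have -> : (D *m u) i 0 = complex.Re (\tr (dr i *m X)).
  rewrite mxE /X mulmx_sumr mxtrace_sum /= Re_sum; apply: eq_bigr => j _.
  by rewrite -scalemxAr mxtraceZ ReZr mulrC -hD mxE.
apply: le_trans (hc i X hX) _; rewrite ler_wpM2l //.
have := psd_form_le (cmx u) hV; rewrite gram_form //.
rewrite cmx_adj -!cmxM [X in _ <= X]mxE => /cplx_le; apply: le_trans.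
rewrite (_ : \sum_j _ = X) //; apply: eq_bigr => j _.
by rewrite mxE conj_real.
Qed.

(** A quantum Cramer-Rao bound: with response [1], each coordinate of [u] is the
    response of an observable with second moment at most [u^T V u]. *)
Lemma attainable1_lower : exists2 c : R, 0 < c &
  forall V, attainable 1%:M V -> rpsd (V - c%:M).
Proof.
have [c c0 hc] := attainable_bound.
pose m := c *+ p + 1.
have m0 : 0 < m by rewrite ltr_wpDl // mulrn_wge0.
exists m^-1; rewrite ?invr_gt0 // => V hV; split.
  by rewrite linearB /= tr_scalar_mx (attainable_sym hV).
move=> u; rewrite mulmxBr mulmxBl mxE [X in _ + X]mxE subr_ge0.
rewrite mul_mx_scalar -scalemxAl mxE.
have V0 : 0 <= (u^T *m V *m u) 0 0 by case: (attainable_psd hV).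
rewrite mulrC ler_pdivrMr //.
apply: (@le_trans _ _ ((u^T *m V *m u) 0 0 * (c *+ p))); last first.
  by rewrite ler_wpM2l // lerDl.
rewrite mxE mulrnAr; set q := _ 0 0 * c.
have -> : q *+ p = \sum_(i < p) q by rewrite sumr_const card_ord.
apply: ler_sum => i _.
by have := hc _ _ hV u i; rewrite mul1mx expr2 [c * _]mulrC [u^T 0 i]mxE.
Qed.

Lemma attainable_exists Y : (forall j, (Y j) ^t* = Y j) ->
  exists V, attainable (response Y) V.
Proof.
move=> hY; have pZ := gram_psd pr hY.
exists ((complex.Re (\tr (gram r Y Y)))%:M), Y; split; [exact: hY|by []|].
rewrite cmx_scalar; have := psd_le_tr pZ.
suff -> : real_complex R (complex.Re (\tr (gram r Y Y))) = \tr (gram r Y Y) by [].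
have := psd_tr_ge0 pZ; rewrite cplx_ge0 => /andP[/eqP h _].
by apply: complex_eq; rewrite //= h.
Qed.

Section Compactness.
Variable U : set_system nat.
Context {UU : UltraFilter U}.

(** The truncated observables have second moments at most the diagonal of [V n],
    hence are bounded, and they have a limit along [U]; responses and Gram
    matrices are unchanged by truncation and pass to the limit. *)
Lemma attainable_limit (D V : nat -> 'M[R]_p) (M : R) :
  (forall n, attainable (D n) (V n)) ->
  (forall n i j, `|D n i j| <= M) -> (forall n i j, `|V n i j| <= M) ->
  exists D' V', [/\ attainable D' V',
    forall i j, D n i j @[n --> U] --> D' i j &
    forall i j, V n i j @[n --> U] --> V' i j].
Proof.
move=> hDV hD hV.
have [D' hD'] : exists D', mcvg U (fun n => cmx (D n)) D'.
  apply: (@ultra_mlim _ _ _ _ _ _ M) => k i j.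
  by rewrite mxE cmx_norm lecR.
have [V' hV'] : exists V', mcvg U (fun n => cmx (V n)) V'.
  apply: (@ultra_mlim _ _ _ _ _ _ M) => k i j.
  by rewrite mxE cmx_norm lecR.
have /choice[Y hY] := hDV.
have [Q [c [hQ hdr hr c0 hb]]] := truncation pr.
pose T n j := Y n j - Q *m Y n j *m Q.
have [m hm] : exists m : R, forall n j k l, `|T n j k l| <= real_complex R m.
  pose m := sqrtC (c * real_complex R M).
  exists (complex.Re m) => n j k l.
  have M0 : 0 <= M by apply: le_trans (hV n j j).
  have cM0 : 0 <= c * real_complex R M by rewrite mulr_ge0 // ler0c.
  have -> : real_complex R (complex.Re m) = m.
    have : 0 <= m by rewrite sqrtC_ge0.
    by rewrite cplx_ge0 => /andP[/eqP h _]; apply: complex_eq; rewrite //= h.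
  rewrite -(@ler_pXn2r _ 2) ?nnegrE ?sqrtC_ge0 // sqrtCK.
  have [hj _ hz] := hY n.
  apply: le_trans (hb _ (hj j) k l) _; rewrite ler_wpM2l //.
  have := psd_diag_ge0 j hz; rewrite !mxE subr_ge0 /qform hj => /le_trans; apply.
  by rewrite lecR; apply: le_trans (hV n j j); apply: ler_norm.
have /choice[Y' hY'] : forall j, exists L, mcvg U (fun n => T n j) L.
  by move=> j; apply: (@ultra_mlim _ _ _ _ _ _ m).
have hTh n j : (T n j) ^t* = T n j.
  by have [hj _ _] := hY n; rewrite /T adjB !adjM hj hQ mulmxA.
exists (Remx D'), (Remx V'); split; last 2 first.
- by move=> i j; have [h _] := hD' i j; move: h; rewrite mxE; under eq_fun do rewrite mxE.
- by move=> i j; have [h _] := hV' i j; move: h; rewrite mxE; under eq_fun do rewrite mxE.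
exists Y'; split.
- by move=> j; apply: (mcvg_herm (hY' j)).
- apply/matrixP => i j; rewrite !mxE.
  have [h _] := mcvg_tr (mcvgM (mcvg_cst (dr i)) (hY' j)).
  have [h' _] := hD' i j.
  have e : (fun n => complex.Re (cmx (D n) i j))
      = (fun n => complex.Re (\tr (dr i *m T n j))).
    apply/funext => n; rewrite mxE /=; have [_ <- _] := hY n.
    by rewrite mxE (hdr _ (kernel_dr i)).
  by rewrite e in h'; apply: fcvg_unique h h'.
- have -> : cmx (Remx V') = V'.
    apply/matrixP => i j; rewrite !mxE; apply: complex_eq => //=.
    have [_ h] := hV' i j; apply: (fcvg_unique _ h).
    by under eq_fun do rewrite mxE /=; apply: cvg_cst.
  have hG : mcvg U (fun n => gram r (T n) (T n)) (gram r Y' Y').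
    move=> i j; rewrite mxE.
    apply: ccvg_ext (mcvg_tr (mcvgM (mcvgM (mcvg_cst r) (hY' i)) (hY' j))) => n.
    by rewrite mxE.
  apply: (mcvg_psd (mcvgD hV' (mcvgN hG))).
  move=> n; have [_ _] := hY n.
  have -> // : gram r (T n) (T n) = gram r (Y n) (Y n).
  by apply/matrixP => i j; rewrite !mxE hr.
Qed.

End Compactness.

End Attainable.

(** * A separating hyperplane in the space of Hermitian matrices *)

Section SmallSteps.
Variable R : realType.

Lemma ge0_of_small_steps (a b : R) :
  (forall t : R, 0 < t <= 1 -> 0 <= t * a + t ^+ 2 * b) -> 0 <= a.
Proof.
move=> h; rewrite leNgt; apply/negP => a0.
pose t := Num.min 1 (- a / (2 * (`|b| + 1))).
have b1 : 0 < `|b| + 1 by rewrite ltr_wpDl.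
have t0 : 0 < t by rewrite lt_min ltr01 divr_gt0 ?oppr_gt0 // mulr_gt0.
have := h t; rewrite t0 ge_min lexx /= => /(_ isT).
rewrite expr2 -mulrA -mulrDr pmulr_rge0 // leNgt => /negP; apply.
have tb : t * b <= - a / 2.
  apply: (@le_trans _ _ (t * (`|b| + 1))).
    by rewrite ler_wpM2l ?(ltW t0) // (le_trans (ler_norm b)) // lerDl.
  rewrite -ler_pdivlMr // -mulrA -invfM.
  by rewrite ge_min lexx orbT.
have : a + t * b <= a - a / 2 by rewrite lerD2l; rewrite mulNr in tb.
by move=> /le_lt_trans; apply; lra.
Qed.

Lemma ge0_of_large_steps (a b : R) : (forall t : R, 0 <= t -> 0 <= b + t * a) -> 0 <= a.
Proof.
move=> h; rewrite leNgt; apply/negP => a0.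
have t0 : 0 <= (`|b| + 1) / - a by rewrite divr_ge0 ?addr_ge0 // oppr_ge0 ltW.
have := h _ t0; rewrite invrN mulrN mulNr divfK ?lt_eqF // leNgt => /negP; apply.
by have := ler_norm b; lra.
Qed.

End SmallSteps.

Section Separation.
Variables (R : realType) (n : nat).
Local Notation C := (complex R).
Implicit Types A B T : 'M[R]_n.

Definition ip A B : R := \sum_i \sum_j A i j * B i j.

Lemma ipC A B : ip A B = ip B A.
Proof. by apply: eq_bigr => i _; apply: eq_bigr => j _; rewrite mulrC. Qed.

Lemma ipDr A B B' : ip A (B + B') = ip A B + ip A B'.
Proof.
rewrite -big_split; apply: eq_bigr => i _; rewrite -big_split; apply: eq_bigr => j _.
by rewrite mxE mulrDr.
Qed.

Lemma ipZr A c B : ip A (c *: B) = c * ip A B.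
Proof.
rewrite mulr_sumr; apply: eq_bigr => i _; rewrite mulr_sumr; apply: eq_bigr => j _.
by rewrite mxE mulrCA.
Qed.

Lemma ipNr A B : ip A (- B) = - ip A B.
Proof. by rewrite -scaleN1r ipZr mulN1r. Qed.

Lemma ipDl A A' B : ip (A + A') B = ip A B + ip A' B.
Proof. by rewrite ipC ipDr !(ipC B). Qed.

Lemma ipZl A c B : ip (c *: A) B = c * ip A B.
Proof. by rewrite ipC ipZr ipC. Qed.

Lemma ip1 A : ip A 1%:M = \tr A.
Proof.
apply: eq_bigr => i _; rewrite (bigD1 i) //= mxE eqxx mulr1 big1 ?addr0 // => j ji.
by rewrite mxE eq_sym (negPf ji) mulr0.
Qed.

Lemma ip_delta A i j : ip A (delta_mx i j) = A i j.
Proof.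
rewrite /ip (bigD1 i) //= (bigD1 j) //= mxE !eqxx mulr1 big1 => [|l /negPf lj].
  rewrite addr0 big1 => [|k /negPf ki]; first by rewrite addr0.
  by rewrite big1 // => l _; rewrite mxE ki mulr0.
by rewrite mxE lj andbF mulr0.
Qed.

Lemma ip_ge0 A : 0 <= ip A A.
Proof. by do 2! (apply: sumr_ge0 => ? _); rewrite -expr2 sqr_ge0. Qed.

Lemma entry_sqr_le_ip A i j : A i j ^+ 2 <= ip A A.
Proof.
rewrite /ip (bigD1 i) //= (bigD1 j) //= -expr2 -addrA lerDl.
apply: addr_ge0; first by apply: sumr_ge0 => ? _; rewrite -expr2 sqr_ge0.
by do 2! (apply: sumr_ge0 => ? _); rewrite -expr2 sqr_ge0.
Qed.

Lemma ip_trM A B : ip A B = \tr (A *m B^T).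
Proof. by apply: eq_bigr => i _; rewrite mxE; apply: eq_bigr => j _; rewrite mxE. Qed.

(** The real space of Hermitian matrices, encoded by the real square matrices:
    the symmetric part is the real part and the skew part the imaginary part.
    The encoding is isometric ([ip_herm]). *)
Definition herm T : 'M[C]_n :=
  \matrix_(i, j) Complex ((T i j + T j i) / 2) ((T i j - T j i) / 2).

Lemma herm_adj T : (herm T) ^t* = herm T.
Proof.
apply/matrixP => i j; rewrite !mxE; apply: complex_eq.
  by rewrite [LHS]ReJ /= addrC.
by rewrite [LHS]ImJ /= -mulNr opprB.
Qed.

Lemma hermD A B : herm (A + B) = herm A + herm B.
Proof.
by apply/matrixP => i j; rewrite !mxE; apply: complex_eq; rewrite ?ReD ?ImD /=; ring.
Qed.

Lemma hermZ c A : herm (c *: A) = real_complex R c *: herm A.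
Proof.
by apply/matrixP => i j; rewrite !mxE; apply: complex_eq; rewrite ?ReZr ?ImZr /=; ring.
Qed.

Lemma herm_sym A : A^T = A -> herm A = cmx A.
Proof.
move=> /matrixP h; apply/matrixP => i j; rewrite !mxE; have := h i j; rewrite mxE => ->.
by apply: complex_eq => /=; [field|rewrite subrr mul0r].
Qed.

Lemma herm_surj (H : 'M[C]_n) : H ^t* = H -> exists T, herm T = H.
Proof.
move=> /matrixP h; exists (\matrix_(i, j) (complex.Re (H i j) + complex.Im (H i j))).
apply/matrixP => i j; have := h i j; rewrite !mxE => e.
have eR : complex.Re (H j i) = complex.Re (H i j) by rewrite -e [RHS]ReJ.
have eI : complex.Im (H j i) = - complex.Im (H i j) by rewrite -e [X in - X]ImJ opprK.
by apply: complex_eq => /=; rewrite eR eI; field.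
Qed.

Lemma ip_herm A B : complex.Re (\tr (herm A *m herm B)) = ip A B.
Proof.
transitivity (\sum_i \sum_j (A i j * B i j + A j i * B j i) / 2).
  rewrite /mxtrace Re_sum; apply: eq_bigr => i _; rewrite mxE Re_sum.
  by apply: eq_bigr => j _; rewrite !mxE ReM /=; field.
transitivity ((ip A B + ip A B) / 2); last by field.
have {2}-> : ip A B = \sum_i \sum_j A j i * B j i by rewrite /ip exchange_big.
rewrite -big_split /= mulr_suml; apply: eq_bigr => i _.
by rewrite -big_split /= mulr_suml.
Qed.

(** The positive matrices contain the ball of radius [s] around [s]. *)
Lemma psd_herm_near1 s B : 0 < s -> ip B B <= s ^+ 2 -> psdmx (herm (s%:M + B)).
Proof.
move=> s0 hB; rewrite hermD herm_sym ?tr_scalar_mx // cmx_scalar.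
apply: psd_shift; [exact: herm_adj|by rewrite ltcR|].
have p := psd_tr_ge0 (psd_MMadj (herm B)).
rewrite herm_adj in p *.
have -> : \tr (herm B *m herm B) = real_complex R (ip B B).
  move: p; rewrite cplx_ge0 => /andP[/eqP h _].
  by apply: complex_eq; [exact: ip_herm|rewrite h].
by rewrite -rmorphXn lecR.
Qed.

Section Convex.
Variable K : set 'M[R]_n.
Hypothesis convK : forall x y (t : R), 0 <= t <= 1 -> K x -> K y -> K ((1 - t) *: x + t *: y).
Hypothesis upK : forall x y, K x -> psdmx (herm y) -> K (x + y).
Hypothesis K0 : ~ K 0.
Hypothesis Kne : exists x, K x.

(** If [x + e] were shorter than [e], then [- x = e - (x + e)] would be positive
    and [0 = x - x] would belong to [K]. *)
Lemma shifted_far (e : R) x : 0 < e -> K x -> e ^+ 2 <= ip (x + e%:M) (x + e%:M).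
Proof.
move=> e0 Kx; rewrite leNgt; apply/negP => h; apply: K0.
rewrite -(subrr x); apply: upK => //.
have -> : - x = e%:M + (- 1) *: (x + e%:M).
  by rewrite scaleN1r opprD addrCA subrr addr0.
apply: psd_herm_near1 => //.
by rewrite ipZl ipZr mulrA mulrNN !mulr1 mul1r ltW.
Qed.

Section Ultra.
Variable U : set_system nat.
Context {UU : UltraFilter U}.
Hypothesis ooU : ((\oo : set_system nat) `<=` U)%classic.

Definition rmcvg (A : nat -> 'M[R]_n) (L : 'M[R]_n) :=
  forall i j, A k i j @[k --> U] --> L i j.

Lemma ultra_rmlim (A : nat -> 'M[R]_n) (M : R) :
  (forall k, ip (A k) (A k) <= M) -> exists L, rmcvg A L.
Proof.
move=> h.
have /choice[f hf] : forall ij : 'I_n * 'I_n, exists l : R,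
    A k ij.1 ij.2 @[k --> U] --> l.
  move=> ij; apply: (@ultra_lim _ _ _ _ (M + 1)) => k.
  have h1 := le_trans (entry_sqr_le_ip (A k) ij.1 ij.2) (h k).
  rewrite -real_normK ?num_real // in h1.
  have h2 := sqr_ge0 (`|A k ij.1 ij.2| - 1).
  have h3 := normr_ge0 (A k ij.1 ij.2).
  by rewrite sqrrB1 in h2; lra.
by exists (\matrix_(i, j) f (i, j)) => i j; rewrite mxE; apply: (hf (i, j)).
Qed.

Lemma rcvg_sum (I : Type) (r : seq I) (z : I -> nat -> R) (l : I -> R) :
  (forall i, z i k @[k --> U] --> l i) ->
  \sum_(i <- r) z i k @[k --> U] --> \sum_(i <- r) l i.
Proof.
move=> h; elim: r => [|i r IH].
  by rewrite big_nil; under eq_fun do rewrite big_nil; apply: cvg_cst.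
by rewrite big_cons; under eq_fun do rewrite big_cons; apply: cvgD.
Qed.

Lemma ip_cvg (A : nat -> 'M[R]_n) L B : rmcvg A L -> ip (A k) B @[k --> U] --> ip L B.
Proof.
move=> h; apply: rcvg_sum => i; apply: rcvg_sum => j.
by apply: cvgM; [exact: h|exact: cvg_cst].
Qed.

Lemma ultra_harmonic : (k.+1%:R^-1 : R) @[k --> U] --> 0.
Proof. by move=> A /(@cvg_harmonic R) hA; apply: ooU. Qed.

(** By [shifted_far] the points of [K + e] stay away from [0], so that the limit
    [a] of a sequence of points of [K + e] whose length tends to the infimum is
    not zero; [a] is the normal of a hyperplane that separates [0] from [K + e].
    It is nonnegative on the positive cone, hence its trace is at least its
    length, and one may divide by the trace. *)
Lemma approx_separation (e : R) : 0 < e -> exists a,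
  [/\ \tr a = 1, ip a a <= 1,
      forall y, psdmx (herm y) -> 0 <= ip a y & forall x, K x -> 0 <= ip a x + e].
Proof.
move=> e0; have [x0 Kx0] := Kne.
pose S := [set ip (x + e%:M) (x + e%:M) | x in K].
have S0 : S !=set0 by exists (ip (x0 + e%:M) (x0 + e%:M)), x0.
have lbS : lbound S (e ^+ 2) by move=> _ [x Kx <-]; apply: shifted_far.
have iS : has_inf S by split => //; exists (e ^+ 2).
pose m := inf S.
have me : e ^+ 2 <= m by apply: lb_le_inf.
have m0 : 0 < m by apply: lt_le_trans me; rewrite exprn_gt0.
have /choice[x hx] : forall k : nat, exists x,
    K x /\ ip (x + e%:M) (x + e%:M) < m + k.+1%:R^-1.
  move=> k; have k0 : 0 < (k.+1%:R^-1 : R) by rewrite invr_gt0.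
  by have [_ [x Kx <-] h] := inf_adherent k0 iS; exists x.
have hN k : m <= ip (x k + e%:M) (x k + e%:M).
  by apply: ge_inf; [exists (e ^+ 2)|exists (x k) => //; case: (hx k)].
have [a ha] : exists a, rmcvg (fun k => x k + e%:M) a.
  apply: (@ultra_rmlim _ (m + 1)) => k; case: (hx k) => _ /ltW/le_trans; apply.
  by rewrite lerD2l invf_le1 // ler1n.
have hNm : ip (x k + e%:M) (x k + e%:M) @[k --> U] --> m.
  apply: (squeeze_cvgr (f := fun=> m) (h := fun k => m + k.+1%:R^-1)).
  - by apply: nearW => k; rewrite hN /= ltW //; case: (hx k).
  - exact: cvg_cst.
  - by rewrite -[X in _ --> X]addr0; apply: cvgD; [exact: cvg_cst|exact: ultra_harmonic].
have sep y : K y -> m <= ip a (y + e%:M).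
  move=> Ky; rewrite -subr_ge0.
  pose b := ip (y + e%:M) (y + e%:M).
  suff : 0 <= 2 * (ip a (y + e%:M) - m) by rewrite pmulr_rge0.
  apply: (@ge0_of_small_steps _ _ (m - 2 * ip a (y + e%:M) + b)) => t /andP[t0 t1].
  have ht : 0 <= t <= 1 by rewrite ltW.
  have h k : m <= (1 - t) ^+ 2 * ip (x k + e%:M) (x k + e%:M)
      + 2 * t * (1 - t) * ip (x k + e%:M) (y + e%:M) + t ^+ 2 * b.
    have Kz : K ((1 - t) *: x k + t *: y) by apply: convK => //; case: (hx k).
    have : m <= ip ((1 - t) *: x k + t *: y + e%:M) ((1 - t) *: x k + t *: y + e%:M).
      by apply: ge_inf; [exists (e ^+ 2)|exists ((1 - t) *: x k + t *: y)].
    have -> : (1 - t) *: x k + t *: y + e%:M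
        = (1 - t) *: (x k + e%:M) + t *: (y + e%:M).
      rewrite !scalerDr addrACA -scalerDl subrK scale1r //.
    rewrite /b; move: (x k + e%:M) (y + e%:M) => u w.
    rewrite !(ipDl, ipDr, ipZl, ipZr) [ip w u]ipC.
    by move/le_trans; apply; rewrite le_eqVlt; apply/orP; left; apply/eqP; ring.
  have hlim : ((1 - t) ^+ 2 * ip (x k + e%:M) (x k + e%:M)
      + 2 * t * (1 - t) * ip (x k + e%:M) (y + e%:M) + t ^+ 2 * b) @[k --> U]
     --> (1 - t) ^+ 2 * m + 2 * t * (1 - t) * ip a (y + e%:M) + t ^+ 2 * b.
    apply: cvgD; last exact: cvg_cst.
    apply: cvgD; apply: cvgM; [exact: cvg_cst|exact: hNm|exact: cvg_cst|].
    exact: ip_cvg.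
  have : m <= (1 - t) ^+ 2 * m + 2 * t * (1 - t) * ip a (y + e%:M) + t ^+ 2 * b.
    by apply: (cvgr_to_ge hlim); apply: nearW.
  rewrite -subr_ge0 => /le_trans; apply.
  by rewrite le_eqVlt; apply/orP; left; apply/eqP; ring.
have cone y : psdmx (herm y) -> 0 <= ip a y.
  move=> py; apply: (@ge0_of_large_steps _ _ (ip a (x0 + e%:M))) => t t0.
  have Kz : K (x0 + t *: y).
    apply: upK; [exact: Kx0|rewrite hermZ; apply: psd_scale; last exact: py].
    by rewrite ler0c.
  have -> : ip a (x0 + e%:M) + t * ip a y = ip a (x0 + t *: y + e%:M).
    by rewrite -ipZr -ipDr addrAC.
  exact: le_trans (ltW m0) (sep _ Kz).
pose s := Num.sqrt (ip a a).
have s0 : 0 < s.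
  rewrite sqrtr_gt0 lt_def ip_ge0 andbT; apply/eqP => h0.
  have a0 : a = 0.
    apply/matrixP => i j; rewrite mxE; apply/eqP; rewrite -sqrf_eq0 eq_le sqr_ge0 andbT.
    by rewrite -h0 entry_sqr_le_ip.
  have := sep _ Kx0; rewrite a0 leNgt => /negP; apply.
  rewrite /ip big1 // => i _; rewrite big1 // => j _; by rewrite mxE mul0r.
have ss : ip a a = s ^+ 2 by rewrite sqr_sqrtr // ip_ge0.
have tra : s <= \tr a.
  have : 0 <= ip a (s%:M + (- 1) *: a).
    apply/cone/psd_herm_near1 => //.
    by rewrite ipZl ipZr mulrA mulrNN !mulr1 mul1r ss.
  rewrite ipDr ipZr -scalemx1 ipZr ip1 ss mulN1r subr_ge0 expr2.
  by rewrite ler_pM2l.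
have t0 : 0 < \tr a by apply: lt_le_trans tra.
exists ((\tr a)^-1 *: a); split.
- by rewrite mxtraceZ mulVf // gt_eqF.
- rewrite ipZl ipZr mulrA -invfM mulrC ler_pdivrMr ?mulr_gt0 // mul1r ss expr2.
  by apply: ler_pM => //; apply: ltW.
- by move=> y /cone h; rewrite ipZl mulr_ge0 // invr_ge0 ltW.
- move=> x' Kx'; have := sep _ Kx'; rewrite ipDr -scalemx1 ipZr ip1 => h.
  rewrite ipZl -(ler_pM2l t0) mulr0 mulrDr mulrA mulfV ?gt_eqF // mul1r.
  by rewrite [\tr a * e]mulrC; apply: le_trans h; exact: ltW.
Qed.

(** The limit of the normals of [approx_separation] as [e] tends to zero; fixing
    their traces to [1] keeps the limit from vanishing, even when [0] is a limit
    point of [K]. *)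
Lemma separation_ultra : exists a,
  [/\ \tr a = 1, forall y, psdmx (herm y) -> 0 <= ip a y & forall x, K x -> 0 <= ip a x].
Proof.
have /choice[a ha] : forall k : nat, exists a,
  [/\ \tr a = 1, ip a a <= 1, forall y, psdmx (herm y) -> 0 <= ip a y &
      forall x, K x -> 0 <= ip a x + k.+1%:R^-1].
  by move=> k; apply: approx_separation; rewrite invr_gt0.
have [l hl] : exists l, rmcvg a l.
  by apply: (@ultra_rmlim _ 1) => k; case: (ha k).
exists l; split.
- have h2 : ip (a k) 1%:M @[k --> U] --> (1 : R).
    have -> : (fun k => ip (a k) 1%:M) = (fun=> 1).
      by apply/funext => k; rewrite ip1; have [-> _ _ _] := ha k.
    exact: cvg_cst.
  have h1 : ip (a k) 1%:M @[k --> U] --> ip l 1%:M by apply: ip_cvg.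
  by rewrite -ip1 (fcvg_unique h1 h2).
- move=> y hy; have h1 : ip (a k) y @[k --> U] --> ip l y by apply: ip_cvg.
  apply: (cvgr_to_ge h1); apply: nearW => k.
  by have [_ _ h _] := ha k; apply: h.
- move=> x Kx; have h1 : ip (a k) x + k.+1%:R^-1 @[k --> U] --> ip l x + 0.
    by apply: cvgD; [exact: ip_cvg|exact: ultra_harmonic].
  rewrite -[X in _ <= X]addr0; apply: (cvgr_to_ge h1); apply: nearW => k.
  by have [_ _ _ h] := ha k; apply: h.
Qed.

End Ultra.

Lemma separation : exists a,
  [/\ \tr a = 1, forall y, psdmx (herm y) -> 0 <= ip a y & forall x, K x -> 0 <= ip a x].
Proof. by have [U [UU ooU]] := ultra_on_nat; apply: (@separation_ultra U UU). Qed.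

End Convex.
End Separation.

(** * The Holevo bound as a linear program over the feasible set *)

Section GramNull.
Variables (C : numClosedFieldType) (d p : nat) (r : 'M[C]_d).
Hypothesis pr : psdmx r.

(** Write [H = K K^H]. Each column of [K] combines the [D j] into an observable
    with second moment zero, which the state annihilates. *)
Lemma gram_null (H : 'M[C]_p) (D X : 'I_p -> 'M[C]_d) : psdmx H ->
  (forall j, (D j) ^t* = D j) -> \tr (H *m gram r D D) = 0 -> H *m gram r D X = 0.
Proof.
move=> /psd_factor[K ->] hD h0.
suff h : K ^t* *m gram r D X = 0 by rewrite -mulmxA h mulmx0.
have h1 : K ^t* *m gram r D D *m K = 0.
  have := psd_conj (K ^t*) (gram_psd pr hD); rewrite trmxCK => /psd_tr_eq0; apply.
  by rewrite mxtrace_mulC mulmxA.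
apply/matrixP => k j; rewrite [RHS]mxE.
pose v := col k K; pose A := \sum_i (v i 0)^* *: D i.
have hA : r *m A = 0.
  apply: qform_eq0 => //; rewrite -gram_form //.
  move/matrixP/(_ k k): h1; rewrite [RHS]mxE => <-.
  rewrite mxE [RHS]mxE; apply: eq_bigr => i _; congr (_ * _); last by rewrite mxE.
  by rewrite mxE [RHS]mxE; apply: eq_bigr => l _; rewrite !mxE.
have -> : (K ^t* *m gram r D X) k j = \tr (r *m A *m X j).
  rewrite mxE /A mulmx_sumr mulmx_suml mxtrace_sum; apply: eq_bigr => i _.
  by rewrite -scalemxAr -scalemxAl mxtraceZ !mxE.
by rewrite hA mul0mx mxtrace0.
Qed.

Lemma tr_gram_line (H : 'M[C]_p) (X D : 'I_p -> 'M[C]_d) c :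
  let Y j := X j + c *: D j in
  \tr (H *m gram r Y Y) = \tr (H *m gram r X X) + c * \tr (H *m gram r D X)
    + c * \tr (H *m gram r X D) + c * (c * \tr (H *m gram r D D)).
Proof.
move=> Y; rewrite /Y !(gramDl, gramDr, gramZl, gramZr).
rewrite !(scalerDr, mulmxDr, mxtraceD) -!scalemxAr !mxtraceZ.
by ring.
Qed.

Lemma mul_gram_shift (H : 'M[C]_p) (X D : 'I_p -> 'M[C]_d) :
  (forall X', H *m gram r D X' = 0) ->
  let Y j := X j + 1 *: D j in
  H *m gram r Y Y - H *m gram r X X = H *m gram r X D.
Proof.
move=> h Y; rewrite /Y !(gramDl, gramDr, gramZl, gramZr) !scale1r !mulmxDr !h.
by rewrite !addr0 addrAC subrr add0r.
Qed.

Lemma tr_gram_conj (H : 'M[C]_p) (X D : 'I_p -> 'M[C]_d) : H ^t* = H ->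
  (forall j, (X j) ^t* = X j) -> (forall j, (D j) ^t* = D j) ->
  \tr (H *m gram r D X) = (\tr (H *m gram r X D))^*.
Proof.
by move=> hH hX hD; rewrite -tr_adj adjM hH (gram_adj pr hX hD) mxtrace_mulC.
Qed.

End GramNull.

Section Bounds.
Variables (R : realType) (d p : nat).
Local Notation C := (complex R).
Variables (r : 'M[C]_d) (dr : 'I_p -> 'M[C]_d).
Hypothesis pr : psdmx r.
Hypothesis kernel_dr : forall k (v : 'cV[C]_d), r *m v = 0 ->
  (v ^t* *m dr k *m v) 0 0 = 0.
Hypothesis feasible : exists Y, (forall j, (Y j) ^t* = Y j) /\ response dr Y = 1%:M.

Local Notation attain := (attainable r dr).
Implicit Types A B G K V I : 'M[R]_p.

(** The quantities of the theorem in terms of the state and its derivatives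
    alone; [holevoE] and its companions identify them. *)
Definition hol G : R := inf [set \tr (G *m V) | V in [set V | attain 1%:M V]].

Definition inV V := posdef_sym V /\ forall G, posdef_sym G -> hol G <= \tr (G *m V).
Definition inI I := posdef_sym I /\ forall G, posdef_sym G -> hol G <= \tr (G *m invmx I).
Definition dual K : R := inf [set c : R | forall I, inI I -> \tr (K *m I) <= c].

Lemma feas_exists : exists V, attain 1%:M V.
Proof. by have [Y [hY h1]] := feasible; rewrite -h1; apply: attainable_exists. Qed.

Lemma feas_posdef V : attain 1%:M V -> posdef_sym V.
Proof.
have [c c0 h] := attainable1_lower pr kernel_dr.
by move=> /h; apply: rpsd_posdef.
Qed.

Lemma hol_lbound G : posdef_sym G ->
  has_inf [set \tr (G *m V) | V in [set V | attain 1%:M V]].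
Proof.
move=> pG; split.
  by have [V hV] := feas_exists; exists (\tr (G *m V)), V.
exists 0 => _ [V hV <-]; apply: rpsd_trM_ge0; first exact: posdef_rpsd.
exact: posdef_rpsd (feas_posdef hV).
Qed.

Lemma hol_le G V : posdef_sym G -> attain 1%:M V -> hol G <= \tr (G *m V).
Proof. by move=> pG hV; apply: ge_inf; [case: (hol_lbound pG)|exists V]. Qed.

Lemma hol_ge G c : posdef_sym G -> (forall V, attain 1%:M V -> c <= \tr (G *m V)) ->
  c <= hol G.
Proof.
move=> pG h; apply: lb_le_inf; first by case: (hol_lbound pG).
by move=> _ [V hV <-]; apply: h.
Qed.

Lemma feas_inV V : attain 1%:M V -> inV V.
Proof. by move=> hV; split; [exact: feas_posdef|move=> G pG; apply: hol_le]. Qed.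

Lemma one_entry_le i j : `|(1%:M : 'M[R]_p) i j| <= 1.
Proof. by rewrite mxE; case: (i == j); rewrite ?normr1 ?normr0. Qed.

Lemma tr_cvg (U : set_system nat) {UU : UltraFilter U} G (V : nat -> 'M[R]_p) V' :
  (forall i j, V n i j @[n --> U] --> V' i j) ->
  \tr (G *m V n) @[n --> U] --> \tr (G *m V').
Proof.
move=> h; rewrite mxtrace_mulC; under eq_fun do rewrite mxtrace_mulC.
have e W : \tr (W *m G) = ip W G^T by rewrite ip_trM trmxK.
by rewrite e; under eq_fun do rewrite e; apply: ip_cvg.
Qed.

Lemma feas_closed (V : nat -> 'M[R]_p) (M : R) :
  (forall n, attain 1%:M (V n)) -> (forall n i j, `|V n i j| <= M) ->
  exists U : set_system nat, exists V', [/\ UltraFilter U, ((\oo : set_system nat) `<=` U)%classic,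
    attain 1%:M V' & forall i j, V n i j @[n --> U] --> V' i j].
Proof.
move=> hV hM; have [U [UU ooU]] := ultra_on_nat; exists U.
have h1 (n : nat) i j : `|(1%:M : 'M[R]_p) i j| <= Num.max 1 M.
  by rewrite le_max one_entry_le.
have h2 n i j : `|V n i j| <= Num.max 1 M by rewrite le_max hM orbT.
have [D' [V' [hA hD hV']]] := attainable_limit pr kernel_dr hV h1 h2.
exists V'; split; [exact: UU|exact: ooU| |exact: hV'].
have -> // : 1%:M = D'; apply/matrixP => i j.
by apply: fcvg_unique (hD i j); apply: cvg_cst.
Qed.

(** A positive definite [G] bounds the entries of a minimizing sequence, so that
    [feas_closed] applies. *)
Lemma hol_attained G : posdef_sym G -> exists2 V, attain 1%:M V & \tr (G *m V) = hol G.
Proof.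
move=> pG; have iS := hol_lbound pG.
have /choice[V hV] : forall n : nat, exists V,
    attain 1%:M V /\ \tr (G *m V) < hol G + n.+1%:R^-1.
  move=> n; have n0 : 0 < (n.+1%:R^-1 : R) by rewrite invr_gt0.
  by have [_ [V hV <-] h] := inf_adherent n0 iS; exists V.
have [g g0 hg] := posdef_lower pG.
have hM n i j : `|V n i j| <= (hol G + 1) / g.
  have [hA /ltW h] := hV n; have pV := posdef_rpsd (feas_posdef hA).
  apply: le_trans (rpsd_entry_le_tr i j pV) _; rewrite ler_pdivlMr //.
  have := rpsd_trM_ge0 hg pV.
  rewrite mulmxBl mxtraceB mul_scalar_mx mxtraceZ subr_ge0 mulrC => /le_trans; apply.
  by apply: le_trans h _; rewrite lerD2l invf_le1 // ler1n.
have [U [V' [UU ooU hA hlim]]] := feas_closed (fun n => proj1 (hV n)) hM.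
exists V' => //.
have h1 := @tr_cvg U UU G V V' hlim.
have h2 : \tr (G *m V n) @[n --> U] --> hol G.
  apply: (squeeze_cvgr (f := fun=> hol G) (h := fun n => hol G + n.+1%:R^-1)).
  - by apply: nearW => n; have [/(hol_le pG) -> /ltW] := hV n.
  - exact: cvg_cst.
  - rewrite -[X in _ --> X]addr0; apply: cvgD; first exact: cvg_cst.
    exact: ultra_harmonic.
exact: fcvg_unique h1 h2.
Qed.

Lemma feas_closed_shift V : (forall e : R, 0 < e -> attain 1%:M (V + e%:M)) -> attain 1%:M V.
Proof.
move=> h.
pose W (n : nat) := V + (n.+1%:R^-1 : R)%:M.
have hW n : attain 1%:M (W n) by apply: h; rewrite invr_gt0.
have hM n i j : `|W n i j| <= (\sum_i \sum_j `|V i j|) + 1.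
  rewrite mxE; apply: le_trans (ler_normD _ _) _; apply: lerD.
    rewrite (bigD1 i) //= (bigD1 j) //= -addrA lerDl addr_ge0 //; last first.
      by do 2! (apply: sumr_ge0 => ? _).
    by apply: sumr_ge0 => ? _.
  rewrite mxE; case: (i == j); rewrite ?mulr0n ?normr0 // mulr1n.
  by rewrite ger0_norm ?invr_ge0 // invf_le1 // ler1n.
have [U [V' [UU ooU hA hlim]]] := feas_closed hW hM.
have -> // : V = V'; apply/matrixP => i j.
apply: fcvg_unique (hlim i j).
rewrite -[X in _ --> X]addr0 -(mul0rn _ (i == j)) /W.
under eq_fun do rewrite !mxE.
apply: cvgD; first exact: cvg_cst.
case: (i == j); last by under eq_fun do rewrite mulr0n; rewrite mulr0n; apply: cvg_cst.
by under eq_fun do rewrite mulr1n; rewrite mulr1n; apply: ultra_harmonic.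
Qed.

Lemma sym_psd_herm (B : 'M[R]_p) : psdmx (herm B) -> rpsd (2^-1 *: (B + B^T)).
Proof.
move=> pB; split; first by rewrite linearZ linearD /= trmxK addrC.
move=> u; case: pB => _ /(_ (cmx u)) /cplx_le /=.
suff -> : complex.Re (((cmx u) ^t* *m herm B *m cmx u) 0 0)
   = (u^T *m (2^-1 *: (B + B^T)) *m u) 0 0 by [].
rewrite cmx_adj mxE [RHS]mxE Re_sum; apply: eq_bigr => j _.
rewrite [cmx u j 0]mxE mulrC ReZr mulrC; congr (_ * _).
rewrite mxE [RHS]mxE Re_sum; apply: eq_bigr => i _.
by rewrite [cmx _ _ _]mxE ReZr; congr (_ * _); rewrite !mxE /= mulrC.
Qed.

Lemma rpsd_herm (B : 'M[R]_p) : rpsd B -> psdmx (herm B).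
Proof. by move=> hB; rewrite herm_sym; [exact: rpsd_cmx|case: hB]. Qed.

Definition sympart (T : 'M[R]_p) : 'M[R]_p := 2^-1 *: (T + T^T).

Lemma sympartD A B : sympart (A + B) = sympart A + sympart B.
Proof. by apply/matrixP => i j; rewrite /sympart !mxE; ring. Qed.

Lemma sympartN A : sympart (- A) = - sympart A.
Proof. by apply/matrixP => i j; rewrite /sympart !mxE; ring. Qed.

Lemma sympartZ c A : sympart (c *: A) = c *: sympart A.
Proof. by apply/matrixP => i j; rewrite /sympart !mxE; ring. Qed.

Lemma sympart_id A : A^T = A -> sympart A = A.
Proof. by rewrite /sympart => ->; apply/matrixP => i j; rewrite !mxE; field. Qed.

(** Separate from [0] the set of the [T] whose symmetric part makes [V + e + T]
    feasible. This set is invariant under skew translations, so that the normal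
    is symmetric. *)
Lemma infeasible_separation V (e : R) : V^T = V -> ~ attain 1%:M (V + e%:M) ->
  exists a, [/\ rpsd a, \tr a = 1 &
    forall W, attain 1%:M W -> \tr (a *m V) + e <= \tr (a *m W)].
Proof.
move=> hVs hN.
have [V0 hV0] := feas_exists.
pose K := [set T : 'M[R]_p | attain 1%:M (sympart T + V + e%:M)].
have e1 W : sympart (W - V - e%:M) + V + e%:M = sympart W.
  rewrite !sympartD !sympartN (sympart_id hVs) (sympart_id (tr_scalar_mx _ e)).
  by rewrite [_ - e%:M + V]addrAC !subrK.
have [|||| a [tra cone sep]] := @separation _ _ K.
- move=> x y t t01 hx hy; rewrite /K /=.
  have -> : sympart ((1 - t) *: x + t *: y) + V + e%:M
     = (1 - t) *: (sympart x + V + e%:M) + t *: (sympart y + V + e%:M).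
    rewrite sympartD !sympartZ; move: (sympart x) (sympart y) => a b.
    by apply/matrixP => i j; rewrite !mxE; ring.
  have := attainable_convex pr t01 hx hy.
  by rewrite -scalerDl subrK scale1r; apply.
- move=> x y hx hy; rewrite /K /= sympartD.
  have -> : sympart x + sympart y + V + e%:M = (sympart x + V + e%:M) + sympart y.
    by rewrite [sympart x + _ + V]addrAC [LHS]addrAC.
  by apply: attainable_up hx _; apply: sym_psd_herm.
- by rewrite /K /= (sympart_id (trmx0 _ _ _)) add0r; exact: hN.
- by exists (V0 - V - e%:M); rewrite /K /= e1 (sympart_id (attainable_sym pr hV0)); exact: hV0.
have a_sym : a^T = a.
  have h0 T : K T -> forall i j, a i j = a j i.
    move=> hT i j.
    pose D : 'M[R]_p := delta_mx i j - delta_mx j i.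
    have smD0 : sympart D = 0.
      by rewrite /D sympartD sympartN /sympart !trmx_delta [X in _ - _ *: X]addrC subrr.
    have hs s : 0 <= ip a T + s * ip a D.
      rewrite -ipZr -ipDr; apply: sep; rewrite /K /= sympartD sympartZ smD0 scaler0 addr0; exact: hT.
    have g1 : 0 <= ip a D by apply: (@ge0_of_large_steps _ _ (ip a T)) => t _.
    have g2 : 0 <= - ip a D.
      by apply: (@ge0_of_large_steps _ _ (ip a T)) => t _; rewrite mulrN -mulNr.
    have : ip a D = 0 by apply/eqP; rewrite eq_le g1 andbT -oppr_ge0.
    rewrite /D ipDr -scaleN1r ipZr mulN1r.
    by rewrite !ip_delta => /eqP; rewrite subr_eq0 => /eqP.
  have hK0 : K (V0 - V - e%:M) by rewrite /K /= e1 (sympart_id (attainable_sym pr hV0)); exact: hV0.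
  by apply/matrixP => i j; rewrite mxE (h0 _ hK0).
have ipa W : ip a W = \tr (a *m W^T) by apply: ip_trM.
have a_psd : rpsd a.
  split=> [|u]; first exact: a_sym.
  have /cone : psdmx (herm (u *m u^T)).
    apply: rpsd_herm; have := rpsd_conj u (@rpsd_scalar R 1 1 ler01).
    by rewrite mulmx1.
  by rewrite ipa trmx_mul trmxK mulmxA mxtrace_mulC mulmxA trace_mx11.
have hsep W : attain 1%:M W -> \tr (a *m V) + e <= \tr (a *m W).
  move=> hW; have hWs := attainable_sym pr hW.
  have /sep : K (W - V - e%:M) by rewrite /K /= e1 (sympart_id hWs); exact: hW.
  rewrite !ipDr !ipNr -scalemx1 ipZr ip1 tra mulr1 !ipa hWs hVs.
  by rewrite -addrA -opprD subr_ge0.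
by exists a; split; [exact: a_psd|exact: tra|exact: hsep].
Qed.

(** The linear bounds describe the feasible set exactly. If [V + e] were not
    feasible, the normal of a hyperplane that separates it from the feasible
    set, made positive definite by a small multiple of the identity, would
    violate the bound at [V]. *)
Lemma inV_feas V : inV V -> attain 1%:M V.
Proof.
case=> pV hV; apply: feas_closed_shift => e e0.
have hVs : V^T = V by case: pV.
apply: contrapT => /(infeasible_separation hVs)[a [a_psd _ hsep]].
(* small enough for [dl * \tr V + dl] to be [e / 2] *)
pose dl := e / (\tr V + 1) / 2.
have tV : 0 <= \tr V by apply/rpsd_tr_ge0/posdef_rpsd.
have tV1 : 0 < \tr V + 1 by rewrite ltr_wpDl.
have dl0 : 0 < dl by rewrite !divr_gt0.
have pa : posdef_sym (a + dl%:M).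
  by rewrite addrC; apply: posdefD a_psd; apply: posdef_scalar.
have := hV _ pa; apply/negP; rewrite -ltNge.
apply: (@lt_le_trans _ _ (\tr (a *m V) + e)).
  rewrite mulmxDl mxtraceD mul_scalar_mx mxtraceZ ltrD2l.
  have h : dl * \tr V + dl = e / 2.
    by rewrite /dl; field; rewrite gt_eqF.
  by move: dl0 e0 h; move: (dl * \tr V) => x; lra.
apply: (hol_ge pa) => W hW; apply: le_trans (hsep W hW) _.
rewrite mulmxDl mxtraceD mul_scalar_mx mxtraceZ lerDl; apply: mulr_ge0; first exact: ltW.
exact/rpsd_tr_ge0/posdef_rpsd/feas_posdef.
Qed.
End Bounds.

(** * Uniqueness of the minimizer *)

Section Uniqueness.
Variables (R : realType) (d p : nat).
Local Notation C := (complex R).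
Variables (r : 'M[C]_d) (dr : 'I_p -> 'M[C]_d).
Hypothesis pr : psdmx r.
Hypothesis kernel_dr : forall k (v : 'cV[C]_d), r *m v = 0 ->
  (v ^t* *m dr k *m v) 0 0 = 0.
Hypothesis feasible : exists Y, (forall j, (Y j) ^t* = Y j) /\ response dr Y = 1%:M.

Local Notation attain := (attainable r dr).
Local Notation hol := (hol r dr).
Implicit Types G K V I W : 'M[R]_p.

Lemma Re_quadratic (a b e f : C) (t : R) (c := real_complex R t) :
  complex.Re (a + c * b + c * e + c * (c * f))
  = complex.Re a + t * complex.Re b + t * complex.Re e + t * (t * complex.Re f).
Proof. by rewrite !ReD !ReZr. Qed.

Lemma quadratic_increment (h s q t : R) :
  h <= h + t * s + t * s + t * (t * q) -> 0 <= t * (2 * s) + t ^+ 2 * q.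
Proof. by move=> h0; rewrite expr2; lra. Qed.

Lemma quadratic_rest (h a b s s' q : R) : a = h -> b = h -> s' = s -> 0 <= s ->
  a = b + 1 * s' + 1 * s + 1 * (1 * q) -> q <= 0.
Proof. by move=> -> -> ->; lra. Qed.

Lemma Re_form_herm (H : 'M[C]_p) (v : 'cV[C]_p) : H ^t* = H ->
  complex.Im ((v ^t* *m H *m v) 0 0) = 0.
Proof.
move=> hH; set z := (_ *m v) 0 0.
have e : z^* = z.
  have := tr_adj (v ^t* *m H *m v).
  by rewrite !adjM trmxCK hH mulmxA trace_mx11 -/z => <-.
have := ImJ z; rewrite e => h; have : complex.Im z + complex.Im z = 0.
  by rewrite {1}h addNr.
by move=> h2; lra.
Qed.

Lemma herm_cone_psd (a : 'M[R]_p) :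
  (forall y, psdmx (herm y) -> 0 <= ip a y) -> psdmx (herm a).
Proof.
move=> cone; split; first by apply/hermP/herm_adj.
move=> v; rewrite cplx_ge0 Re_form_herm ?herm_adj // eqxx /=.
have [B hB] := herm_surj (psd_herm (psd_MMadj v)).
have := cone B; rewrite hB => /(_ (psd_MMadj v)).
rewrite -ip_herm hB mulmxA mxtrace_mulC mulmxA trace_mx11.
by [].
Qed.

(** A hyperplane that separates from [0] the set of the [T] such that [Z(X) <= T
    + V] for some locally unbiased [X] and some symmetric [V] with cost less
    than the infimum. *)
Lemma multiplier_hyperplane G : posdef_sym G -> (0 < p)%N -> exists a : 'M[R]_p,
  [/\ \tr a = 1, forall y, psdmx (herm y) -> 0 <= ip a y &
   forall T V X, V^T = V -> \tr (G *m V) < hol G ->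
     (forall j, (X j) ^t* = X j) -> response dr X = 1%:M ->
     psdmx (herm T + cmx V - gram r X X) -> 0 <= ip a T].
Proof.
move=> pG p0.
pose K := [set T : 'M[R]_p | exists V X, [/\ V^T = V /\ \tr (G *m V) < hol G,
   forall j, (X j) ^t* = X j, response dr X = 1%:M &
   psdmx (herm T + cmx V - gram r X X)]].
have [|||| a [tra cone sep]] := @separation _ _ K.
- move=> x y t /andP[t0 t1] [V1 [X1 [[s1 l1] h1 u1 q1]]] [V2 [X2 [[s2 l2] h2 u2 q2]]].
  have t0' : 0 <= real_complex R t by rewrite ler0c.
  have t1' : 0 <= real_complex R (1 - t) by rewrite ler0c subr_ge0.
  have ht : real_complex R (1 - t) + real_complex R t = 1.
    by rewrite -rmorphD subrK rmorph1.
  exists ((1 - t) *: V1 + t *: V2).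
  exists (fun j => real_complex R (1 - t) *: X1 j + real_complex R t *: X2 j); split.
  + split; first by rewrite linearD !linearZ /= s1 s2.
    rewrite mulmxDr mxtraceD -!scalemxAr !mxtraceZ.
    have [->|tn0] := eqVneq t 0; first by rewrite subr0 mul0r mul1r addr0.
    have tp : 0 < t by rewrite lt_def tn0.
    have hl : t * \tr (G *m V2) < t * hol G by rewrite ltr_pM2l.
    have hl' : (1 - t) * \tr (G *m V1) <= (1 - t) * hol G.
      by apply: ler_wpM2l; [rewrite subr_ge0|exact: ltW].
    by have := ler_ltD hl' hl; rewrite -mulrDl subrK mul1r.
  + by move=> j; rewrite adjD !adjZ !conj_real h1 h2.
  + apply/matrixP => i j; rewrite mxE mulmxDr -!scalemxAr mxtraceD !mxtraceZ ReD !ReZr.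
    move/matrixP/(_ i j): u1; move/matrixP/(_ i j): u2; rewrite [LHS]mxE => ->.
    by rewrite [LHS]mxE => ->; rewrite -mulrDl subrK mul1r.
  + have -> : herm ((1 - t) *: x + t *: y) + cmx ((1 - t) *: V1 + t *: V2)
      = real_complex R (1 - t) *: (herm x + cmx V1) + real_complex R t *: (herm y + cmx V2).
      rewrite hermD (hermZ _ x) (hermZ _ y) cmxD (cmxZ _ V1) (cmxZ _ V2).
      by rewrite (scalerDr _ (herm x)) (scalerDr _ (herm y)) addrACA.
    exact: (gram_convex_psd pr t1' t0' ht h1 h2 q1 q2).
- move=> x y [V [X [hV h u q]]] py; exists V, X; split; [exact: hV|exact: h|exact: u|].
  have -> : herm (x + y) + cmx V - gram r X X = (herm x + cmx V - gram r X X) + herm y.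
    by rewrite hermD [herm x + _ + cmx V]addrAC [LHS]addrAC.
  exact: psd_add q py.
- case=> V [X [[hV hl] h u q]].
  have : attain 1%:M V.
    exists X; split; [exact: h|exact: u|].
    by move: q; rewrite (herm_sym (trmx0 _ _ _)) /cmx map_mx0 add0r; apply.
  by move=> /(hol_le pr kernel_dr feasible pG); rewrite leNgt hl.
- have [V0 hV0] := feas_exists pr feasible; case: (hV0) => X [h u q0].
  have tG := posdef_tr_gt0 pG p0.
  pose c := (\tr (G *m V0) - hol G + 1) / \tr G.
  exists c%:M, (V0 - c%:M), X; split; [split|exact: h|exact: u|].
  + by rewrite linearB /= tr_scalar_mx (attainable_sym pr hV0).
  + rewrite mulmxBr mxtraceB mul_mx_scalar mxtraceZ /c divfK ?gt_eqF //.
    by lra.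
  + by rewrite (herm_sym (tr_scalar_mx _ _)) cmxB addrCA subrr addr0; exact: q0.
exists a; split; [exact: tra|exact: cone|].
move=> T V X hV hl h u q; apply: sep.
by exists V, X; split; [split; [exact: hV|exact: hl]|exact: h|exact: u|exact: q].
Qed.

(** A Lagrange multiplier for the constraint [Z(X) <= V]. Since [V] ranges over
    all real symmetric matrices, the real part of the multiplier is [G]; its
    imaginary part accounts for the imaginary part of [Z(X)]. What remains is a
    quadratic minimization over the [X] alone. *)
Lemma multiplier G : posdef_sym G -> (0 < p)%N -> exists H : 'M[C]_p,
  [/\ psdmx H, Remx H = G &
   forall X, (forall j, (X j) ^t* = X j) -> response dr X = 1%:M ->
     hol G <= complex.Re (\tr (H *m gram r X X))].
Proof.
move=> pG p0; have [a [tra cone sep]] := multiplier_hyperplane pG p0.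
have tG := posdef_tr_gt0 pG p0.
have hGs : G^T = G by case: pG.
have [V0 hV0] := feas_exists pr feasible; case: (hV0) => X0 [h0 u0 q0].
have [T0 hT0] := herm_surj (gram_adj pr h0 h0).
(* a scalar matrix whose cost is less than the infimum *)
pose c0 := (hol G - 1) / \tr G.
have hc0 : \tr (G *m c0%:M) < hol G.
  by rewrite mul_mx_scalar mxtraceZ /c0 divfK ?gt_eqF //; lra.
(* the normal is orthogonal to the symmetric matrices that are orthogonal to [G] *)
have orth W : W^T = W -> \tr (G *m W) = 0 -> 0 <= ip a W.
  move=> hW hGW; apply: (@ge0_of_large_steps _ _ (ip a (T0 - c0%:M))) => t _.
  rewrite -ipZr -ipDr.
  apply: (sep _ (c0%:M - t *: W) X0); [| |exact: h0|exact: u0|].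
  - by rewrite linearB linearZ /= tr_scalar_mx hW.
  - by rewrite mulmxBr mxtraceB -scalemxAr mxtraceZ hGW mulr0 subr0.
  - rewrite !hermD hT0 hermZ (herm_sym hW) !cmxB cmxZ.
    have -> : herm (- c0%:M : 'M[R]_p) = - cmx c0%:M.
      by rewrite -scaleN1r hermZ (herm_sym (tr_scalar_mx _ _)) rmorphN1 scaleN1r.
    rewrite [X in X - _]addrACA subrK subrr addr0 subrr; exact: psd0.
have ipW W : W^T = W -> \tr G * ip a W = \tr (G *m W).
  move=> hW; pose s := \tr (G *m W) / \tr G; pose W' := W - s%:M.
  have hW' : W'^T = W' by rewrite /W' linearB /= tr_scalar_mx hW.
  have hGW' : \tr (G *m W') = 0.
    by rewrite /W' mulmxBr mxtraceB mul_mx_scalar mxtraceZ /s divfK ?subrr // gt_eqF.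
  have g1 := orth _ hW' hGW'.
  have g2 : 0 <= ip a (- W').
    by apply: orth; [rewrite linearN /= hW'|rewrite mulmxN mxtraceN hGW' oppr0].
  have : ip a W' = 0 by apply/eqP; rewrite eq_le g1 andbT -oppr_ge0 -ipNr.
  rewrite /W' ipDr ipNr -scalemx1 ipZr ip1 tra mulr1 => /eqP; rewrite subr_eq0 => /eqP ->.
  by rewrite /s mulrC divfK // gt_eqF.
exists (herm (\tr G *: a)); split.
- apply: herm_cone_psd => y /cone h; rewrite ipZl mulr_ge0 //; exact: ltW.
- apply/matrixP => i j; rewrite !mxE /=.
  have := ipW (delta_mx i j + delta_mx j i).
  rewrite linearD /= !trmx_delta addrC => /(_ erefl).
  rewrite ipDr !ip_delta mulmxDr mxtraceD -!ip_delta.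
  have trd k l : \tr (G *m delta_mx k l) = G l k.
    by rewrite -trmx_delta -ip_trM ip_delta.
  rewrite !trd !ip_delta.
  have -> : G j i = G i j by move/matrixP/(_ i j): hGs; rewrite mxE.
  by move=> h; rewrite -mulrDr h; field.
- move=> X h u.
  have [T hT] := herm_surj (gram_adj pr h h).
  rewrite -hT ip_herm ipZl.
  apply/ler_addgt0Pr => e e0; rewrite -lerBlDr.
  pose V : 'M[R]_p := ((hol G - e) / \tr G)%:M.
  have hV : V^T = V by rewrite tr_scalar_mx.
  have trV : \tr (G *m V) = hol G - e.
    by rewrite mul_mx_scalar mxtraceZ divfK // gt_eqF.
  have : 0 <= ip a (T - V).
    apply: (sep _ V X hV _ h u); first by rewrite trV; lra.
    have -> : herm (T - V) = gram r X X - cmx V.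
      by rewrite hermD hT -scaleN1r hermZ (herm_sym hV) rmorphN1 scaleN1r.
    by rewrite subrK subrr; exact: psd0.
  rewrite ipDr ipNr subr_ge0 => hle.
  by rewrite -trV -(ipW _ hV) ler_pM2l.
Qed.

Lemma Re_tr_cmx (H : 'M[C]_p) V : complex.Re (\tr (H *m cmx V)) = \tr (Remx H *m V).
Proof.
rewrite /mxtrace Re_sum; apply: eq_bigr => i _; rewrite !mxE Re_sum.
by apply: eq_bigr => j _; rewrite !mxE mulrC ReZr mulrC.
Qed.

Lemma Remx_mul_cmx (H : 'M[C]_p) V : Remx (H *m cmx V) = Remx H *m V.
Proof.
apply/matrixP => i j; rewrite !mxE Re_sum.
by apply: eq_bigr => k _; rewrite !mxE mulrC ReZr mulrC.
Qed.

(** The two positive matrices [H] and [V - Z(X)] have a product with nonnegative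
    trace, while the optimality of [V] makes this trace at most zero. *)
Lemma slackness G (H : 'M[C]_p) V X : psdmx H -> Remx H = G ->
  (hol G <= complex.Re (\tr (H *m gram r X X))) -> \tr (G *m V) = hol G ->
  psdmx (cmx V - gram r X X) ->
  H *m cmx V = H *m gram r X X /\ complex.Re (\tr (H *m gram r X X)) = hol G.
Proof.
move=> pH hG hX hV q.
have t0 := psd_trM_ge0 pH q.
have eR : complex.Re (\tr (H *m (cmx V - gram r X X)))
    = hol G - complex.Re (\tr (H *m gram r X X)).
  by rewrite mulmxBr mxtraceB ReD ReN Re_tr_cmx hG hV.
move: (t0); rewrite cplx_ge0 eR subr_ge0 => /andP[/eqP eI hle].
have e : complex.Re (\tr (H *m gram r X X)) = hol G by apply/eqP; rewrite eq_le hle hX.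
split; last exact: e.
have /(psd_trM_eq0 pH q) : \tr (H *m (cmx V - gram r X X)) = 0.
  by apply: complex_eq; [rewrite eR e subrr|exact: eI].
by rewrite mulmxBr => /eqP; rewrite subr_eq0 => /eqP.
Qed.

(** Let [X1] and [X2] realize the two minimizers and [D = X2 - X1]. The
    quadratic function [tr (H Z(X))] is minimal at both, so that [tr (H Z(D))]
    is zero and, by slackness, [H (V2 - V1) = H Z(X1, D)]. All combinations [D
    A] are admissible variations with zero first-order change, which says that
    the real part of [H Z(X1, D)] is zero. That real part is [G (V2 - V1)]. *)
Lemma feas_minimizer_unique G V1 V2 : posdef_sym G ->
  attain 1%:M V1 -> attain 1%:M V2 ->
  \tr (G *m V1) = hol G -> \tr (G *m V2) = hol G -> V1 = V2.
Proof.
move=> pG [X1 [h1 u1 q1]] [X2 [h2 u2 q2]] e1 e2.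
case: (posnP p) => [p0|p0].
  by apply/matrixP => i; move: (ltn_ord i); rewrite {2}p0.
have [H [pH hG hbound]] := multiplier pG p0.
have [s1 Q1] := slackness pH hG (hbound _ h1 u1) e1 q1.
have [s2 Q2] := slackness pH hG (hbound _ h2 u2) e2 q2.
have hH := psd_herm pH.
pose D j := X2 j + (- 1) *: X1 j.
have hD j : (D j) ^t* = D j by rewrite /D adjD adjZ h1 h2 rmorphN rmorph1.
have uD : response dr D = 0.
  apply/matrixP => i j; rewrite !mxE mulmxDr -scalemxAr mxtraceD mxtraceZ mulN1r ReD ReN.
  move/matrixP/(_ i j): u1; move/matrixP/(_ i j): u2; rewrite [LHS]mxE => ->.
  by rewrite [LHS]mxE => ->; rewrite subrr.
(* stationarity of the quadratic form at [X1] *)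
have stat D' : (forall j, (D' j) ^t* = D' j) -> response dr D' = 0 ->
    0 <= complex.Re (\tr (H *m gram r X1 D')).
  move=> hD' uD'.
  have eC : complex.Re (\tr (H *m gram r D' X1)) = complex.Re (\tr (H *m gram r X1 D')).
    by rewrite (tr_gram_conj pr hH h1 hD') ReJ.
  suff : 0 <= 2 * complex.Re (\tr (H *m gram r X1 D')) by rewrite pmulr_rge0.
  apply: (@ge0_of_small_steps _ _ (complex.Re (\tr (H *m gram r D' D')))) => t _.
  pose X j := X1 j + real_complex R t *: D' j.
  have hX j : (X j) ^t* = X j by rewrite /X adjD adjZ conj_real h1 hD'.
  have uX : response dr X = 1%:M.
    apply/matrixP => i j; rewrite mxE mulmxDr -scalemxAr mxtraceD mxtraceZ ReD ReZr.
    move/matrixP/(_ i j): u1; move/matrixP/(_ i j): uD'; rewrite [LHS]mxE => ->.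
    by rewrite [LHS]mxE => ->; rewrite [X in _ * X]mxE mulr0 addr0.
  have := hbound _ hX uX.
  have -> : complex.Re (\tr (H *m gram r X X)) = hol G
      + t * complex.Re (\tr (H *m gram r X1 D')) + t * complex.Re (\tr (H *m gram r X1 D'))
      + t * (t * complex.Re (\tr (H *m gram r D' D'))).
    by rewrite -Q1 -{1}eC -Re_quadratic; congr complex.Re; apply: tr_gram_line.
  exact: quadratic_increment.
have QD : complex.Re (\tr (H *m gram r D D)) <= 0.
  have eX2 : X2 = fun j => X1 j + 1 *: D j.
    by apply/funext => j; rewrite scale1r /D scaleN1r addrC subrK.
  have e : complex.Re (\tr (H *m gram r X2 X2)) = complex.Re (\tr (H *m gram r X1 X1))
      + 1 * complex.Re (\tr (H *m gram r D X1)) + 1 * complex.Re (\tr (H *m gram r X1 D))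
      + 1 * (1 * complex.Re (\tr (H *m gram r D D))).
    by rewrite -Re_quadratic {1 2}eX2; congr complex.Re; apply: tr_gram_line.
  have eC : complex.Re (\tr (H *m gram r D X1)) = complex.Re (\tr (H *m gram r X1 D)).
    by rewrite (tr_gram_conj pr hH h1 hD) ReJ.
  exact: (quadratic_rest Q2 Q1 eC (stat D hD uD) e).
have HD : \tr (H *m gram r D D) = 0.
  have := psd_trM_ge0 pH (gram_psd pr hD); rewrite cplx_ge0 => /andP[/eqP eI eR].
  by apply: complex_eq => //; apply/eqP; rewrite eq_le QD eR.
have HDX X : H *m gram r D X = 0 by apply: gram_null.
have HW : H *m cmx (V2 - V1) = H *m gram r X1 D.
  have eX2 : X2 = fun j => X1 j + 1 *: D j.
    by apply/funext => j; rewrite scale1r /D scaleN1r addrC subrK.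
  rewrite cmxB mulmxBr s1 s2 {1 2}eX2; exact: mul_gram_shift.
(* the variations are the combinations of [D] by multiples of elementary matrices *)
have ReY (i j : 'I_p) s : 0 <= s * Remx (H *m gram r X1 D) i j.
  pose A : 'M[R]_p := s *: delta_mx j i.
  pose D' k := \sum_l cmx A l k *: D l.
  have hD' k : (D' k) ^t* = D' k.
    rewrite /D' adj_sum; apply: eq_bigr => l _.
    by rewrite adjZ hD mxE conj_real.
  have uD' : response dr D' = 0.
    apply/matrixP => k l; rewrite !mxE mulmx_sumr mxtrace_sum Re_sum big1 // => m _.
    rewrite -scalemxAr mxtraceZ mxE ReZr.
    by move/matrixP/(_ k m): uD; rewrite !mxE => ->; rewrite mulr0.
  have := stat D' hD' uD'; rewrite /D' gram_mulr mulmxA Re_tr_cmx.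
  rewrite /A -scalemxAr mxtraceZ.
  by rewrite -[delta_mx j i]trmx_delta -ip_trM ip_delta.
have R0 : Remx (H *m gram r X1 D) = 0.
  apply/matrixP => i j; rewrite [RHS]mxE.
  have := ReY i j 1; have := ReY i j (- 1); rewrite mul1r mulN1r oppr_ge0 => a b.
  by apply/eqP; rewrite eq_le a b.
have : G *m (V2 - V1) = 0 by rewrite -hG -Remx_mul_cmx HW R0.
move=> /(congr1 (mulmx (invmx G))); rewrite mulmx0 mulKmx ?posdef_unit //.
by move=> /eqP; rewrite subr_eq0 => /eqP.
Qed.

End Uniqueness.

(** * Duality between covariance and information *)

Section Duality.
Variables (R : realType) (d p : nat).
Local Notation C := (complex R).
Variables (r : 'M[C]_d) (dr : 'I_p -> 'M[C]_d).
Hypothesis pr : psdmx r.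
Hypothesis kernel_dr : forall k (v : 'cV[C]_d), r *m v = 0 ->
  (v ^t* *m dr k *m v) 0 0 = 0.
Hypothesis feasible : exists Y, (forall j, (Y j) ^t* = Y j) /\ response dr Y = 1%:M.

Local Notation attain := (attainable r dr).
Local Notation hol := (hol r dr).
Local Notation inV := (inV r dr).
Local Notation inI := (inI r dr).
Local Notation dual := (dual r dr).
Implicit Types G K V I J W : 'M[R]_p.

Lemma inI_feas I : inI I -> attain 1%:M (invmx I).
Proof.
case=> pI h; apply: (inV_feas pr kernel_dr feasible).
by split; [exact: posdef_inv|exact: h].
Qed.

Lemma feas_inI V : attain 1%:M V -> inI (invmx V).
Proof.
move=> hV; have pV := feas_posdef pr kernel_dr hV.
split; first exact: posdef_inv.
by move=> G pG; rewrite invmxK; apply: hol_le.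
Qed.

(** The congruence by [I] turns [(1, I^-1)] into [(I, I)]. *)
Lemma inI_attain I : inI I -> attain I I.
Proof.
move=> hI; have pI : posdef_sym I by case: hI.
have uI := posdef_unit pI; have sI : I^T = I by case: pI.
have := attainable_mul I (inI_feas hI).
by rewrite mul1mx sI (mulmxV uI) mul1mx; apply.
Qed.

Lemma attain_inI I : posdef_sym I -> attain I I -> inI I.
Proof.
move=> pI hI; have uI := posdef_unit pI.
have sI : (invmx I)^T = invmx I by case: (posdef_inv pI).
have := attainable_mul (invmx I) hI.
rewrite (mulmxV uI) sI (mulVmx uI) mul1mx => /feas_inI.
by rewrite invmxK; apply.
Qed.

(** Attainable informations form a convex set, like the informations of
    randomized measurements; a definite [J] makes the mixture definite. *)
Lemma inI_mix I J t : 0 < t <= 1 -> attain I I -> inI J -> inI ((1 - t) *: I + t *: J).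
Proof.
move=> /andP[t0 t1] hI hJ; have pJ : posdef_sym J by case: hJ.
apply: attain_inI.
  rewrite addrC; apply: posdefD; first exact: posdefZ.
  by apply: rpsdZ; [rewrite subr_ge0|exact: attainable_psd hI].
by apply: (attainable_convex pr _ hI (inI_attain hJ)); rewrite (ltW t0) t1.
Qed.

Lemma inI_exists : exists I, inI I.
Proof. by have [V /feas_inI hV] := feas_exists pr feasible; exists (invmx V). Qed.

(** The lower bound of [attainable1_lower] on covariances is an upper bound on
    informations. *)
Lemma inI_bounded K : posdef_sym K -> exists c, forall I, inI I -> \tr (K *m I) <= c.
Proof.
move=> pK; have [c c0 hc] := attainable1_lower pr kernel_dr.
exists (\tr (K *m (c^-1)%:M)) => I hI.
have pI : posdef_sym I by case: hI.
have := inv_antitone (posdef_scalar p c0) (posdef_inv pI) (hc _ (inI_feas hI)).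
rewrite invmxK invmx_scalar => /(rpsd_trM_ge0 (posdef_rpsd pK)).
by rewrite mulmxBr mxtraceB subr_ge0.
Qed.

Lemma dual_ge K I : posdef_sym K -> inI I -> \tr (K *m I) <= dual K.
Proof.
move=> pK hI; apply: lb_le_inf.
  by have [c hc] := inI_bounded pK; exists c => J; apply: hc.
by move=> c; apply.
Qed.

Lemma dual_le K c : (forall I, inI I -> \tr (K *m I) <= c) -> dual K <= c.
Proof.
move=> h; apply: ge_inf => //; have [J hJ] := inI_exists.
by exists (\tr (K *m J)) => c'; apply.
Qed.

(** A possibly singular attainable [I] is the limit of its mixtures with an
    element of [inI]. *)
Lemma attain_le_dual K I : posdef_sym K -> attain I I -> \tr (K *m I) <= dual K.
Proof.
move=> pK hI; have [J hJ] := inI_exists; rewrite -subr_ge0.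
apply: (@ge0_of_small_steps _ _ (\tr (K *m I) - \tr (K *m J))) => t ht.
have := dual_ge pK (inI_mix ht hI hJ).
rewrite mulmxDr mxtraceD -!scalemxAr !mxtraceZ => h.
have -> : t * (dual K - \tr (K *m I)) + t ^+ 2 * (\tr (K *m I) - \tr (K *m J))
  = t * (dual K - ((1 - t) * \tr (K *m I) + t * \tr (K *m J))) by ring.
by case/andP: ht => t0 _; rewrite mulr_ge0 ?subr_ge0 // ltW.
Qed.

(** The function [J |-> tr (G0 J^-1)] is minimal at [I0] on the convex set
    [inI]. Its derivative at [I0] towards [I] is [- tr (K0 (I - I0))], which is
    therefore nonnegative. *)
Lemma dual_of_primal G0 I0 : posdef_sym G0 -> inI I0 ->
  \tr (G0 *m invmx I0) = hol G0 -> dual (invmx I0 *m G0 *m invmx I0) = hol G0.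
Proof.
move=> pG hI0 e; have pI0 : posdef_sym I0 by case: hI0.
have uI0 := posdef_unit pI0; set V0 := invmx I0.
have pV0 : posdef_sym V0 by apply: posdef_inv.
have sV0 : V0^T = V0 by case: pV0.
set K0 := V0 *m G0 *m V0.
have pK0 : posdef_sym K0.
  by rewrite /K0 -{2}sV0; apply: posdef_conj_unit => //; apply: posdef_unit.
have eK : \tr (K0 *m I0) = hol G0.
  by rewrite /K0 -mulmxA mulVmx // mulmx1 mxtrace_mulC.
apply/eqP; rewrite eq_le; apply/andP; split; last by rewrite -eK dual_ge.
apply: dual_le => I hI; rewrite -eK -subr_ge0.
have pI : posdef_sym I by case: hI.
pose D := I - I0.
have sD : D^T = D by rewrite /D linearB /=; case: pI => -> _; case: pI0 => -> _.
have -> : \tr (K0 *m I0) - \tr (K0 *m I) = - \tr (K0 *m D).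
  by rewrite /D mulmxBr mxtraceB opprB.
pose M := \tr ((D *m K0 *m D^T) *m (2 *: V0)).
suff : 0 <= - \tr (K0 *m D) / 2 by rewrite pmulr_lge0 ?invr_gt0.
apply: (@ge0_of_small_steps _ _ (M / 4)) => s /andP[s0 s1].
(* for [t] at most 1/2 one has [J >= I0 / 2], which bounds the remainder by [M] *)
pose t := s / 2.
have t0 : 0 < t by rewrite divr_gt0.
have t12 : t <= 2^-1 by rewrite /t ler_pdivrMr // mulVf // pnatr_eq0.
have t1 : 0 < t <= 1 by rewrite t0 /=; lra.
pose J := I0 + t *: D.
have eJ : J = (1 - t) *: I0 + t *: I.
  by rewrite /J /D scalerBr scalerBl scale1r addrA addrAC.
have hJ : inI J by rewrite eJ; apply: inI_mix (inI_attain hI0) hI.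
have pJ : posdef_sym J by case: hJ.
have hJ2 : rpsd (2 *: V0 - invmx J).
  have -> : 2 *: V0 = invmx (2^-1 *: I0).
    by rewrite invmxZ ?unitmxZ ?unitfE ?invr_eq0 ?pnatr_eq0 // invrK.
  apply: inv_antitone => //; first by apply: posdefZ => //; rewrite invr_gt0.
  have -> : J - 2^-1 *: I0 = (2^-1 - t) *: I0 + t *: I.
    rewrite eJ !scalerBl scale1r addrAC; congr (_ + _).
    rewrite addrAC; congr (_ - _).
    by apply/matrixP => i j; rewrite !mxE; field.
  apply: rpsdD; apply: rpsdZ; [by rewrite subr_ge0|exact: posdef_rpsd|exact: ltW|].
  exact: posdef_rpsd.
have := (proj2 hJ) _ pG.
rewrite /J (inv_expansion uI0) ?posdef_unit // -/J -/V0 -e.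
have -> : \tr (G0 *m (V0 - t *: (V0 *m D *m V0)
      + t ^+ 2 *: (V0 *m D *m invmx J *m D *m V0)))
   = \tr (G0 *m V0) - t * \tr (K0 *m D) + t ^+ 2 * \tr (D *m K0 *m D^T *m invmx J).
  rewrite mulmxDr mulmxBr mxtraceD mxtraceB -!scalemxAr !mxtraceZ sD.
  congr (_ - _ * _ + _ * _).
    by rewrite mxtrace_mulC -!mulmxA mxtrace_mulC -!mulmxA mxtrace_mulC -!mulmxA.
  by rewrite [RHS]mxtrace_mulC /K0 !mulmxA [LHS]mxtrace_mulC !mulmxA [LHS]mxtrace_mulC
     !mulmxA [LHS]mxtrace_mulC !mulmxA.
rewrite -addrA lerDl => h1.
have h2 : \tr (D *m K0 *m D^T *m invmx J) <= M.
  have := rpsd_trM_ge0 (rpsd_conj D (posdef_rpsd pK0)) hJ2.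
  by rewrite mulmxBr mxtraceB subr_ge0.
have h3 : t ^+ 2 * \tr (D *m K0 *m D^T *m invmx J) <= t ^+ 2 * M.
  by apply: ler_wpM2l => //; apply: sqr_ge0.
have -> : s * (- \tr (K0 *m D) / 2) + s ^+ 2 * (M / 4)
   = - (t * \tr (K0 *m D)) + t ^+ 2 * M by rewrite /t; field.
by apply: le_trans h1 _; rewrite lerD2l.
Qed.

(** The tangent of [V |-> V^-1] at [I0^-1] bounds [tr (G0 V)] below by [2 tr (K0
    I0) - tr (K0 V^-1)], and [V^-1] is in [inI]. *)
Lemma primal_of_dual K0 I0 : posdef_sym K0 -> inI I0 ->
  \tr (K0 *m I0) = dual K0 -> hol (I0 *m K0 *m I0) = dual K0.
Proof.
move=> pK hI0 e; have pI0 : posdef_sym I0 by case: hI0.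
have uI0 := posdef_unit pI0; have sI0 : I0^T = I0 by case: pI0.
have pG : posdef_sym (I0 *m K0 *m I0) by rewrite -{2}sI0; apply: posdef_conj_unit.
apply/eqP; rewrite eq_le -e; apply/andP; split.
  have := hol_le pr kernel_dr feasible pG (inI_feas hI0).
  by rewrite (mulmxK uI0) [X in _ <= X -> _]mxtrace_mulC; apply.
apply: (hol_ge pr kernel_dr feasible pG) => V hV.
have pV := feas_posdef pr kernel_dr hV.
have := rpsd_trM_ge0 (posdef_rpsd pK) (inv_tangent pV sI0).
have := dual_ge pK (feas_inI hV).
rewrite -e !(mulmxBr, mulmxDr, mxtraceB, mxtraceD).
have -> : \tr (K0 *m (I0 *m V *m I0)) = \tr (I0 *m K0 *m I0 *m V).
  by rewrite !mulmxA [LHS]mxtrace_mulC !mulmxA.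
by lra.
Qed.

Lemma hol_ereal_inf G : posdef_sym G ->
  (hol G)%:E = ereal_inf [set (\tr (G *m V))%:E | V in inV].
Proof.
move=> pG; apply/eqP; rewrite eq_le; apply/andP; split.
  by apply: le_ereal_inf_tmp => _ [V [_ hV] <-]; rewrite lee_fin; apply: hV.
have [V hV <-] := hol_attained pr kernel_dr feasible pG.
by apply: ereal_inf_lbound; exists V => //; apply: feas_inV.
Qed.

Lemma inV_minimizer G : posdef_sym G ->
  exists! V, inV V /\ \tr (G *m V) = hol G.
Proof.
move=> pG; have [V hV e] := hol_attained pr kernel_dr feasible pG.
exists V; split; first by split=> //; apply: feas_inV.
move=> W [hW eW]; have hWf := inV_feas pr kernel_dr feasible hW.
exact: (feas_minimizer_unique pr kernel_dr feasible pG hV hWf e eW).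
Qed.

Lemma dual_ereal_sup K : posdef_sym K ->
  (dual K)%:E = ereal_sup [set (\tr (K *m I))%:E | I in inI].
Proof.
move=> pK; have [J hJ] := inI_exists.
have -> : [set (\tr (K *m I))%:E | I in inI] = [set x%:E | x in [set \tr (K *m I) | I in inI]].
  by rewrite image_comp.
rewrite ereal_sup_EFin; last 2 first.
- by exists (dual K) => _ [I hI <-]; apply: dual_ge.
- by exists (\tr (K *m J)), J.
congr (_%:E); apply/eqP; rewrite eq_le; apply/andP; split.
  apply: dual_le => I hI; apply: ub_le_sup; last by exists I.
  by exists (dual K) => _ [I' hI' <-]; apply: dual_ge.
apply: ge_sup; first by exists (\tr (K *m J)), J.
by move=> _ [I hI <-]; apply: dual_ge.
Qed.

End Duality.

(** * Derivatives of matrix-valued functions and of the model *)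

Section ComplexDerivative.
Variables (R : realType) (p : nat).
Local Notation C := (complex R).
Implicit Types (t v : 'cV[R]_p).

Definition cder (F : 'cV[R]_p -> C) t v (z : C) : Prop :=
  is_derive t v (fun s => complex.Re (F s)) (complex.Re z) /\
  is_derive t v (fun s => complex.Im (F s)) (complex.Im z).

Definition mder m n (A : 'cV[R]_p -> 'M[C]_(m, n)) t v (D : 'M[C]_(m, n)) : Prop :=
  forall i j, cder (fun s => A s i j) t v (D i j).

Lemma cder_ext F F' t v z : (forall s, F s = F' s) -> cder F' t v z -> cder F t v z.
Proof. by move=> /funext ->. Qed.

Lemma cder_cst c t v : cder (fun=> c) t v 0.
Proof. by split; apply: is_derive_cst. Qed.

Lemma cderD F G t v z w : cder F t v z -> cder G t v w ->
  cder (fun s => F s + G s) t v (z + w).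
Proof.
case=> fr fi [gr gi]; split.
  have -> : (fun s => complex.Re (F s + G s))
     = (fun s => complex.Re (F s)) + (fun s => complex.Re (G s)).
    by apply/funext => s; rewrite ReD.
  by rewrite ReD; apply: is_deriveD.
have -> : (fun s => complex.Im (F s + G s))
   = (fun s => complex.Im (F s)) + (fun s => complex.Im (G s)).
  by apply/funext => s; rewrite ImD.
by rewrite ImD; apply: is_deriveD.
Qed.

Lemma cderM F G t v z w : cder F t v z -> cder G t v w ->
  cder (fun s => F s * G s) t v (z * G t + F t * w).
Proof.
case=> fr fi [gr gi]; split.
  have -> : (fun s => complex.Re (F s * G s))
     = (fun s => complex.Re (F s)) * (fun s => complex.Re (G s))
       - (fun s => complex.Im (F s)) * (fun s => complex.Im (G s)).
    by apply/funext => s; rewrite ReM.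
  apply: (is_derive_eq (is_deriveB (is_deriveM fr gr) (is_deriveM fi gi))).
  by rewrite ReD !ReM /GRing.scale /=; ring.
have -> : (fun s => complex.Im (F s * G s))
   = (fun s => complex.Re (F s)) * (fun s => complex.Im (G s))
     + (fun s => complex.Im (F s)) * (fun s => complex.Re (G s)).
  by apply/funext => s; rewrite ImM.
apply: (is_derive_eq (is_deriveD (is_deriveM fr gi) (is_deriveM fi gr))).
by rewrite ImD !ImM /GRing.scale /=; ring.
Qed.

Lemma cder_sum (I : Type) (e : seq I) (F : I -> 'cV[R]_p -> C) t v (z : I -> C) :
  (forall i, cder (F i) t v (z i)) ->
  cder (fun s => \sum_(i <- e) F i s) t v (\sum_(i <- e) z i).
Proof.
move=> h; elim: e => [|i e IH].
  by rewrite big_nil; apply: cder_ext (cder_cst 0 _ _) => s; rewrite big_nil.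
by rewrite big_cons; apply: cder_ext (cderD (h i) IH) => s; rewrite big_cons.
Qed.

Lemma mder_cst m n (A : 'M[C]_(m, n)) t v : mder (fun=> A) t v 0.
Proof. by move=> i j; rewrite mxE; apply: cder_cst. Qed.

Lemma mder_tens m n q s (A : 'cV[R]_p -> 'M[C]_(m, n)) (B : 'cV[R]_p -> 'M[C]_(q, s))
    t v DA DB : mder A t v DA -> mder B t v DB ->
  mder (fun x => A x *t B x) t v (DA *t B t + A t *t DB).
Proof.
move=> hA hB i j; rewrite mxE [(DA *t _) _ _]mxE [(A t *t _) _ _]mxE.
apply: cder_ext (cderM (hA _ _) (hB _ _)) => x; by rewrite mxE.
Qed.

Lemma mder_trM n (A : 'cV[R]_p -> 'M[C]_n) t v D (X : 'M[C]_n) : mder A t v D ->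
  cder (fun s => \tr (A s *m X)) t v (\tr (D *m X)).
Proof.
move=> h; rewrite /mxtrace; apply: cder_sum => i.
rewrite mxE; apply: (@cder_ext _ (fun s => \sum_j A s i j * X j i)).
  by move=> s; rewrite mxE.
apply: cder_sum => j.
have := cderM (h i j) (cder_cst (X j i) t v).
by rewrite mulr0 addr0.
Qed.

Lemma mder_tpower d (A : 'cV[R]_p -> 'M[C]_d) t v D N : mder A t v D ->
  mder (fun s => tpower (A s) N) t v (dtpower (A t) D N).
Proof.
move=> h; elim: N => [|N IH]; first exact: mder_cst.
exact: mder_tens.
Qed.

Lemma is_derive_seq (f : 'cV[R]_p -> R) t v (df : R) (h : nat -> R) :
  is_derive t v f df -> h n @[n --> \oo] --> 0 -> (forall n, h n != 0) ->
  (h n)^-1 * (f (h n *: v + t) - f t) @[n --> \oo] --> df.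
Proof.
case=> dfv <- h0 hn.
have /cvgr_dnbhsP : (e^-1 *: ((f \o shift t) (e *: v) - f t)) @[e --> (0 : R)^'] --> 'D_v f t.
  exact: dfv.
by apply.
Qed.

Lemma cder_seq F t v z (h : nat -> R) :
  cder F t v z -> h n @[n --> \oo] --> 0 -> (forall n, h n != 0) ->
  ccvg \oo (fun n => real_complex R (h n)^-1 * (F (h n *: v + t) - F t)) z.
Proof.
case=> fr fi h0 hn; split.
  have -> : (fun n => complex.Re (real_complex R (h n)^-1 * (F (h n *: v + t) - F t)))
     = (fun n => (h n)^-1 * (complex.Re (F (h n *: v + t)) - complex.Re (F t))).
    by apply/funext => n; rewrite ReZr ReD ReN.
  exact: is_derive_seq fr h0 hn.
have -> : (fun n => complex.Im (real_complex R (h n)^-1 * (F (h n *: v + t) - F t)))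
   = (fun n => (h n)^-1 * (complex.Im (F (h n *: v + t)) - complex.Im (F t))).
  by apply/funext => n; rewrite ImZr ImD ImN.
exact: is_derive_seq fi h0 hn.
Qed.

Lemma mder_seq m n (A : 'cV[R]_p -> 'M[C]_(m, n)) t v D (h : nat -> R) :
  mder A t v D -> h k @[k --> \oo] --> 0 -> (forall k, h k != 0) ->
  mcvg \oo (fun k => real_complex R (h k)^-1 *: (A (h k *: v + t) - A t)) D.
Proof.
move=> hA h0 hn i j; apply: ccvg_ext (cder_seq (hA i j) h0 hn) => k.
by rewrite !mxE.
Qed.

End ComplexDerivative.

Section Model.
Variables (R : realType) (d p : nat).
Local Notation C := (complex R).
Variables (Theta : set 'cV[R]_p) (rho : 'cV[R]_p -> 'M[C]_d) (theta : 'cV[R]_p).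
Hypothesis rho_smooth : smooth_quantum_model Theta rho.
Hypothesis theta_in : interior Theta theta.

Local Notation e_ k := (basis_vec R k).

Definition drho (k : 'I_p) : 'M[C]_d :=
  \matrix_(i, j) Complex ('D_(e_ k) (fun t => complex.Re (rho t i j)) theta)
                         ('D_(e_ k) (fun t => complex.Im (rho t i j)) theta).

Lemma mder_rho k : mder rho theta (e_ k) (drho k).
Proof.
case: rho_smooth => _ sm i j; rewrite mxE.
have [/(_ _ theta_in k)[h1 _] /(_ _ theta_in k)[h2 _]] := sm i j.
by split; apply: derivableP.
Qed.

Lemma theta_Theta : Theta theta.
Proof. exact: interior_subset theta_in. Qed.

Lemma state_psd t : Theta t -> psdmx (rho t).
Proof. by case: rho_smooth => h _ /h[]. Qed.

Lemma state_tr t : Theta t -> \tr (rho t) = 1.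
Proof. by case: rho_smooth => h _ /h[]. Qed.

Lemma segment_in_Theta (v : 'cV[R]_p) :
  exists2 e : R, 0 < e & forall h : R, `|h| <= e -> Theta (h *: v + theta).
Proof.
have : \forall h \near (0 : R), Theta (h *: v + theta).
  have hc : (h *: v + theta) @[h --> (0 : R)] --> theta.
    have e : theta = 0 *: v + theta by rewrite scale0r add0r.
    rewrite [X in _ --> X]e.
    by apply: cvgD; [apply: cvgZr_tmp; exact: cvg_id|exact: cvg_cst].
  exact: hc.
move=> /nbhs_ballP[e /= e0 he]; exists (e / 2); first by rewrite divr_gt0.
move=> h hh; apply: he; rewrite /ball /= sub0r normrN.
by apply: le_lt_trans hh _; rewrite ltr_pdivrMr // mulr_natr mulr2n ltrDl.
Qed.

(** Both half-lines through [theta] are considered because one-sided difference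
    quotients give one inequality each in [kernel_drho]. *)
Lemma drho_limit k (s : bool) : exists h : nat -> R,
  [/\ h n @[n --> \oo] --> 0, forall n, 0 < h n,
     forall n, Theta (((-1) ^+ s * h n) *: e_ k + theta) &
     forall n, (-1) ^+ s * h n != 0].
Proof.
have [e e0 he] := segment_in_Theta (e_ k).
exists (fun n => e * n.+1%:R^-1); split.
- rewrite -[X in _ --> X](mulr0 e); apply: cvgM; first exact: cvg_cst.
  exact: cvg_harmonic.
- by move=> n; rewrite mulr_gt0 // invr_gt0.
- move=> n; apply: he; rewrite normrM normr_sign mul1r ger0_norm; last first.
    by rewrite mulr_ge0 ?invr_ge0 // ltW.
  by rewrite ger_pMr // invf_le1 // ler1n.
- by move=> n; rewrite mulf_neq0 ?signr_eq0 // mulf_neq0 ?gt_eqF // invr_gt0.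
Qed.

Lemma drho_quotient k (s : bool) : exists h : nat -> R,
  [/\ forall n, 0 < h n, forall n, Theta (((-1) ^+ s * h n) *: e_ k + theta) &
  mcvg \oo (fun n => real_complex R ((-1) ^+ s * h n)^-1 *:
    (rho (((-1) ^+ s * h n) *: e_ k + theta) - rho theta)) (drho k)].
Proof.
have [h [h0 hp hT hn]] := drho_limit k s; exists h; split => //.
apply: (mder_seq (mder_rho k)) => //.
by rewrite -[X in _ --> X](mulr0 ((-1) ^+ s)); apply: cvgM => //; apply: cvg_cst.
Qed.

Lemma tr_drho k : \tr (drho k) = 0.
Proof.
have [h [hp hT hc]] := drho_quotient k false.
apply: ccvg_unique (mcvg_tr hc) _; apply: ccvg_ext (ccvg_cst 0) => n.
rewrite mxtraceZ mxtraceB !state_tr ?subrr ?mulr0 //; exact: theta_Theta.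
Qed.

(** A nonnegative function has derivative zero where it vanishes; here the
    function is the form of the state at a vector of the kernel. *)
Lemma kernel_drho k (v : 'cV[C]_d) : rho theta *m v = 0 ->
  (v ^t* *m drho k *m v) 0 0 = 0.
Proof.
move=> hv.
have hq (s : bool) : exists h : nat -> R, (forall n, 0 < h n) /\
   exists2 f : nat -> C, forall n, 0 <= f n &
     ccvg \oo (fun n => real_complex R ((-1) ^+ s * h n)^-1 * f n)
       ((v ^t* *m drho k *m v) 0 0).
  have [h [hp hT hc]] := drho_quotient k s; exists h; split=> //.
  exists (fun n => (v ^t* *m rho (((-1) ^+ s * h n) *: e_ k + theta) *m v) 0 0).
    by move=> n; case: (state_psd (hT n)).
  apply: ccvg_ext (mcvgM (mcvgM (mcvg_cst (v ^t*)) hc) (mcvg_cst v) 0 0) => n.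
  rewrite -scalemxAr -scalemxAl mulmxBr mulmxBl -(mulmxA _ (rho theta)) hv mulmx0 subr0.
  by rewrite [RHS]mxE.
apply/eqP; rewrite eq_le; apply/andP; split.
  have [h [hp [f f0 hf]]] := hq true.
  rewrite -oppr_ge0; apply: ccvg_ge0 (ccvgN hf) _ => n.
  rewrite expr1 mulN1r invrN rmorphN /= mulNr opprK mulr_ge0 // ler0c invr_ge0.
  exact: ltW.
have [h [hp [f f0 hf]]] := hq false.
apply: ccvg_ge0 hf _ => n; rewrite expr0 mul1r mulr_ge0 // ler0c invr_ge0.
exact: ltW.
Qed.

Lemma response_derive X (i j : 'I_p) :
  'D_(e_ i) (fun t => complex.Re (\tr (rho t *m X j))) theta = response drho X i j.
Proof.
have [h _] := mder_trM (X j) (mder_rho i).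
by rewrite mxE; apply: derive_val.
Qed.

Lemma locally_unbiasedE X : locally_unbiased rho theta X <->
  (forall j, (X j) ^t* = X j) /\ response drho X = 1%:M.
Proof.
split=> -[h1 h2]; split.
- by move=> j; apply/hermP.
- by apply/matrixP => i j; rewrite -response_derive h2 mxE.
- by move=> j; apply/hermP.
- by move=> i j; rewrite response_derive h2 mxE.
Qed.

Lemma holevoE G : holevo rho theta G = hol (rho theta) drho G.
Proof.
have hr := state_psd theta_Theta.
rewrite /holevo /hol; congr (inf (image _ _)); apply/seteqP; split => V /=.
  move=> [_ [X [/locally_unbiasedE[h u] q]]]; exists X; split; [exact: h|exact: u|exact: q].
move=> hV; split; first exact: (attainable_sym hr hV).
case: hV => X [h u q]; exists X; split; last exact: q.
exact/locally_unbiasedE.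
Qed.

Lemma calVE : calV rho theta = inV (rho theta) drho.
Proof.
apply/seteqP; split => V [pV h]; split; try exact: pV; move=> G pG;
  by have := h G pG; rewrite holevoE.
Qed.

Lemma calIE : calI rho theta = inI (rho theta) drho.
Proof.
apply/seteqP; split => V [pV h]; split; try exact: pV; move=> G pG;
  by have := h G pG; rewrite holevoE.
Qed.

Lemma dual_holevoE K : dual_holevo rho theta K = dual (rho theta) drho K.
Proof. by rewrite /dual_holevo calIE. Qed.

Lemma tensor_powerE (A : 'M[C]_d) N : tensor_power A N = tpower A N.
Proof. by elim: N => //= N ->. Qed.

End Model.

(** * Measurements with finitely many outcomes *)

Section FiniteMeasurement.
Variable C : numClosedFieldType.

(** Let [A] be the weighted sum. The sum of the positive matrices [(t_b - A) M_b
    (t_b - A)^H] and of [A (1 - sum M_b) A^H] is the second-moment matrix minus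
    [A A^H]. *)
Lemma kadison (J : finType) n (r : 'M[C]_n) (M : J -> 'M[C]_n) (t : J -> C) :
  psdmx r -> (forall b, psdmx (M b)) -> psdmx (1%:M - \sum_b M b) ->
  qform r (\sum_b t b *: M b) <= \sum_b `|t b| ^+ 2 * \tr (r *m M b).
Proof.
move=> pr pM pS; set A := \sum_b t b *: M b.
have eA : A ^t* = \sum_b (t b)^* *: M b.
  by rewrite /A adj_sum; apply: eq_bigr => b _; rewrite adjZ psd_herm.
pose F b := ((t b)%:M - A) *m M b *m ((t b)%:M - A) ^t*.
have pF : psdmx (\sum_b F b + A *m (1%:M - \sum_b M b) *m A ^t*).
  by apply: psd_add; [apply: psd_sum => b _|]; apply: psd_conj.
have eF b : F b = `|t b| ^+ 2 *: M b - (t b *: M b) *m A ^t*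
    - A *m ((t b)^* *: M b) + A *m M b *m A ^t*.
  rewrite /F adjB tr_scalar_mx map_scalar_mx mulmxBl mul_scalar_mx mulmxBr.
  rewrite !mulmxBl mul_mx_scalar normCK scalerA mulrC -scalemxAr.
  by rewrite mul_mx_scalar opprB addrA -!(addrAC _ (- (_ *m A ^t*))) addrAC.
have e : \sum_b F b + A *m (1%:M - \sum_b M b) *m A ^t*
    = \sum_b `|t b| ^+ 2 *: M b - A *m A ^t*.
  rewrite (eq_bigr _ (fun b _ => eF b)) !big_split /= !sumrN -mulmx_suml.
  rewrite -[in X in _ - _ - X]mulmx_sumr -eA -/A -[in X in _ - _ - _ + X]mulmx_suml -mulmx_sumr.
  rewrite mulmxBr mulmx1 mulmxBl addrA (addrAC _ (A *m A ^t*)) addrK.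
  by rewrite addrNK.
have := psd_trM_ge0 pr pF; rewrite e mulmxBr mxtraceB mulmxA subr_ge0.
move=> h; apply: le_trans h _; rewrite mulmx_sumr mxtrace_sum.
by apply: ler_sum => b _; rewrite -scalemxAr mxtraceZ.
Qed.

Variables (d p N : nat) (J : finType) (r : 'M[C]_d).
Hypotheses (pr : psdmx r) (tr1 : \tr r = 1) (N0 : (0 < N)%N).
Variable M : J -> 'M[C]_(tensor_dim d N).
Hypotheses (pM : forall b, psdmx (M b)) (pS : psdmx (1%:M - \sum_b M b)).
Variable tau : 'I_p -> J -> C.
Hypothesis tau_real : forall j b, (tau j b)^* = tau j b.

(** The observable on one copy that stands for the random variable [tau j] of
    the outcome of the measurement [M] on [N] copies. *)
Definition estimator (j : 'I_p) : 'M[C]_d :=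
  N%:R^-1 *: reduce r (\sum_b tau j b *: M b).

Lemma reduceZ c W : reduce r (c *: W) = c *: reduce (N := N) r W.
Proof. exact: linearZ_LR. Qed.

Lemma Ninv_conj : (N%:R^-1 : C)^* = N%:R^-1.
Proof. by rewrite geC0_conj // invr_ge0 ler0n. Qed.

Lemma estimator_herm j : (estimator j) ^t* = estimator j.
Proof.
rewrite /estimator adjZ Ninv_conj -reduce_adj // adj_sum.
by congr (_ *: reduce r _); apply: eq_bigr => b _; rewrite adjZ tau_real psd_herm.
Qed.

Lemma tr_estimator (dr : 'M[C]_d) j : \tr dr = 0 ->
  \tr (dr *m estimator j)
  = N%:R^-1 * \sum_b tau j b * \tr (dtpower r dr N *m M b).
Proof.
move=> dr0; rewrite /estimator -scalemxAr mxtraceZ -tr_reduce //; congr (_ * _).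
rewrite mulmx_sumr mxtrace_sum; apply: eq_bigr => b _.
by rewrite -scalemxAr mxtraceZ.
Qed.

(** On a combination of the estimators, [qform_reduce] costs a factor [N] and
    [kadison] compares the rest with the moments of the outcome; the factor
    [N^-1] of the estimators leaves [N^-1]. *)
Lemma gram_estimator : psdmx ((\matrix_(i, j) (N%:R^-1 *
    \sum_b tau i b * tau j b * \tr (tpower r N *m M b)))
    - gram r estimator estimator).
Proof.
have ptr b : 0 <= \tr (tpower r N *m M b).
  by apply: psd_trM_ge0 => //; apply: tpower_psd.
split.
  apply/hermP; rewrite adjB (gram_adj pr estimator_herm estimator_herm).
  congr (_ - _); apply/matrixP => i j; rewrite !mxE rmorphM /= Ninv_conj rmorph_sum.
  congr (_ * _); apply: eq_bigr => b _ /=.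
  by rewrite !rmorphM /= !tau_real (geC0_conj (ptr b)) (mulrC (tau j b)).
move=> v; rewrite mulmxBr mulmxBl mxE [X in _ + X]mxE subr_ge0.
rewrite (gram_form _ _ estimator_herm).
pose t b := \sum_j (v j 0)^* * tau j b.
have -> : \sum_j (v j 0)^* *: estimator j
    = N%:R^-1 *: reduce r (\sum_b t b *: M b).
  have -> : \sum_b t b *: M b = \sum_j (v j 0)^* *: \sum_b tau j b *: M b.
    under eq_bigr => b _ do rewrite /t scaler_suml.
    rewrite exchange_big; apply: eq_bigr => j _; rewrite scaler_sumr.
    by apply: eq_bigr => b _; rewrite scalerA.
  rewrite linear_sum scaler_sumr; apply: eq_bigr => j _ /=.
  by rewrite reduceZ /estimator scalerA mulrC -scalerA.
rewrite qformZ ger0_norm ?invr_ge0 ?ler0n //.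
have N1 : N%:R != 0 :> C by rewrite pnatr_eq0 -lt0n.
have h1 : qform r (reduce r (\sum_b t b *: M b))
    <= N%:R * \sum_b `|t b| ^+ 2 * \tr (tpower r N *m M b).
  apply: le_trans (qform_reduce _ _ _) _ => //.
  by rewrite ler_wpM2l ?ler0n // kadison //; apply: tpower_psd.
apply: le_trans (ler_wpM2l _ h1) _; first by rewrite exprn_ge0 ?invr_ge0 ?ler0n.
rewrite expr2 -mulrA (mulrA _ N%:R) mulVf // mul1r mxE mulr_sumr le_eqVlt.
apply/orP; left; apply/eqP.
under [RHS]eq_bigr => j _ do rewrite mxE mulr_suml.
under [RHS]eq_bigr => j _.
  under eq_bigr => i _ do rewrite !mxE mulr_sumr mulr_sumr mulr_suml.
  over.
rewrite /=.
under [RHS]eq_bigr => j _ do rewrite exchange_big.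
rewrite exchange_big; apply: eq_bigr => b _ /=.
rewrite normCK /t rmorph_sum mulr_suml mulr_suml mulr_sumr exchange_big /=.
apply: eq_bigr => j _; move: (\tr _) => y.
rewrite mulr_sumr mulr_suml mulr_sumr; apply: eq_bigr => i _.
rewrite rmorphM /= conjCK tau_real; ring.
Qed.

End FiniteMeasurement.

Section PovmAdditivity.
Variables (R : realType) (disp : measure_display) (T : measurableType disp) (n : nat).
Variable M : povm T R n.
Local Notation C := (complex R).

(** The constant series of the values at the empty set converges. *)
Lemma povm_set0 : M set0 = 0.
Proof.
have h (u : nat -> R) : (forall k, u k = u 0%N) ->
    (fun m => \sum_(0 <= k < m) u k) @ \oo --> u 0%N -> u 0%N = 0.
  move=> uc hu; have := cvg_series_cvg_0 (cvgP _ hu).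
  have -> : u = (fun=> u 0%N) by apply/funext.
  by move=> u0; apply: fcvg_unique (cvg_cst _) u0.
apply/matrixP => i j; rewrite mxE.
have [] := povm_sigma_additive M (fun=> measurable0) (@trivIset_set0 _ _ _) i j.
rewrite bigcup0 // => h1 h2; apply: complex_eq.
  exact: (h (fun=> complex.Re (M set0 i j))).
exact: (h (fun=> complex.Im (M set0 i j))).
Qed.

Lemma povm_setU A B : measurable A -> measurable B -> A `&` B = set0 ->
  M (A `|` B) = M A + M B.
Proof.
move=> mA mB AB.
have mF k : measurable (bigcup2 A B k).
  by case: k => [|[|k]] //=; exact: measurable0.
have tF : trivIset setT (bigcup2 A B) by rewrite -trivIset_bigcup2.
apply/matrixP => i j.
have [] := povm_sigma_additive M mF tF i j; rewrite bigcup2E => h1 h2.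
have lim (u : nat -> R) l : u 0%N + u 1%N = l -> (forall k, u k.+2 = 0) ->
    (fun m => \sum_(0 <= k < m) u k) @ \oo --> l.
  move=> <- u0; apply: (@cvg_trans _ ((fun=> u 0%N + u 1%N) @ \oo)); last exact: cvg_cst.
  apply: near_eq_cvg; exists 2%N => // -[|[|m]] // _.
  rewrite !big_nat_recl // big1_seq ?addr0 ?addrA //.
rewrite mxE; apply: complex_eq.
  rewrite ReD; apply: fcvg_unique h1 (lim _ _ _ _) => //= k.
  by rewrite povm_set0 mxE.
rewrite ImD; apply: fcvg_unique h2 (lim _ _ _ _) => //= k.
by rewrite povm_set0 mxE.
Qed.

Lemma povm_bigsetU (J : finType) (B : J -> set T) (s : seq J) : uniq s ->
  (forall b, measurable (B b)) -> (forall b c x, B b x -> B c x -> b = c) ->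
  M (\big[setU/set0]_(b <- s) B b) = \sum_(b <- s) M (B b).
Proof.
move=> us mB dB; elim: s us => [|b s IH] /=; first by rewrite !big_nil povm_set0.
case/andP=> bs us; rewrite !big_cons povm_setU ?IH //.
  exact: bigsetU_measurable.
apply/seteqP; split => // x [xb]; rewrite -bigcup_seq => -[c /= cs xc].
by move: bs; rewrite (dB _ _ _ xb xc) cs.
Qed.

Lemma povm_partial (J : finType) (B : J -> set T) :
  (forall b, measurable (B b)) -> (forall b c x, B b x -> B c x -> b = c) ->
  psdmx (1%:M - \sum_b M (B b)).
Proof.
move=> mB dB; rewrite -povm_bigsetU ?index_enum_uniq //.
set A := \big[_/_]_(_ <- _) _.
have mA : measurable A by apply: bigsetU_measurable.
have := povm_setU mA (measurableC mA) (setICr A).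
rewrite setUCr povm_setT => ->.
rewrite [X in psdmx X](_ : _ = M (~` A)).
  exact: povm_psd (measurableC mA).
by rewrite addrC addKr.
Qed.

End PovmAdditivity.

Section FiniteAttainable.
Variables (R : realType) (d p N : nat) (J : finType).
Local Notation C := (complex R).
Variables (r : 'M[C]_d) (dr : 'I_p -> 'M[C]_d).
Hypotheses (pr : psdmx r) (tr1 : \tr r = 1) (N0 : (0 < N)%N).
Hypothesis tr_dr : forall k, \tr (dr k) = 0.
Variable M : J -> 'M[C]_(tensor_dim d N).
Hypotheses (pM : forall b, psdmx (M b)) (pS : psdmx (1%:M - \sum_b M b)).
Variable tau : 'I_p -> J -> R.

(** For [tau] the scores of the outcome, both matrices are the average Fisher
    information. *)
Lemma finite_measurement_attainable : attainable r dr
  (\matrix_(i, j) (N%:R^-1 * \sum_b tau j b * complex.Re (\tr (dtpower r (dr i) N *m M b))))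
  (\matrix_(i, j) (N%:R^-1 * \sum_b tau i b * tau j b * complex.Re (\tr (tpower r N *m M b)))).
Proof.
pose t j b := real_complex R (tau j b).
have tR j b : (t j b)^* = t j b by exact: conj_real.
have NE : (N%:R^-1 : C) = real_complex R N%:R^-1 by rewrite fmorphV rmorph_nat.
exists (estimator r M t); split.
- exact: estimator_herm.
- apply/matrixP => i j; rewrite mxE [RHS]mxE tr_estimator // NE ReZr Re_sum.
  by congr (_ * _); apply: eq_bigr => b _; rewrite ReZr.
have h := gram_estimator pr tr1 N0 pM pS tR.
have trE b : real_complex R (complex.Re (\tr (tpower r N *m M b))) = \tr (tpower r N *m M b).
  have : 0 <= \tr (tpower r N *m M b).
    by apply: psd_trM_ge0; [exact: tpower_psd|exact: pM].
  by rewrite cplx_ge0 => /andP[/eqP h1 _]; apply: complex_eq.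
set V := \matrix_(i, j) _.
set W := (X in psdmx (X - _)) in h.
suff -> : cmx V = W by exact: h.
apply/matrixP => i j; rewrite /V /W [LHS]mxE [in LHS]mxE [RHS]mxE NE rmorphM rmorph_sum.
congr (_ * _); apply: eq_bigr => b _.
by rewrite [LHS]rmorphM [in LHS]rmorphM /= trE.
Qed.

End FiniteAttainable.

(** * Approximation of the scores by step functions *)

Section RealIntegral.
Context {disp} {T : measurableType disp} {R : realType}.
Variable mu : {measure set T -> \bar R}.
Implicit Types (A B : set T) (f g : T -> R).

Lemma le_integrableR A f g : measurable A -> measurable_fun A f ->
  (forall x, A x -> `|f x| <= g x) -> mu.-integrable A (EFin \o g) ->
  mu.-integrable A (EFin \o f).
Proof.
move=> mA mf fg; apply: (le_integrable mA); first exact/measurable_EFinP.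
move=> x Ax /=; rewrite !lee_fin; exact: le_trans (fg _ Ax) (ler_norm _).
Qed.

Lemma integrable_measurable A f : mu.-integrable A (EFin \o f) -> measurable_fun A f.
Proof. by move=> /measurable_int/measurable_EFinP. Qed.

Lemma integrable_sub A f : measurable A -> mu.-integrable setT (EFin \o f) ->
  mu.-integrable A (EFin \o f).
Proof. by move=> mA; apply: integrableS. Qed.

Lemma integrableDR A f g : measurable A -> mu.-integrable A (EFin \o f) ->
  mu.-integrable A (EFin \o g) -> mu.-integrable A (EFin \o (fun x => f x + g x)).
Proof. by move=> mA fi gi; have := integrableD mA fi gi. Qed.

Lemma integrableZR A f c : measurable A -> mu.-integrable A (EFin \o f) ->
  mu.-integrable A (EFin \o (fun x => c * f x)).
Proof. by move=> mA fi; have := integrableZl mA c fi. Qed.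

Lemma integrable_normR A f : measurable A -> mu.-integrable A (EFin \o f) ->
  mu.-integrable A (EFin \o (fun x => `|f x|)).
Proof. by move=> mA fi; have := integrable_abse fi. Qed.

Lemma Rdominated_convergence A (u : nat -> T -> R) f g : measurable A ->
  (forall n, measurable_fun A (u n)) ->
  (forall x, A x -> u n x @[n --> \oo] --> f x) ->
  mu.-integrable A (EFin \o g) ->
  (forall n x, A x -> `|u n x| <= g x) ->
  \int[mu]_(x in A) u n x @[n --> \oo] --> \int[mu]_(x in A) f x.
Proof.
move=> mA mu_ uf ig ug.
have mf : measurable_fun A f by apply: measurable_fun_cvg uf.
have [|||//|//|fi _ h] := @dominated_convergence _ T R mu A mA
    (fun n => EFin \o u n) (EFin \o f) (EFin \o g).
- by move=> n; apply/measurable_EFinP.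
- exact/measurable_EFinP.
- by apply/aeW => x Ax; apply: cvg_EFin; [exact: nearW|exact: uf].
- by apply/aeW => x n Ax /=; rewrite lee_fin; apply: ug.
rewrite /Rintegral; apply: fine_cvg; rewrite fineK; last exact: integrable_fin_num.
exact: h.
Qed.

Lemma Rintegral_sum (J : Type) (s : seq J) A (F : J -> T -> R) : measurable A ->
  (forall b, mu.-integrable A (EFin \o F b)) ->
  \int[mu]_(x in A) (\sum_(b <- s) F b x) = \sum_(b <- s) \int[mu]_(x in A) F b x.
Proof.
move=> mA iF; elim: s => [|b s IH].
  under eq_Rintegral do rewrite big_nil.
  by rewrite big_nil Rintegral_cst // mul0r.
under eq_Rintegral do rewrite big_cons.
rewrite big_cons RintegralD // ?IH //.
rewrite (_ : _ \o _ = fun x => (\sum_(i <- s) (F i x)%:E)%E); last first.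
  by apply/funext => x; rewrite /= sumEFin.
by apply: (@integrable_sum _ _ _ _ _ mA _ _ _ (fun b => EFin \o F b)) => b0 _; exact: iF.
Qed.

End RealIntegral.

Section ScoreApproximation.
Context {disp} {T : measurableType disp} {R : realType}.
Variable mu : {measure set T -> \bar R}.
Variables (p : nat) (f : T -> R) (q : 'I_p -> nat -> T -> R) (D : 'I_p -> T -> R).
Hypothesis f_ge0 : forall x, 0 <= f x.
Hypothesis f_int : mu.-integrable setT (EFin \o f).
Hypothesis q_meas : forall k n, measurable_fun setT (q k n).
Hypothesis q_cvg : forall k x, q k n x @[n --> \oo] --> D k x.

(** The product of two scores times the density. The convention [x / 0 = 0]
    gives the value zero where the density vanishes. *)
Definition fisher_integrand i j x := D i x * D j x / f x.
Hypothesis fisher_int : forall i j,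
  mu.-integrable setT (EFin \o fisher_integrand i j).

(** The set on which the density is bounded below and the difference quotients
    are bounded, so that they are dominated by a multiple of the density. *)
Definition good_set (n : nat) : set T :=
  [set x | n.+1%:R^-1 <= f x /\ forall l k, `|q k l x| <= n.+1%:R].

Definition cell_index (n : nat) := {ffun 'I_p -> 'I_(2 * n.+1 ^ 3).+1}.

(** The points of the good set at which the scores, which are at most [n.+1 ^ 2]
    there, lie in a given cube of side [n.+1^-1]; the inequalities are
    multiplied by [f x]. *)
Definition cell n (b : cell_index n) : set T :=
  good_set n `&` [set x | forall j, (b j)%:R * f x <=
    n.+1%:R * (D j x + n.+1%:R ^+ 2 * f x) < (b j).+1%:R * f x].

(** The lower corner of the cube. *)
Definition cell_score n (j : 'I_p) (b : cell_index n) : R :=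
  (b j)%:R / n.+1%:R - n.+1%:R ^+ 2.

Lemma f_meas : measurable_fun setT f.
Proof. exact: integrable_measurable f_int. Qed.

Lemma D_meas k : measurable_fun setT (D k).
Proof. by apply: (measurable_fun_cvg (q_meas k)) => x _; apply: q_cvg. Qed.

Lemma measurable_good_set n : measurable (good_set n).
Proof.
have -> : good_set n = (setT `&` [set x | n.+1%:R^-1 <= f x]) `&`
    \bigcap_l \bigcap_(k in [set: 'I_p]) (setT `&` [set x | `|q k l x| <= n.+1%:R]).
  apply/seteqP; split => x /=.
    by move=> [h1 h2]; split => // l _ k _; split => //; apply: h2.
  by move=> [[_ h1] h2]; split => // l k; have [] := h2 l I k I.
apply: measurableI; first exact: measurable_fun_le f_meas.
apply: bigcapT_measurable => l; apply: fin_bigcap_measurable => [|k _].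
  exact: finite_finset.
by apply: measurable_fun_le => //; apply: measurableT_comp.
Qed.

Lemma measurable_cell n b : measurable (@cell n b).
Proof.
have -> : cell b = good_set n `&` \bigcap_(j in [set: 'I_p])
   ((setT `&` [set x | (b j)%:R * f x <= n.+1%:R * (D j x + n.+1%:R ^+ 2 * f x)]) `\`
    (setT `&` [set x | (b j).+1%:R * f x <= n.+1%:R * (D j x + n.+1%:R ^+ 2 * f x)])).
  apply/seteqP; split => x /= [gx h]; split => // j.
    by move=> _; have /andP[h1 h2] := h j; split=> // -[_]; apply/negP; rewrite -ltNge.
  by have [[_ h1] h2] := h j I; rewrite h1 ltNge; apply/negP => h3; apply: h2.
have mr j : measurable_fun setT (fun x => n.+1%:R * (D j x + n.+1%:R ^+ 2 * f x)).
  apply: measurable_funM => //; apply: measurable_funD; first exact: D_meas.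
  by apply: measurable_funM => //; exact: f_meas.
apply: measurableI; first exact: measurable_good_set.
apply: fin_bigcap_measurable => [|j _]; first exact: finite_finset.
by apply: measurableD; apply: measurable_fun_le => //; apply: measurable_funM => //; exact: f_meas.
Qed.

Lemma good_setP n x : good_set n x ->
  [/\ 0 < f x & forall k, `|D k x| <= n.+1%:R ^+ 2 * f x].
Proof.
case=> h1 h2; have f0 : 0 < f x by apply: lt_le_trans h1; rewrite invr_gt0.
split=> // k; have : `|D k x| <= n.+1%:R.
  apply: (cvgr_to_le (cvg_norm (@q_cvg k x))); exact: nearW.
move=> /le_trans; apply; rewrite expr2 -mulrA ler_peMr //.
by rewrite -[leLHS](divff (x := n.+1%:R)) // ler_wpM2l.
Qed.

Lemma cellP n b x : @cell n b x -> forall j,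
  `|cell_score j b - D j x / f x| <= n.+1%:R^-1.
Proof.
case=> gx h j; have [f0 _] := good_setP gx; have /andP[h1 h2] := h j.
have n0 : 0 < n.+1%:R :> R by [].
rewrite /cell_score ler_norml.
have e : D j x / f x = (n.+1%:R * (D j x + n.+1%:R ^+ 2 * f x)) / f x / n.+1%:R
    - n.+1%:R ^+ 2.
  by field; rewrite !gt_eqF.
move: h1 h2; set w := n.+1%:R * (D j x + _) => h1 h2.
have {}h1 : (b j)%:R <= w / f x by rewrite ler_pdivlMr.
have {}h2 : w / f x <= (b j)%:R + 1 by rewrite ler_pdivrMr // natr1 ltW.
rewrite e -/w opprB addrA subrK -mulrBl lerNl -mulNr opprB.
by rewrite -[X in _ && (_ <= X)]mul1r -[X in (_ <= X) && _]mul1r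
  !ler_pM2r ?invr_gt0 //; apply/andP; split; lra.
Qed.

Lemma cell_disjoint n b c x : @cell n b x -> @cell n c x -> b = c.
Proof.
case=> gx h [_ h']; have [f0 _] := good_setP gx.
apply/ffunP => j; apply/val_inj => /=.
have /andP[h1 h2] := h j; have /andP[h3 h4] := h' j.
have := le_lt_trans h1 h4; have := le_lt_trans h3 h2.
rewrite !ltr_pM2r // !ltr_nat !ltnS => e1 e2.
by apply/eqP; rewrite eqn_leq e1 e2.
Qed.

Lemma cell_cover n x : good_set n x -> exists b, @cell n b x.
Proof.
move=> gx; have [f0 hD] := good_setP gx.
pose w j := n.+1%:R * (D j x + n.+1%:R ^+ 2 * f x) / f x.
have w0 j : 0 <= w j.
  rewrite /w divr_ge0 // mulr_ge0 //.
  by have := hD j; rewrite ler_norml => /andP[h _]; lra.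
have wL j : (Num.truncn (w j) < (2 * n.+1 ^ 3).+1)%N.
  rewrite truncn_lt_nat // ltr_pdivrMr //.
  have := hD j; rewrite ler_norml => /andP[_ h].
  have hn : n.+1%:R * (D j x + n.+1%:R ^+ 2 * f x) <= (2 * n.+1 ^ 3)%:R * f x.
    rewrite natrM natrX.
    have := ler_wpM2l (ler0n R n.+1) h; lra.
  by apply: le_lt_trans hn _; rewrite ltr_pM2r // ltr_nat.
exists [ffun j => Ordinal (wL j)]; split=> // j; rewrite ffunE /=.
have /andP[h1 h2] := truncn_itv (w0 j).
by rewrite -ler_pdivlMr // -ltr_pdivrMr // h1.
Qed.

Lemma good_set_eventually x : 0 < f x ->
  \forall n \near \oo, good_set n x.
Proof.
move=> f0.
have hb k : exists M : nat, forall l, `|q k l x| <= M%:R.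
  have [M [_ hM]] := cvg_seq_bounded (cvgP _ (@q_cvg k x)).
  exists (Num.truncn (M + 1)).+1 => l; apply: (hM (Num.truncn (M + 1)).+1%:R) => //.
  by apply: lt_trans (truncnS_gt _); rewrite ltrDl.
have [M hM] := choice hb.
pose B := (\sum_k M k + (Num.truncn (f x)^-1).+1)%N.
exists B => // n /= Bn; split.
  rewrite invf_ple ?posrE //; apply: ltW; apply: lt_le_trans (truncnS_gt _) _.
  by rewrite ler_nat (leq_trans _ (leqW Bn)) // leq_addl.
move=> l k; apply: le_trans (hM k l) _; rewrite ler_nat.
rewrite (leq_trans _ (leqW Bn)) // (leq_trans _ (leq_addr _ _)) //.
by rewrite (bigD1 k) //= leq_addr.
Qed.

Lemma fisher_integrand0 i j x : f x = 0 -> fisher_integrand i j x = 0.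
Proof. by move=> h; rewrite /fisher_integrand h invr0 mulr0. Qed.

Lemma sum_cells n (F : cell_index n -> R) b x : @cell n b x ->
  \sum_c F c * \1_(cell c) x = F b.
Proof.
move=> bx; rewrite (bigD1 b) //= indicE mem_set // mulr1 big1 ?addr0 // => c cb.
rewrite indicE memNset ?mulr0 // => cx.
by move: cb; rewrite (cell_disjoint cx bx) eqxx.
Qed.

Lemma sum_cells0 n (F : cell_index n -> R) x : ~ good_set n x ->
  \sum_c F c * \1_(cell c) x = 0.
Proof.
move=> gx; rewrite big1 // => c _; rewrite indicE memNset ?mulr0 //.
by case=> /gx.
Qed.

(** The sum over the cells is the integral of a step function that converges to
    the integrand wherever the density is positive and is dominated by [G] and
    the integrand. *)
Lemma step_limit (i j : 'I_p) (Phi : forall n, cell_index n -> T -> R) (G : T -> R) :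
  (forall n b, measurable_fun setT (Phi n b)) ->
  mu.-integrable setT (EFin \o G) -> (forall x, 0 <= G x) ->
  (forall n b x, cell b x ->
     `|Phi n b x - fisher_integrand i j x| <= n.+1%:R^-1 * G x) ->
  \sum_b \int[mu]_(x in cell b) Phi n b x @[n --> \oo]
    --> \int[mu]_x fisher_integrand i j x.
Proof.
move=> mPhi iG G0 hPhi.
pose H x := G x + `|fisher_integrand i j x|.
have iH : mu.-integrable setT (EFin \o H).
  by apply: integrableDR => //; apply: integrable_normR.
have mPhi1 n b : measurable_fun setT (fun x => Phi n b x * \1_(cell b) x).
  by apply: measurable_funM => //; apply: measurable_indic; exact: measurable_cell.
have PhiH n b x : cell b x -> `|Phi n b x| <= H x.
  move=> bx; rewrite -[Phi _ _ _](subrK (fisher_integrand i j x)).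
  apply: le_trans (ler_normD _ _) _; rewrite lerD2r.
  apply: le_trans (hPhi _ _ _ bx) _.
  by rewrite ler_piMl // invf_le1 // ler1n.
have stepH n x : `|\sum_b Phi n b x * \1_(cell b) x| <= H x.
  have [/cell_cover[b bx]|gx] := pselect (good_set n x).
    by rewrite (sum_cells (fun b => Phi n b x) bx) PhiH.
  by rewrite sum_cells0 // normr0 addr_ge0.
have iPhi1 n b : mu.-integrable setT (EFin \o (fun x => Phi n b x * \1_(cell b) x)).
  apply: le_integrableR iH => // x _; rewrite indicE.
  have [/set_mem bx|_] := boolP (x \in cell b); first by rewrite mulr1 PhiH.
  by rewrite mulr0 normr0 addr_ge0.
have -> : (fun n => \sum_b \int[mu]_(x in cell b) Phi n b x)
    = (fun n => \int[mu]_x \sum_b Phi n b x * \1_(cell b) x).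
  apply/funext => n; rewrite Rintegral_sum //; apply: eq_bigr => b _.
  rewrite Rintegral_mkcond; apply: eq_Rintegral => x _.
  rewrite patchE indicE; case: ifP => _; by rewrite ?mulr1 ?mulr0.
apply: (Rdominated_convergence measurableT _ _ iH) => [n|x _|//].
  by apply: measurable_sum.
have [f0|f0] := eqVneq (f x) 0.
  rewrite fisher_integrand0 //; have c0 : (fun=> 0 : R) @ \oo --> (0 : R) by exact: cvg_cst.
  apply: cvg_trans c0.
  apply: near_eq_cvg; exists 0%N => // n _; rewrite sum_cells0 //.
  by case/good_setP; rewrite f0 ltxx.
have {}f0 : 0 < f x by rewrite lt0r f0 f_ge0.
apply/cvgrPdist_le => e e0.
have hG : n.+1%:R^-1 * G x @[n --> \oo] --> 0.
  rewrite -[X in _ --> X](mul0r (G x)); apply: cvgM; last exact: cvg_cst.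
  exact: cvg_harmonic.
have hG' : \forall n \near \oo, n.+1%:R^-1 * G x <= e.
  move/cvgrPdist_le : hG => /(_ e e0); apply: filterS => n.
  by rewrite sub0r normrN; apply: le_trans; apply: ler_norm.
apply: filterS2 hG' (good_set_eventually f0) => n h1 /cell_cover[b bx].
rewrite (sum_cells (fun b => Phi n b x) bx) distrC.
exact: le_trans (hPhi _ _ _ bx) h1.
Qed.

(** A common majorant of the two errors in [cell_integrands]. *)
Definition score_bound i j x :=
  fisher_integrand i i x + fisher_integrand j j x + 3 * f x.

Lemma score_bound_int i j : mu.-integrable setT (EFin \o score_bound i j).
Proof.
apply: integrableDR => //; last exact: integrableZR.
exact: integrableDR.
Qed.

Lemma score_bound_ge0 i j x : 0 <= score_bound i j x.
Proof.
have h k : 0 <= fisher_integrand k k x.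
  by rewrite /fisher_integrand divr_ge0 // -expr2 sqr_ge0.
by rewrite !addr_ge0 // mulr_ge0.
Qed.

Lemma cell_integrands i j n b x : @cell n b x ->
  `|cell_score j b * D i x - fisher_integrand i j x| <= n.+1%:R^-1 * score_bound i j x /\
  `|cell_score i b * cell_score j b * f x - fisher_integrand i j x|
     <= n.+1%:R^-1 * score_bound i j x.
Proof.
move=> bx; have [gx _] := bx; have [f0 _] := good_setP gx.
have hi := cellP bx i; have hj := cellP bx j.
set ti := cell_score i b in hi *; set tj := cell_score j b in hj *.
have fn0 : f x != 0 by rewrite gt_eqF.
have eD k : D k x = (D k x / f x) * f x by rewrite divfK.
have eI k l : fisher_integrand k l x = (D k x / f x) * (D l x / f x) * f x.
  by rewrite /fisher_integrand; field.
rewrite /score_bound !eI (eD i) mulfK //.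
set a := D i x / f x in hi *; set c := D j x / f x in hj *.
set e := n.+1%:R^-1 in hi hj *.
have e0 : 0 < e by rewrite invr_gt0.
have e1 : e <= 1 by rewrite invf_le1 // ler1n.
have -> : e * (a * a * f x + c * c * f x + 3 * f x) = e * (a * a + c * c + 3) * f x by ring.
have na : `|a| <= a * a + 1.
  by rewrite ler_norml; apply/andP; split; nra.
have nc : `|c| <= c * c + 1.
  by rewrite ler_norml; apply/andP; split; nra.
have aa : 0 <= a * a by rewrite -expr2 sqr_ge0.
have cc : 0 <= c * c by rewrite -expr2 sqr_ge0.
split.
  have -> : tj * (a * f x) - a * c * f x = (tj - c) * a * f x by ring.
  rewrite normrM (ger0_norm (f_ge0 x)) ler_wpM2r // normrM.
  apply: ler_pM => //; lra.
have -> : ti * tj * f x - a * c * f x = ((ti - a) * (tj - c) + a * (tj - c) + (ti - a) * c) * f x.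
  by ring.
rewrite normrM (ger0_norm (f_ge0 x)) ler_wpM2r //.
apply: le_trans (ler_normD _ _) _; apply: le_trans (lerD (ler_normD _ _) (lexx _)) _.
rewrite (normrM (ti - a) (tj - c)) (normrM a (tj - c)) (normrM (ti - a) c).
have h1 : `|ti - a| * `|tj - c| <= e * 1 by apply: ler_pM => //; apply: le_trans hj e1.
have h2 : `|a| * `|tj - c| <= (a * a + 1) * e by apply: ler_pM.
have h3 : `|ti - a| * `|c| <= e * (c * c + 1) by apply: ler_pM.
lra.
Qed.

Variable P' : 'I_p -> set T -> R.
Hypothesis P'_lim : forall k B, measurable B ->
  \int[mu]_(x in B) q k n x @[n --> \oo] --> P' k B.

(** Differentiation under the integral sign, by domination. *)
Lemma good_derivative k n B : measurable B -> B `<=` good_set n ->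
  P' k B = \int[mu]_(x in B) D k x.
Proof.
move=> mB hB.
suff h : \int[mu]_(x in B) q k m x @[m --> \oo] --> \int[mu]_(x in B) D k x.
  exact: fcvg_unique (P'_lim mB) h.
apply: (@Rdominated_convergence _ _ _ _ _ _ _ (fun x => n.+1%:R ^+ 2 * f x)) => //.
- by move=> m; apply: measurable_funS (q_meas k m).
- by apply: integrableZR => //; apply: integrable_sub.
move=> l x /hB[h1 h2]; apply: le_trans (h2 l k) _.
rewrite expr2 -mulrA ler_peMr //.
by rewrite -[leLHS](divff (x := n.+1%:R)) // ler_wpM2l.
Qed.

(** The mean of a score approximation against the derivative of the law tends to
    the Fisher information. *)
Lemma score_cross_limit i j :
  \sum_b cell_score j b * P' i (@cell n b) @[n --> \oo] --> \int[mu]_x fisher_integrand i j x.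
Proof.
have := @step_limit i j (fun n b x => cell_score j b * D i x) (score_bound i j).
have -> : (fun n => \sum_b \int[mu]_(x in @cell n b) (cell_score j b * D i x))
    = (fun n => \sum_b cell_score j b * P' i (@cell n b)).
  apply/funext => n; apply: eq_bigr => b _.
  have sub : cell b `<=` good_set n by move=> x [].
  rewrite (good_derivative i (measurable_cell b) sub) RintegralZl //.
    exact: measurable_cell.
  apply: (@le_integrableR _ _ _ _ _ _ (fun x => n.+1%:R ^+ 2 * f x)).
  - exact: measurable_cell.
  - exact: measurable_funS (D_meas i).
  - by move=> x [/good_setP[_]].
  - by apply: integrableZR; [exact: measurable_cell|apply: integrable_sub => //; exact: measurable_cell].
apply.
- by move=> n b; apply: measurable_funM => //; exact: D_meas.
- exact: score_bound_int.
- exact: score_bound_ge0.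
- by move=> n b x /(cell_integrands i j)[].
Qed.

(** So do the second moments of the score approximations. *)
Lemma score_square_limit i j :
  \sum_b cell_score i b * cell_score j b * \int[mu]_(x in @cell n b) f x @[n --> \oo]
    --> \int[mu]_x fisher_integrand i j x.
Proof.
have := @step_limit i j (fun n b x => cell_score i b * cell_score j b * f x) (score_bound i j).
have -> : (fun n => \sum_b \int[mu]_(x in @cell n b) (cell_score i b * cell_score j b * f x))
    = (fun n => \sum_b cell_score i b * cell_score j b * \int[mu]_(x in @cell n b) f x).
  apply/funext => n; apply: eq_bigr => b _; rewrite RintegralZl //.
    exact: measurable_cell.
  by apply: integrable_sub => //; exact: measurable_cell.
apply.
- by move=> n b; apply: measurable_funM => //; exact: f_meas.
- exact: score_bound_int.
- exact: score_bound_ge0.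
- by move=> n b x /(cell_integrands i j)[].
Qed.

End ScoreApproximation.

(** * Closedness of attainability, scores, and null sets *)

Section AttainableClosed.
Variables (R : realType) (d p : nat).
Local Notation C := (complex R).
Variables (r : 'M[C]_d) (dr : 'I_p -> 'M[C]_d).
Hypotheses (pr : psdmx r).
Hypothesis kernel_dr : forall k (v : 'cV[C]_d), r *m v = 0 ->
  (v ^t* *m dr k *m v) 0 0 = 0.

Lemma cvg_entries_bounded (D : nat -> 'M[R]_p) (D' : 'M[R]_p) :
  (forall i j, D n i j @[n --> \oo] --> D' i j) ->
  exists M : R, forall n i j, `|D n i j| <= M.
Proof.
move=> h.
have hb (ij : 'I_p * 'I_p) : exists M : R, 0 <= M /\ forall n, `|D n ij.1 ij.2| <= M.
  have [M [_ hM]] := cvg_seq_bounded (cvgP _ (h ij.1 ij.2)).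
  exists (`|M| + 1); split; first by rewrite addr_ge0.
  move=> n; apply: (hM (`|M| + 1)) => //.
  by rewrite (le_lt_trans (ler_norm _)) // ltrDl.
have [M hM] := choice hb.
exists (\sum_ij M ij) => n i j.
apply: le_trans (proj2 (hM (i, j)) n) _.
rewrite (bigD1 (i, j)) //= lerDl; apply: sumr_ge0 => ij _.
exact: proj1 (hM ij).
Qed.

Lemma attainable_cvg (D V : nat -> 'M[R]_p) (D' V' : 'M[R]_p) :
  (forall n, attainable r dr (D n) (V n)) ->
  (forall i j, D n i j @[n --> \oo] --> D' i j) ->
  (forall i j, V n i j @[n --> \oo] --> V' i j) ->
  attainable r dr D' V'.
Proof.
move=> hDV hD hV.
have [M1 h1] := cvg_entries_bounded hD; have [M2 h2] := cvg_entries_bounded hV.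
have [U [UU ooU]] := ultra_on_nat.
have [||D1 [V1 [hA eD eV]]] := @attainable_limit _ _ _ _ _ pr kernel_dr U UU D V (Num.max M1 M2) hDV.
- by move=> n i j; rewrite le_max h1.
- by move=> n i j; rewrite le_max h2 orbT.
have -> : D' = D1.
  apply/matrixP => i j; have h := cvg_trans (cvg_app (fun n => D n i j) ooU) (hD i j).
  exact: fcvg_unique h (eD i j).
have -> // : V' = V1.
apply/matrixP => i j; have h := cvg_trans (cvg_app (fun n => V n i j) ooU) (hV i j).
exact: fcvg_unique h (eV i j).
Qed.

End AttainableClosed.

Section Score.
Variables (R : realType) (p : nat).
Implicit Types (F : 'cV[R]_p -> R) (t v : 'cV[R]_p).

(** Directional derivatives are derivatives along a line, to which the
    one-variable chain rule applies. *)
Lemma is_derive_line F t v (a : R) :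
  is_derive t v F a <-> is_derive (0 : R) (1 : R) (fun h : R => F (h *: v + t)) a.
Proof.
have e : (fun h : R => h^-1 *: (((fun h => F (h *: v + t)) \o shift 0) (h *: (1 : R)) -
    F ((0 : R) *: v + t))) = (fun h => h^-1 *: ((F \o shift t) (h *: v) - F t)).
  by apply/funext => h /=; rewrite addr0 scale0r add0r [h *: 1]mulr1.
split=> -[h1 h2]; split.
- by rewrite /derivable e.
- by rewrite /derive e.
- by move: h1; rewrite /derivable e.
- by move: h2; rewrite /derive e.
Qed.

Lemma derive_ln F t v : 0 < F t -> derivable F t v ->
  'D_v (fun s => ln (F s)) t = 'D_v F t / F t.
Proof.
move=> F0 /derivableP /is_derive_line h.
have h0 : is_derive (F ((0 : R) *: v + t)) 1 (@ln R) (F t)^-1.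
  by rewrite scale0r add0r; apply: is_derive1_ln.
have := is_derive1_comp h0 h.
move/(is_derive_line (fun s => ln (F s)) t v _) => h1.
by rewrite (derive_val (is_derive := h1)) mulrC.
Qed.

End Score.

Section NullSets.
Context {disp} {T : measurableType disp} {R : realType}.
Variable mu : {measure set T -> \bar R}.
Implicit Types (A B N : set T) (f g : T -> R).

Lemma measurable_off f N : measurable N -> measurable_fun setT f ->
  measurable_fun setT (fun x => f x * \1_(~` N) x).
Proof.
by move=> mN mf; apply: measurable_funM => //; apply: measurable_indic; apply: measurableC.
Qed.

Lemma integrable_off f N : measurable N -> mu.-integrable setT (EFin \o f) ->
  mu.-integrable setT (EFin \o (fun x => f x * \1_(~` N) x)).
Proof.
move=> mN fi; have mf := integrable_measurable fi.
have fi' := integrable_normR measurableT fi.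
apply: (le_integrableR measurableT _ _ fi'); first exact: measurable_off.
move=> x _; rewrite normrM indicE ler_piMr //.
by case: (_ \in _); rewrite ?normr1 ?normr0.
Qed.

Lemma Rintegral_off f N A : measurable A -> measurable N -> mu N = 0%E ->
  measurable_fun setT f ->
  \int[mu]_(x in A) (f x * \1_(~` N) x) = \int[mu]_(x in A) f x.
Proof.
move=> mA mN N0 mf; congr fine; apply: ae_eq_integral => //.
- by apply/measurable_EFinP; apply: measurable_funS (measurable_off mN mf).
- by apply/measurable_EFinP; apply: measurable_funS mf.
exists N; split=> // x /= h; apply: contrapT => Nx; apply: h => _.
by rewrite indicE mem_set // mulr1.
Qed.

(** On the set where [f] is negative its integral is both nonnegative and
    nonpositive. *)
Lemma integral_ge0_ae f : mu.-integrable setT (EFin \o f) ->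
  (forall B, measurable B -> 0 <= \int[mu]_(x in B) f x) ->
  {ae mu, forall x, 0 <= f x}.
Proof.
move=> fi h; have mf := integrable_measurable fi.
pose B := setT `&` [set x | f x < 0].
have mB : measurable B.
  have -> : B = ~` (setT `&` [set x | 0 <= f x]).
    apply/seteqP; split => x; first by case=> _ /= fx [_]; rewrite leNgt fx.
    by move=> h0; split=> //=; rewrite ltNge; apply/negP => h1; apply: h0.
  by apply: measurableC; apply: measurable_fun_le.
have fB : mu.-integrable B (EFin \o f) by apply: integrable_sub.
have e : (\int[mu]_(x in B) `|(EFin \o f) x|)%E = 0%E.
  have e1 : (\int[mu]_(x in B) `|(EFin \o f) x|)%E = (\int[mu]_(x in B) ((- f x)%:E))%E.
    by apply: eq_integral => x /set_mem[_ fx] /=; rewrite ler0_norm // ltW.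
  have : \int[mu]_(x in B) (- f x) = 0.
    apply/eqP; rewrite eq_le; apply/andP; split; last first.
      by apply: Rintegral_ge0 => x [_ fx]; rewrite oppr_ge0 ltW.
    under eq_Rintegral do rewrite -mulN1r.
    by rewrite RintegralZl // mulN1r oppr_le0; apply: h.
  rewrite e1 /Rintegral => e2; rewrite -[LHS]fineK ?e2 //.
  have fN := integrableZR (-1) mB fB.
  have := integrable_fin_num mB fN.
  by congr (_ \is a fin_num); apply: eq_integral => x _ /=; rewrite mulN1r.
have mfB : measurable_fun B (EFin \o f) by apply: measurable_int fB.
have /(ae_eq_integral_abs mu mB mfB) [N [mN N0 hN]] := e.
exists N; split=> // x /= /negP; rewrite -ltNge => fx; apply: hN => /= hx.
have /(_ (conj I fx)) [] := hx; move=> f0; by rewrite f0 ltxx in fx.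
Qed.

End NullSets.

(** * The Fisher information of a measurement is attainable *)

Lemma cvg_seq_ext (R : realType) (u v : nat -> R) (l : R) :
  (forall n, u n = v n) -> u n @[n --> \oo] --> l -> v n @[n --> \oo] --> l.
Proof. by move=> /funext ->. Qed.

Section FisherBound.
Variables (R : realType) (d p : nat).
Local Notation C := (complex R).
Variables (Theta : set 'cV[R]_p) (rho : 'cV[R]_p -> 'M[C]_d) (theta : 'cV[R]_p).
Hypothesis rho_smooth : smooth_quantum_model Theta rho.
Hypothesis theta_in : interior Theta theta.
Variables (N : nat) (disp : measure_display) (T : measurableType disp).
Variable M : povm T R (tensor_dim d N).
Hypothesis N0 : (0 < N)%N.

Local Notation e_ k := (basis_vec R k).
Local Notation D := (drho rho theta).

Definition law_derivative (k : 'I_p) (B : set T) : R :=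
  complex.Re (\tr (dtpower (rho theta) (D k) N *m M B)).

Lemma outcome_lawE t B : outcome_law rho M t B = complex.Re (\tr (tpower (rho t) N *m M B)).
Proof. by rewrite /outcome_law tensor_powerE. Qed.

Lemma is_derive_law k B :
  is_derive theta (e_ k) (fun t => outcome_law rho M t B) (law_derivative k B).
Proof.
have -> : (fun t => outcome_law rho M t B)
    = (fun t => complex.Re (\tr (tpower (rho t) N *m M B))).
  by apply/funext => t; apply: outcome_lawE.
by have [h _] := mder_trM (M B) (@mder_tpower _ _ _ _ _ _ _ N (mder_rho rho_smooth theta_in k)).
Qed.

Lemma outcome_law_ge0 t B : Theta t -> measurable B -> 0 <= outcome_law rho M t B.
Proof.
move=> tT mB; rewrite outcome_lawE.
have : 0 <= \tr (tpower (rho t) N *m M B).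
  apply: psd_trM_ge0; first exact: (tpower_psd (state_psd rho_smooth tT)).
  exact: povm_psd mB.
by rewrite cplx_ge0 => /andP[].
Qed.

Section Dominated.
Variables (mu : {sigma_finite_measure set T -> \bar R}) (f : 'cV[R]_p -> T -> R).
Hypothesis f_dens : density_family Theta (outcome_law rho M) mu f.
Hypothesis f_der : {ae mu, forall x, forall k : 'I_p,
  derivable (fun t => f t x) theta (e_ k)}.

Lemma density_Rintegral t B : Theta t -> measurable B ->
  \int[mu]_(x in B) f t x = outcome_law rho M t B.
Proof. by move=> tT mB; have [_ h] := f_dens tT; rewrite /Rintegral -h. Qed.

Lemma density_regular_set : exists Z : set T,
  [/\ measurable Z, mu Z = 0%E & forall x, ~ Z x ->
    0 <= f theta x /\ forall k, derivable (fun t => f t x) theta (e_ k)].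
Proof.
have tT := theta_Theta theta_in.
have [fi _] := f_dens tT.
have f0 : {ae mu, forall x, 0 <= f theta x}.
  apply: (integral_ge0_ae fi) => B mB; rewrite density_Rintegral //.
  exact: outcome_law_ge0.
have [Z [mZ Z0 hZ]] := filterI f0 f_der.
exists Z; split=> // x Zx; apply: contrapT => h; apply: Zx; apply: hZ => /= -[h1 h2].
exact: h.
Qed.

Hypothesis score_int : forall i j : 'I_p, mu.-integrable setT
  (EFin \o (fun x => score f theta i x * score f theta j x * f theta x)).

(** On the cells the finite-outcome bound applies to the approximate scores: the
    responses and the second moments both tend to [I], and attainability is
    closed. The densities and their quotients are set to zero on a null set, so
    that all the limits exist everywhere. *)
Lemma fisher_attainable (I : 'M[R]_p) :
  (forall i j, I i j = \int[mu]_x (score f theta i x * score f theta j x * f theta x)) ->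
  attainable (rho theta) D (N%:R^-1 *: I) (N%:R^-1 *: I).
Proof.
move=> hI; have tT := theta_Theta theta_in.
have [Z [mZ Z0 hZ]] := density_regular_set.
have /choice[h hh] k := drho_limit theta_in k false.
pose f0 x := f theta x * \1_(~` Z) x.
pose q k n x := ((h k n)^-1 * (f (h k n *: e_ k + theta) x - f theta x)) * \1_(~` Z) x.
pose D0 k x := 'D_(e_ k) (fun t => f t x) theta * \1_(~` Z) x.
have fi t : Theta t -> mu.-integrable setT (EFin \o f t) by move=> /f_dens[].
have hT k n : Theta (h k n *: e_ k + theta).
  by have [_ _ /(_ n) + _] := hh k; rewrite expr0 mul1r.
have f0_ge0 x : 0 <= f0 x.
  rewrite /f0 indicE; have [/set_mem Zx|_] := boolP (x \in ~` Z); last by rewrite mulr0.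
  by rewrite mulr1; have [] := hZ x Zx.
have f0_int : mu.-integrable setT (EFin \o f0) by apply: integrable_off => //; apply: fi.
have qi k n : mu.-integrable setT
    (EFin \o (fun x => (h k n)^-1 * (f (h k n *: e_ k + theta) x - f theta x))).
  apply: integrableZR => //; have -> : (fun x => f (h k n *: e_ k + theta) x - f theta x)
      = (fun x => f (h k n *: e_ k + theta) x + -1 * f theta x).
    by apply/funext => x; rewrite mulN1r.
  by apply: integrableDR => //; [exact: fi|apply: integrableZR => //; exact: fi].
have q_meas k n : measurable_fun setT (q k n).
  by apply: measurable_off => //; apply: integrable_measurable (qi k n).
have hn k n : h k n != 0.
  by have [_ /(_ n) + _ _] := hh k; apply: lt0r_neq0.
have h0 k : h k n @[n --> \oo] --> 0 by have [] := hh k.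
have offE x : ~ Z x -> \1_(~` Z) x = 1 :> R by move=> Zx; rewrite indicE mem_set.
have onE x : Z x -> \1_(~` Z) x = 0 :> R.
  by move=> Zx; rewrite indicE memNset // => /(_ Zx).
have q_cvg k x : q k n x @[n --> \oo] --> D0 k x.
  rewrite /q /D0; have [Zx|Zx] := pselect (Z x).
    rewrite onE // mulr0; apply: (@cvg_seq_ext _ (fun=> 0)); last exact: cvg_cst.
    by move=> n; rewrite mulr0.
  apply: cvgM; last exact: cvg_cst.
  have [_ /(_ k) dx] := hZ x Zx.
  exact: (is_derive_seq (derivableP dx) (h0 k) (hn k)).
have eI i j x : fisher_integrand f0 D0 i j x
    = score f theta i x * score f theta j x * f theta x * \1_(~` Z) x.
  rewrite /fisher_integrand /f0 /D0; have [Zx|Zx] := pselect (Z x).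
    by rewrite onE // !mulr0 mul0r.
  rewrite offE // !mulr1; have [fx dx] := hZ x Zx.
  have [->|fx0] := eqVneq (f theta x) 0; first by rewrite invr0 !mulr0.
  have fxp : 0 < f theta x by rewrite lt0r fx0.
  rewrite /score !(derive_ln fxp) //; field; exact: fx0.
have fisher_int i j : mu.-integrable setT (EFin \o fisher_integrand f0 D0 i j).
  rewrite (_ : fisher_integrand f0 D0 i j = fun x => score f theta i x * score f theta j x * f theta x * \1_(~` Z) x).
    exact: integrable_off.
  by apply/funext.
have I_int i j : \int[mu]_x fisher_integrand f0 D0 i j x = I i j.
  rewrite hI -[RHS](Rintegral_off measurableT mZ Z0 (integrable_measurable (score_int i j))).
  by apply: eq_Rintegral => x _; apply: eI.
have lim_law k B : measurable B ->
    \int[mu]_(x in B) q k n x @[n --> \oo] --> law_derivative k B.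
  move=> mB; apply: cvg_seq_ext (is_derive_seq (is_derive_law k B) (h0 k) (hn k)) => n.
  rewrite (Rintegral_off mB mZ Z0 (integrable_measurable (qi k n))).
  have fB t : Theta t -> mu.-integrable B (EFin \o f t).
    by move=> /fi ft; apply: integrable_sub ft.
  rewrite RintegralZl //; last first.
    have -> : (fun x => f (h k n *: e_ k + theta) x - f theta x)
        = (fun x => f (h k n *: e_ k + theta) x + -1 * f theta x).
      by apply/funext => x; rewrite mulN1r.
    by apply: integrableDR => //; [exact: fB|apply: integrableZR => //; exact: fB].
  by rewrite RintegralB // ?density_Rintegral //; apply: fB.
pose law b := complex.Re (\tr (tpower (rho theta) N *m M b)).
pose c := @cell_score R p.
pose B n := @cell _ T R p f0 q D0 n.
have mB n b : measurable (B n b) by apply: (measurable_cell (mu := mu)).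
have dB n b b' x : B n b x -> B n b' x -> b = b' by apply: cell_disjoint.
pose Dn n : 'M[R]_p := \matrix_(i, j) (N%:R^-1 * \sum_b c n j b * law_derivative i (B n b)).
pose Vn n : 'M[R]_p := \matrix_(i, j) (N%:R^-1 * \sum_b c n i b * c n j b * law (B n b)).
have key : forall n, attainable (rho theta) D (Dn n) (Vn n).
  move=> n; have pM b : psdmx (M (B n b)) by apply: povm_psd.
  exact: (finite_measurement_attainable (state_psd rho_smooth tT) (state_tr rho_smooth tT)
    N0 (tr_drho rho_smooth theta_in) pM (povm_partial M (mB n) (@dB n)) (c n)).
apply: (attainable_cvg (state_psd rho_smooth tT) (kernel_drho rho_smooth theta_in) key).
- move=> i j; rewrite mxE -I_int; under eq_fun do rewrite mxE.
  apply: cvgM; first exact: cvg_cst.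
  exact: (score_cross_limit f0_ge0 f0_int q_meas q_cvg fisher_int lim_law).
move=> i j; rewrite mxE -I_int; under eq_fun do rewrite mxE.
apply: cvgM; first exact: cvg_cst.
apply: cvg_seq_ext (score_square_limit f0_ge0 f0_int q_meas q_cvg fisher_int (i := i) (j := j)) => n.
apply: eq_bigr => b _; congr (_ * _).
rewrite (Rintegral_off (mB n b) mZ Z0 (integrable_measurable (fi _ tT))).
by rewrite density_Rintegral // outcome_lawE.
Qed.

End Dominated.

Lemma fisher_information_attainable (I : 'M[R]_p) :
  is_fisher_information Theta (outcome_law rho M) theta I ->
  attainable (rho theta) D (N%:R^-1 *: I) (N%:R^-1 *: I).
Proof.
case=> mu [f [h1 h2 h3]].
apply: (fisher_attainable h1 h2) => i j; have [] := h3 i j; [by []|by move=> _ ->].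
Qed.

End FisherBound.

(** * Densities of set functions *)

Section SetFunctions.
Context {disp} {T : measurableType disp} {R : realType}.

Definition sigma_add (nu : set T -> R) : Prop :=
  forall F : (set T)^nat, (forall k, measurable (F k)) -> trivIset setT F ->
    (fun m => \sum_(0 <= k < m) nu (F k)) @ \oo --> nu (\bigcup_k F k).

Lemma finite_measure_of (nu : set T -> R) : nu set0 = 0 ->
  (forall B, measurable B -> 0 <= nu B) -> sigma_add nu ->
  exists mu : {finite_measure set T -> \bar R},
    forall B, measurable B -> mu B = (nu B)%:E.
Proof.
move=> nu0 nu_ge0 nu_add.
pose m (B : set T) : \bar R := (Num.max 0 (nu B))%:E.
have mE B : measurable B -> m B = (nu B)%:E.
  by move=> mB; congr EFin; apply/max_idPr; apply: nu_ge0.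
have m0 : m set0 = 0%E by rewrite mE // nu0.
have m_ge0 B : (0 <= m B)%E by rewrite lee_fin le_max lexx.
have m_add : semi_sigma_additive m.
  move=> F mF tF mUF; rewrite mE //.
  have -> : (fun n => (\sum_(0 <= i < n) m (F i))%E)
      = (fun n => (\sum_(0 <= i < n) nu (F i))%:E).
    by apply/funext => n; rewrite -sumEFin; apply: eq_bigr => i _; rewrite mE.
  by apply: cvg_EFin; [exact: nearW|exact: nu_add].
pose mM := isMeasure.Build _ _ _ m m0 m_ge0 m_add.
pose m1 : {measure set T -> \bar R} := HB.pack m mM.
have fm : fin_num_fun m1 by move=> B mB; rewrite /= mE.
pose fM := Measure_isFinite.Build _ _ _ m1 fm.
pose m2 : {finite_measure set T -> \bar R} := HB.pack m mM fM.
by exists m2.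
Qed.

Lemma density_exists (mu : {finite_measure set T -> \bar R}) (nu : set T -> R) :
  nu set0 = 0 -> sigma_add nu ->
  (forall B, measurable B -> mu B = 0%E -> nu B = 0) ->
  exists2 g : T -> R, mu.-integrable setT (EFin \o g) &
    forall B, measurable B -> nu B = \int[mu]_(x in B) g x.
Proof.
move=> nu0 nu_add nu_mu.
pose m (B : set T) : \bar R := (nu B)%:E.
have m0 : m set0 = 0%E by rewrite /m nu0.
have m_fin B : measurable B -> m B \is a fin_num by [].
have m_add : semi_sigma_additive m.
  move=> F mF tF mUF.
  have -> : (fun n => (\sum_(0 <= i < n) m (F i))%E)
      = (fun n => (\sum_(0 <= i < n) nu (F i))%:E).
    by apply/funext => n; rewrite -sumEFin.
  by apply: cvg_EFin; [exact: nearW|exact: nu_add].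
pose mM := isCharge.Build _ _ _ m m0 m_fin m_add.
pose m1 : {charge set T -> \bar R} := HB.pack m mM.
have dom : m1 `<< mu.
  by move=> N hN A mA AN; rewrite /= /m nu_mu //; apply: hN.
exists (fine \o Radon_Nikodym m1 mu).
  have -> : EFin \o (fine \o Radon_Nikodym m1 mu) = Radon_Nikodym m1 mu.
    by apply/funext => x /=; rewrite fineK // Radon_Nikodym_fin_num.
  exact: Radon_Nikodym_integrable.
move=> B mB; have h := Radon_Nikodym_integral dom mB.
have : (nu B)%:E = (\int[mu]_(x in B) Radon_Nikodym m1 mu x)%E by rewrite -h.
rewrite /Rintegral => e; rewrite -[LHS]/(fine (nu B)%:E) e; congr fine.
by apply: eq_integral => x _ /=; rewrite fineK // Radon_Nikodym_fin_num.
Qed.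

End SetFunctions.

(** The quadratic polynomial [f q^2 - 2 h q + c] is nonnegative at all
    rationals, hence its discriminant is nonpositive. A null set can only be
    discarded for countably many [q]. The case [f = 0] is a limit of [f > 0]. *)
Lemma rational_discriminant (R : realType) (f h c : R) : 0 <= f -> 0 <= c ->
  (forall q : rat, 0 <= (ratr q) ^+ 2 * f + c - 2 * ratr q * h) -> h ^+ 2 <= c * f.
Proof.
move=> f0 c0 hq.
suff key g : 0 < g -> f <= g -> h ^+ 2 <= c * g.
  apply/ler_addgt0Pr => e e0.
  have c1 : 0 < c + 1 by lra.
  have e1 : 0 < e / (c + 1) by rewrite divr_gt0.
  have := key (f + e / (c + 1)); rewrite lerDl (ltW e1) => /(_ (ltr_wpDl f0 e1) isT).
  move=> /le_trans; apply; rewrite mulrDr lerD2l mulrA ler_pdivrMr //.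
  by rewrite mulrDr mulr1 mulrC lerDl ltW.
move=> g0 fg; rewrite leNgt; apply/negP => hlt.
pose D := (h ^+ 2 / g - c) / g.
have D0 : 0 < D by rewrite divr_gt0 // subr_gt0 ltr_pdivlMr.
pose dl := Num.min 1 D.
have dl0 : 0 < dl by rewrite lt_min ltr01 D0.
have [q] := rat_in_itvoo (ltr_pwDr dl0 (lexx (h / g))).
rewrite in_itv /= => /andP[q1 q2].
set z := ratr q - h / g.
have z0 : 0 < z by rewrite subr_gt0.
have zd : z < dl by rewrite ltrBlDl.
have z1 : z < 1 by apply: lt_le_trans zd _; rewrite ge_min lexx.
have zD : z < D by apply: lt_le_trans zd _; rewrite ge_min lexx orbT.
have e : (ratr q) ^+ 2 * g + c - 2 * ratr q * h = g * (z ^+ 2 - D).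
  by rewrite /D /z; field; rewrite gt_eqF.
have := hq q; apply/negP; rewrite -ltNge.
apply: (@le_lt_trans _ _ ((ratr q) ^+ 2 * g + c - 2 * ratr q * h)).
  by rewrite lerD2r lerD2r ler_wpM2l // sqr_ge0.
rewrite e pmulr_rlt0 // subr_lt0; apply: le_lt_trans zD.
by rewrite expr2 ler_piMr // ltW.
Qed.

(** * The density of a measurement *)

Section PovmDensity.
Context {disp} {T : measurableType disp} {R : realType}.
Local Notation C := (complex R).
Variables (n : nat) (M : povm T R n).

Lemma Re_trM (A X : 'M[C]_n) : complex.Re (\tr (A *m X)) =
  \sum_(ij : 'I_n * 'I_n) (complex.Re (A ij.1 ij.2) * complex.Re (X ij.2 ij.1)
    - complex.Im (A ij.1 ij.2) * complex.Im (X ij.2 ij.1)).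
Proof.
rewrite /mxtrace Re_sum.
rewrite -(pair_bigA _ (fun i j => complex.Re (A i j) * complex.Re (X j i)
    - complex.Im (A i j) * complex.Im (X j i))) /=.
apply: eq_bigr => i _; rewrite mxE Re_sum; apply: eq_bigr => j _.
by rewrite ReM.
Qed.

Lemma povm_Re_add i j : sigma_add (fun B => complex.Re (M B i j)).
Proof. by move=> F mF tF; have [] := povm_sigma_additive M mF tF i j. Qed.

Lemma povm_Im_add i j : sigma_add (fun B => complex.Im (M B i j)).
Proof. by move=> F mF tF; have [] := povm_sigma_additive M mF tF i j. Qed.

Lemma povm_tr_add : sigma_add (fun B => complex.Re (\tr (M B))).
Proof.
move=> F mF tF; rewrite /mxtrace Re_sum.
have -> : (fun m => \sum_(0 <= k < m) complex.Re (\sum_i M (F k) i i))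
    = (fun m => \sum_i \sum_(0 <= k < m) complex.Re (M (F k) i i)).
  apply/funext => m; rewrite exchange_big; apply: eq_bigr => k _.
  by rewrite Re_sum.
have e (I : Type) (s : seq I) (u : I -> nat -> R) (l : I -> R) :
    (forall i, u i m @[m --> \oo] --> l i) ->
    \sum_(i <- s) u i m @[m --> \oo] --> \sum_(i <- s) l i.
  move=> h; elim: s => [|i s IH].
    rewrite big_nil; apply: cvg_seq_ext (cvg_cst 0) => m; by rewrite big_nil.
  rewrite big_cons; apply: cvg_seq_ext (cvgD (h i) IH) => m.
  by rewrite big_cons.
apply: e => i; exact: povm_Re_add mF tF.
Qed.

Lemma povm_tr_ge0 B : measurable B -> 0 <= complex.Re (\tr (M B)).
Proof.
by move=> mB; have := psd_tr_ge0 (povm_psd M mB); rewrite cplx_ge0 => /andP[].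
Qed.

Lemma povm_tr_eq0 B : measurable B -> complex.Re (\tr (M B)) = 0 -> M B = 0.
Proof.
move=> mB h; apply: (psd_tr_eq0 (povm_psd M mB)).
have := psd_tr_ge0 (povm_psd M mB); rewrite cplx_ge0 => /andP[/eqP h' _].
exact: complex_eq.
Qed.

(** The trace of the measurement dominates all its entries, which therefore have
    densities; the law of the outcome in every state is a linear image of these.
    *)
Lemma povm_density : exists (mu : {finite_measure set T -> \bar R}) (m : T -> 'M[C]_n),
  (forall B, measurable B -> mu B = (complex.Re (\tr (M B)))%:E) /\
  forall A : 'M[C]_n,
    mu.-integrable setT (EFin \o (fun x => complex.Re (\tr (A *m m x)))) /\
    forall B, measurable B ->
      complex.Re (\tr (A *m M B)) = \int[mu]_(x in B) complex.Re (\tr (A *m m x)).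
Proof.
have [|mu muE] := finite_measure_of _ povm_tr_ge0 povm_tr_add.
  by rewrite povm_set0 mxtrace0.
have null B : measurable B -> mu B = 0%E -> M B = 0.
  by move=> mB; rewrite muE // => -[]; apply: povm_tr_eq0.
have hr (ij : 'I_n * 'I_n) : exists g : T -> R, mu.-integrable setT (EFin \o g) /\
    forall B, measurable B -> complex.Re (M B ij.1 ij.2) = \int[mu]_(x in B) g x.
  have [|B mB B0|g g1 g2] := density_exists (mu := mu) _ (@povm_Re_add ij.1 ij.2).
  - by rewrite povm_set0 mxE.
  - by rewrite (null B mB B0) mxE.
  - by exists g.
have hi (ij : 'I_n * 'I_n) : exists g : T -> R, mu.-integrable setT (EFin \o g) /\
    forall B, measurable B -> complex.Im (M B ij.1 ij.2) = \int[mu]_(x in B) g x.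
  have [|B mB B0|g g1 g2] := density_exists (mu := mu) _ (@povm_Im_add ij.1 ij.2).
  - by rewrite povm_set0 mxE.
  - by rewrite (null B mB B0) mxE.
  - by exists g.
have [r hr'] := choice hr; have [s hs'] := choice hi.
exists mu, (fun x => \matrix_(i, j) Complex (r (i, j) x) (s (i, j) x)); split=> // A.
pose F (ij : 'I_n * 'I_n) x := complex.Re (A ij.1 ij.2) * r (ij.2, ij.1) x
   + (- complex.Im (A ij.1 ij.2)) * s (ij.2, ij.1) x.
have -> : (fun x => complex.Re (\tr (A *m \matrix_(i, j) Complex (r (i, j) x) (s (i, j) x))))
    = (fun x => \sum_ij F ij x).
  apply/funext => x; rewrite Re_trM; apply: eq_bigr => ij _.
  by rewrite /F !mxE mulNr.
have iF ij B : measurable B -> mu.-integrable B (EFin \o F ij).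
  move=> mB; have [h1 _] := hr' (ij.2, ij.1); have [h2 _] := hs' (ij.2, ij.1).
  by apply: integrableDR => //; apply: integrableZR => //; apply: integrable_sub.
have eF B ij : measurable B -> \int[mu]_(x in B) F ij x
    = complex.Re (A ij.1 ij.2) * complex.Re (M B ij.2 ij.1)
      - complex.Im (A ij.1 ij.2) * complex.Im (M B ij.2 ij.1).
  move=> mB; have [h1 h1'] := hr' (ij.2, ij.1); have [h2 h2'] := hs' (ij.2, ij.1).
  have i1 := integrable_sub mB h1; have i2 := integrable_sub mB h2.
  rewrite RintegralD //; [|exact: integrableZR..].
  by rewrite !RintegralZl // -h1' // -h2' // mulNr.
split.
  rewrite (_ : _ \o _ = fun x => (\sum_ij (F ij x)%:E)%E); last first.
    by apply/funext => x; rewrite /= sumEFin.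
  by apply: (@integrable_sum _ _ _ _ _ measurableT _ _ _ (fun b => EFin \o F b)) => b _; apply: iF.
move=> B mB; rewrite Rintegral_sum // => [|ij]; last exact: iF.
by rewrite Re_trM; apply: eq_bigr => ij _; rewrite eF.
Qed.

End PovmDensity.

(** * Existence of the Fisher information *)

(** The polynomial in [q] has nonpositive discriminant. *)
Lemma quadratic_ge0 (R : realType) (P t h c q : R) : 0 <= P -> 0 <= t -> 0 <= c ->
  h ^+ 2 <= c * (P * t) -> 0 <= q ^+ 2 * P + (c * t + - (2 * q) * h).
Proof.
move=> P0 t0 c0 hh.
have S0 : 0 <= q ^+ 2 * P + c * t by apply: addr_ge0; apply: mulr_ge0 => //; apply: sqr_ge0.
suff : 2 * q * h <= q ^+ 2 * P + c * t by lra.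
rewrite leNgt; apply/negP => hlt.
have h1 : (q ^+ 2 * P + c * t) ^+ 2 < (2 * q * h) ^+ 2.
  by rewrite ltr_pXn2r // nnegrE ltW // (le_lt_trans S0 hlt).
have h2 : (2 * q * h) ^+ 2 <= 4 * q ^+ 2 * (c * (P * t)).
  have -> : (2 * q * h) ^+ 2 = 4 * q ^+ 2 * h ^+ 2 by ring.
  by rewrite ler_wpM2l // mulr_ge0 // sqr_ge0.
have h3 : 0 <= (q ^+ 2 * P - c * t) ^+ 2 by apply: sqr_ge0.
have e : (q ^+ 2 * P + c * t) ^+ 2
  = 4 * q ^+ 2 * (c * (P * t)) + (q ^+ 2 * P - c * t) ^+ 2 by ring.
lra.
Qed.

Lemma normM_le (R : realType) (a b y : R) : a ^+ 2 <= y -> b ^+ 2 <= y -> `|a * b| <= y.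
Proof.
move=> ha hb; have h1 := sqr_ge0 (a - b); have h2 := sqr_ge0 (a + b).
by rewrite ler_norml; apply/andP; split; lra.
Qed.

Section FisherExistence.
Variables (R : realType) (d p : nat).
Local Notation C := (complex R).
Variables (Theta : set 'cV[R]_p) (rho : 'cV[R]_p -> 'M[C]_d) (theta : 'cV[R]_p).
Hypothesis rho_smooth : smooth_quantum_model Theta rho.
Hypothesis theta_in : interior Theta theta.
Variables (N : nat) (disp : measure_display) (T : measurableType disp).
Variable M : povm T R (tensor_dim d N).

Local Notation e_ k := (basis_vec R k).
Local Notation D := (drho rho theta).
Local Notation law' := (law_derivative rho theta M).

(** The derivative of the law is the response of the reduced observable, bounded
    by [derivative_bound]; then [qform_reduce] and [psd_sqr_le] bound its second
    moment by the probability times the trace. *)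
Lemma law_derivative_bound : exists2 c : R, 0 <= c & forall k B, measurable B ->
  law' k B ^+ 2 <= c * (outcome_law rho M theta B * complex.Re (\tr (M B))).
Proof.
have tT := theta_Theta theta_in.
have pr := state_psd rho_smooth tT; have tr1 := state_tr rho_smooth tT.
have [c c0 hc] := derivative_bound pr (kernel_drho rho_smooth theta_in).
exists (c * N%:R); first by rewrite mulr_ge0.
move=> k B mB; have pM : psdmx (M B) := povm_psd M mB.
pose X := reduce (rho theta) (M B).
have hX : X ^t* = X by rewrite /X -reduce_adj // psd_herm.
have e1 : \tr (dtpower (rho theta) (D k) N *m M B) = \tr (D k *m X).
  exact: (tr_reduce _ _ (tr_drho rho_smooth theta_in k)).
rewrite /law_derivative e1; apply: le_trans (hc k X hX) _.
rewrite -mulrA; apply: ler_wpM2l => //.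
have h1 : qform (rho theta) X <= N%:R * (\tr (M B) * \tr (tpower (rho theta) N *m M B)).
  apply: le_trans (qform_reduce pr tr1 (M B)) _.
  apply: ler_wpM2l; first exact: ler0n.
  rewrite /qform (psd_herm pM); apply: psd_sqr_le; [exact: tpower_psd|exact: pM].
have := cplx_le h1; move/le_trans; apply.
have tr0 := psd_tr_ge0 pM.
have [i0 _] : complex.Im (\tr (M B)) = 0 /\ True.
  by move: tr0; rewrite cplx_ge0 => /andP[/eqP].
have -> : (N%:R : C) = real_complex R N%:R by rewrite rmorph_nat.
rewrite ReZr ReM i0 mul0r subr0 outcome_lawE (mulrC (complex.Re (\tr (M B)))).
exact: lexx.
Qed.

(** The family of densities is the linear image of the state under the density
    of the measurement, so that it is differentiable. The bound on the
    derivatives of the probabilities of all events gives [h^2 <= c f] almost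
    everywhere for the derivative [h] of the density [f]. Hence the integrands
    [h_i h_j / f] are bounded, and the dominating measure is finite. *)
Lemma fisher_information_exists :
  exists I : 'M[R]_p, is_fisher_information Theta (outcome_law rho M) theta I.
Proof.
have tT := theta_Theta theta_in.
have [mu [m [muE hm]]] := povm_density M.
have [c c0 hc] := law_derivative_bound.
pose F t x := complex.Re (\tr (tpower (rho t) N *m m x)).
pose H k x := complex.Re (\tr (dtpower (rho theta) (D k) N *m m x)).
have Fint t : mu.-integrable setT (EFin \o F t) by have [] := hm (tpower (rho t) N).
have Hint k : mu.-integrable setT (EFin \o H k).
  by have [] := hm (dtpower (rho theta) (D k) N).
have FE t B : measurable B -> \int[mu]_(x in B) F t x = outcome_law rho M t B.
  by move=> mB; have [_ h] := hm (tpower (rho t) N); rewrite outcome_lawE h.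
have HE k B : measurable B -> \int[mu]_(x in B) H k x = law' k B.
  by move=> mB; have [_ h] := hm (dtpower (rho theta) (D k) N); rewrite /law_derivative h.
have cint (a : R) B : measurable B -> mu.-integrable B (EFin \o (fun=> a)).
  move=> mB; exact: finite_measure_integrable_cst.
have quad k (q : R) : {ae mu, forall x, 0 <= q ^+ 2 * F theta x + c - 2 * q * H k x}.
  pose u x := q ^+ 2 * F theta x + (c + (- (2 * q)) * H k x).
  have uint B : measurable B -> mu.-integrable B (EFin \o u).
    move=> mB; apply: integrableDR => //.
      by apply: integrableZR => //; apply: integrable_sub.
    apply: integrableDR => //; first exact: cint.
    by apply: integrableZR => //; apply: integrable_sub.
  have : {ae mu, forall x, 0 <= u x}.
    apply: integral_ge0_ae; first exact: uint.
    move=> B mB.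
    rewrite RintegralD //; first last.
    - apply: integrableDR => //; first exact: cint.
      by apply: integrableZR => //; apply: integrable_sub.
    - by apply: integrableZR => //; apply: integrable_sub.
    rewrite RintegralD //; first last.
    - by apply: integrableZR => //; apply: integrable_sub.
    - exact: cint.
    rewrite !RintegralZl //; [|exact: integrable_sub..].
    have CE : \int[mu]_(x in B) c = c * complex.Re (\tr (M B)).
      by rewrite Rintegral_cst //; congr (c * _); apply: (f_equal fine (muE B mB)).
    rewrite FE // HE // CE.
    have P0 : 0 <= outcome_law rho M theta B.
      exact: (outcome_law_ge0 rho_smooth M tT mB).
    exact: (quadratic_ge0 q P0 (povm_tr_ge0 M mB) c0 (hc k B mB)).
  by apply: filterS => x; rewrite /u mulNr addrA.
have [Z [mZ Z0 hZ]] : exists Z, [/\ measurable Z, mu Z = 0%E &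
    forall x, ~ Z x -> 0 <= F theta x /\ forall k, H k x ^+ 2 <= c * F theta x].
  have F0 : {ae mu, forall x, 0 <= F theta x}.
    apply: (integral_ge0_ae (Fint theta)) => B mB; rewrite FE //.
    exact: (outcome_law_ge0 rho_smooth M tT mB).
  (* one null set for all pairs of a direction and a rational *)
  have : {ae mu, forall x, forall n : nat, 0 <= F theta x /\
      if (unpickle n : option ('I_p * rat)) is Some (k, q)
      then 0 <= (ratr q) ^+ 2 * F theta x + c - 2 * ratr q * H k x else True}.
    apply: ae_foralln => n; apply: filterI F0 _.
    case: (unpickle n) => [[k q]|]; first exact: quad.
    exact: aeW.
  case=> Z [mZ Z0 hZ]; exists Z; split=> // x Zx.
  have hx : forall n : nat, 0 <= F theta x /\
      if (unpickle n : option ('I_p * rat)) is Some (k, q)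
      then 0 <= (ratr q) ^+ 2 * F theta x + c - 2 * ratr q * H k x else True.
    by apply: contrapT => h; apply: Zx; apply: hZ.
  have [Fx _] := hx 0%N; split=> // k; apply: rational_discriminant => // q.
  by have [_] := hx (pickle (k, q)); rewrite pickleK.
pose f t x := F t x * \1_(~` Z) x.
have offE x : ~ Z x -> \1_(~` Z) x = 1 :> R by move=> Zx; rewrite indicE mem_set.
have onE x : Z x -> \1_(~` Z) x = 0 :> R.
  by move=> Zx; rewrite indicE memNset // => /(_ Zx).
have fder x k : is_derive theta (e_ k) (fun t => f t x) (H k x * \1_(~` Z) x).
  have [h _] := mder_trM (m x) (@mder_tpower _ _ _ _ _ _ _ N (mder_rho rho_smooth theta_in k)).
  have -> : (fun t => f t x) = \1_(~` Z) x *: (fun t => F t x).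
    by apply/funext => t; rewrite /f mulrC.
  rewrite mulrC; exact: is_deriveZ.
have f_meas : measurable_fun setT (f theta).
  by apply: measurable_off => //; apply: integrable_measurable.
pose g i j x := H i x * H j x * (f theta x) `^ (-1) * \1_(~` Z) x.
have gE i j x : score f theta i x * score f theta j x * f theta x = g i j x.
  rewrite /g; have [Zx|Zx] := pselect (Z x).
    have fZ : f theta x = 0 by rewrite /f onE // mulr0.
    by rewrite fZ mulr0 onE // mulr0.
  have [Fx _] := hZ x Zx; have fE : f theta x = F theta x by rewrite /f offE // mulr1.
  rewrite offE // mulr1 powR_inv1 fE //.
  have [->|F0] := eqVneq (F theta x) 0; first by rewrite invr0 !mulr0.
  have fp : 0 < f theta x by rewrite fE lt0r F0.
  have sc k : score f theta k x = H k x / F theta x.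
    have [dk _] := fder x k; rewrite /score (derive_ln fp dk).
    by rewrite (derive_val (is_derive := fder x k)) fE offE // mulr1.
  rewrite !sc; move: (H i x) (H j x) (F theta x) F0 => a b y y0; by field.
have g_meas i j : measurable_fun setT (g i j).
  apply: measurable_funM; last by apply: measurable_indic; apply: measurableC.
  apply: measurable_funM; last by apply: measurableT_comp (measurable_powR _) f_meas.
  by apply: measurable_funM; apply: integrable_measurable (Hint _).
have g_int i j : mu.-integrable setT (EFin \o g i j).
  apply: (le_integrableR measurableT (g_meas i j) _ (cint c _ measurableT)) => x _.
  rewrite /g; have [Zx|Zx] := pselect (Z x); first by rewrite onE // mulr0 normr0.
  have [Fx Hx] := hZ x Zx; rewrite offE // mulr1 /f offE // mulr1 powR_inv1 //.
  have [->|F0] := eqVneq (F theta x) 0; first by rewrite invr0 mulr0 normr0.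
  have Fp : 0 < F theta x by rewrite lt0r F0.
  rewrite normrM [X in _ * X]ger0_norm; last by rewrite invr_ge0.
  by rewrite ler_pdivrMr //; apply: normM_le.
exists (\matrix_(i, j) \int[mu]_x (score f theta i x * score f theta j x * f theta x)).
exists mu, f; split.
- move=> t _; split; first exact: integrable_off.
  move=> B mB.
  have iB : mu.-integrable B (EFin \o f t).
    by apply: integrable_sub => //; apply: integrable_off.
  rewrite -FE // -(Rintegral_off mB mZ Z0 (integrable_measurable (Fint t))) /Rintegral fineK //.
  exact: integrable_fin_num.
- by apply: aeW => x k; have [] := fder x k.
move=> i j; split; last by rewrite mxE.
rewrite (_ : (fun x => score f theta i x * score f theta j x * f theta x) = g i j) //.
by apply/funext.
Qed.

End FisherExistence.

(** * The bounds *)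

Local Open Scope complex_scope.

Theorem theorem2 (R : realType) (d p : nat) (Theta : set 'cV[R]_p)
    (rho : 'cV[R]_p -> 'M[R[i]]_d) (theta : 'cV[R]_p)
    (rho_smooth : smooth_quantum_model Theta rho)
    (theta_in : interior Theta theta)
    (feasible : exists X : 'I_p -> 'M[R[i]]_d, locally_unbiased rho theta X) :
  [/\ (* (i) *)
      forall K : 'M[R]_p, posdef_sym K ->
      forall N : nat, (0 < N)%N ->
      forall (disp : measure_display) (T : measurableType disp)
             (M : povm T R (tensor_dim d N)),
        (exists I : 'M[R]_p,
           is_fisher_information Theta (outcome_law rho M) theta I) /\
        (forall I : 'M[R]_p,
           is_fisher_information Theta (outcome_law rho M) theta I ->
           \tr (K *m (N%:R^-1 *: I)) <= dual_holevo rho theta K),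
      (* (ii), direct *)
      forall G0 I0 : 'M[R]_p, posdef_sym G0 -> calI rho theta I0 ->
        \tr (G0 *m invmx I0) = holevo rho theta G0 ->
        dual_holevo rho theta (invmx I0 *m G0 *m invmx I0)
        = holevo rho theta G0,
      (* (ii), converse *)
      forall K0 I0 : 'M[R]_p, posdef_sym K0 -> calI rho theta I0 ->
        \tr (K0 *m I0) = dual_holevo rho theta K0 ->
        holevo rho theta (I0 *m K0 *m I0) = dual_holevo rho theta K0,
      (* (iii), primal bounds *)
      forall G : 'M[R]_p, posdef_sym G ->
        (holevo rho theta G)%:E
          = ereal_inf [set (\tr (G *m V))%:E | V in calV rho theta] /\
        (exists! V : 'M[R]_p, calV rho theta V /\
           \tr (G *m V) = holevo rho theta G) &
      (* (iii), dual bounds *)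
      forall K : 'M[R]_p, posdef_sym K ->
        (dual_holevo rho theta K)%:E
          = ereal_sup [set (\tr (K *m I))%:E | I in calI rho theta] ].
Proof.
have tT := theta_Theta theta_in.
have pr := state_psd rho_smooth tT.
have ker := kernel_drho rho_smooth theta_in.
have feas : exists Y, (forall j, (Y j) ^t* = Y j) /\ response (drho rho theta) Y = 1%:M.
  by have [X /(locally_unbiasedE rho_smooth theta_in)] := feasible; exists X.
have holE := holevoE rho_smooth theta_in.
have dualE := dual_holevoE rho_smooth theta_in.
rewrite (calVE rho_smooth theta_in) (calIE rho_smooth theta_in).
split.
- move=> K pK N N0 disp T M; split; first exact: fisher_information_exists.
  move=> I /(fisher_information_attainable rho_smooth theta_in N0) hI.
  by rewrite dualE; apply: attain_le_dual.
- by move=> G0 I0; rewrite dualE !holE; apply: dual_of_primal.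
- by move=> K0 I0; rewrite dualE holE; apply: primal_of_dual.
- move=> G pG; rewrite holE; split; first exact: hol_ereal_inf.
  exact: inV_minimizer.
- by move=> K pK; rewrite dualE; apply: dual_ereal_sup.
Qed.
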